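(* Let $p$ be a prime and $\alpha,\beta$ integers different from $1$, and assume that either $p>3$, or $p=3$ and neither $\alpha$ nor $\beta$ is congruent to $7$ modulo $9$. Suppose $v_p(\alpha-1)=v_p(\beta-1)=m>0$ and $2\ell=3m$, where $\ell=v_p(\alpha-\beta)$. Write $\alpha=1+p^m u$ with $p\nmid u$ and $\alpha-\beta=p^\ell k$ with $p\nmid k$, and set $s=v_p(2k^2-u^3)$. Then the nilpotency class $f$ of $G_p$ is $5$ if $s=0$ and $6$ if $s>0$. Moreover, if $0\le s\le m/2$ then $|G_p|=p^{s+13m/2}$, $o(a)=o(b)=p^{s+5m/2}$ and $o(c)=p^{2m+s}$; while if $s\ge m/2$ then $|G_p|=p^{7m}$, $o(a)=o(b)=p^{3m}$ and $o(c)=p^{5m/2}$.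
   Context: $G(\alpha,\beta)=\langle A,B\mid A^{[A,B]}=A^{\alpha},\ B^{[B,A]}=B^{\beta}\rangle$ with $[x,y]=x^{-1}y^{-1}xy$, $y^x=x^{-1}yx$, and $C=[A,B]$. The group $G(\alpha,\beta)$ is finite and nilpotent, hence the direct product of its Sylow subgroups; $G_p$ denotes its Sylow $p$-subgroup and $a,b,c$ denote the images of $A,B,C$ under the canonical projection $G(\alpha,\beta)\to G_p$. $v_p$ is the $p$-adic valuation and $o(x)$ the order of $x$. *)

(* Defs.v *)
From mathcomp Require Import all_boot all_order all_algebra all_fingroup all_solvable.
Set Implicit Arguments. Unset Strict Implicit. Unset Printing Implicit Defensive.
Import GRing.Theory Num.Theory.

Definition zpowg (gT : finGroupType) (x : gT) (n : int) : gT :=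
  match n with
  | Posz k => (x ^+ k)%g
  | Negz k => ((x ^+ k.+1)^-1)%g
  end.

(* The defining relations of G(alpha,beta), with the paper's conventions
   [x,y] = x^-1 y^-1 x y and y^x = x^-1 y x, which coincide with mathcomp's
   [~ x, y] and (y ^ x)%g. *)
Definition Grels (alpha beta : int) (hT : finGroupType) (x y : hT) : Prop :=
  (x ^ [~ x, y])%g = zpowg x alpha /\ (y ^ [~ y, x])%g = zpowg y beta.

(* (G, A, B) is a (finite) model of the presentation
   <A, B | A^[A,B] = A^alpha, B^[B,A] = B^beta>:
   G is generated by A, B which satisfy the relations, and G has the
   universal property with respect to all finite groups.  Since G(alpha,beta)
   is finite, this characterizes G(alpha,beta) up to isomorphism. *)
Definition presents (alpha beta : int) (gT : finGroupType) (G : {group gT})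
    (A B : gT) : Prop :=
  [/\ G :=: <<[set A; B]>>%g,
      Grels alpha beta A B &
      forall (hT : finGroupType) (x y : hT), Grels alpha beta x y ->
        exists f : {morphism G >-> hT}, f A = x /\ f B = y].

Definition vp (p : nat) (x : int) : nat := logn p `|x|%N.

(* Main.v *)
Require Import Defs.
From mathcomp Require Import all_boot all_order all_algebra all_fingroup all_solvable.
From mathcomp Require Import ring zify.
Set Implicit Arguments. Unset Strict Implicit. Unset Printing Implicit Defensive.
Import GRing.Theory Num.Theory.

(* Put m = 2n, l = 3n, e = p^n, D = 2k^2 - u^3 and s = min(v_p(D), n).

   In any finite group with these relations A^B = AC, so C normalises
   <A> and <B>, and B^(A^t) becomes explicit.  If the centre is trivial,
   computing B^(A^t) for t = alpha^j in two ways puts a power of A into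
   <A> and <B> at once, hence into the centre; this forces alpha = 1 modulo
   every prime dividing the order of A, and suitable powers of
   the q-parts of A, B and C (q prime) are then central.  So every finite quotient is nilpotent.

   In the Sylow p-subgroup the same computation, with exponents expanded
   e-adically, gives c^(u e^4) = a^(2k e^5) = b^(2k e^5) and a^(e^5) = b^(e^5)
   of order dividing gcd(D, e).  As the subgroup is the product <a><c><b>, its
   order is at most p^(13n+s); each of the orders of a, b, c is then forced by
   the order of the group, and the upper and lower central series are read off
   the chain a, c, a^(e^2), c^(e^2), a^(e^4), c^(e^4).

   The order p^(13n+s) is attained: A, B and C act on (Z/e^6)^3, whose points
   (i, k, j) stand for A^i C^k B^j acted on by right multiplication, and the
   relations hold modulo translations by an invariant lattice. *)

(** * The relations *)

Section Triples.
Local Open Scope group_scope.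

(** Where D comes from: putting t = alpha in both formulas for B^(A^t) gives a relation A^x = B^h
    C^(alpha - beta), with x and -h both close to e^4 u^2 / 2. Since A^x fixes A, the elements B^h
    and C^(beta - alpha) conjugate A alike, and this yields C^(u e^4) = A^(2k e^5). Raised to the
    power 2e, the same relation yields C^(2k e^4) = A^(2u^2 e^5). Computing C^(2ku e^4) from each
    leaves A^(2D e^5) = 1. Two obstacles shape the details. In the model, A^C = A^alpha fails by a
    defect quadratic in j: its linear part is simply declared to be a lattice vector, but the
    quadratic part must then lie in the lattice too, and this is what forces the generator involving
    D. Exchanging A and B while inverting C preserves the relations, so most statements are proved
    for one side and used twice. *)

Definition geom (b t : nat) : nat := (\sum_(i < t) b ^ i)%N.

Lemma geomS b t : geom b t.+1 = (b * geom b t).+1.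
Proof.
rewrite /geom big_ord_recl expn0 add1n big_distrr /=; congr _.+1.
by apply: eq_bigr => i _; rewrite -expnS.
Qed.

(* (x, y, z) stands for (A, B, [A, B]); the relations are stable under
   (x, y, z, a, b) |-> (y, x, z^-1, b, a). *)
Definition mrels (gT : finGroupType) (a b : nat) (x y z : gT) : Prop :=
  [/\ x ^ z = x ^+ a, y ^ z^-1 = y ^+ b & x ^ y = x * z].

Section Relations.
Variable gT : finGroupType.
Implicit Types (A B C : gT).

Lemma mrels_sym a b A B C : mrels a b A B C -> mrels b a B A C^-1.
Proof.
case=> h1 h2 h3; split; rewrite ?invgK //.
have -> : C = A^-1 * (A ^ B) by rewrite h3 mulKg.
by rewrite /conjg !invMg !invgK !mulgA mulgV mul1g.
Qed.

Lemma mrels_comm a b A B C : mrels a b A B C -> C = [~ A, B].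
Proof. by case=> _ _ h; rewrite commgEl h mulKg. Qed.

Lemma conjX_rel A C a k : A ^ C = A ^+ a -> A ^ (C ^+ k) = A ^+ (a ^ k).
Proof.
move=> h; elim: k => [|k IHk]; first by rewrite conjg1 expg1.
by rewrite expgSr conjgM IHk conjXg h -expgM expnS.
Qed.

Lemma conjXX_rel A C a k i :
  A ^ C = A ^+ a -> (A ^+ i) ^ (C ^+ k) = A ^+ (i * a ^ k).
Proof. by move=> h; rewrite conjXg (conjX_rel _ h) -expgM mulnC. Qed.

Lemma mulXC_rel A C a k i :
  A ^ C = A ^+ a -> A ^+ i * C ^+ k = C ^+ k * A ^+ (i * a ^ k).
Proof. by move=> h; rewrite -(conjXX_rel _ _ h) -conjgC. Qed.

Lemma mulXV_rel A C a k i :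
  A ^ C = A ^+ a -> C ^- k * A ^+ i = A ^+ (i * a ^ k) * C ^- k.
Proof.
move=> h; apply: (mulgI (C ^+ k)); apply: (mulIg (C ^+ k)).
by rewrite mulKVg mulgA mulgKV (mulXC_rel _ _ h).
Qed.

Lemma expMC_rel A C a t :
  A ^ C = A ^+ a -> (A * C) ^+ t = C ^+ t * A ^+ (a * geom a t).
Proof.
move=> h; elim: t => [|t IHt]; first by rewrite /geom big_ord0 muln0 mulg1.
rewrite expgSr IHt mulgA -[_ * A]mulgA -expgSr -geomS -mulgA.
rewrite -[X in _ * (_ * X)](expg1 C) (mulXC_rel 1 _ h) mulgA -expgD addn1.
by rewrite mulnC expn1.
Qed.

(** It suffices to know (A^t)^B = (A C)^t: collecting the factors C on the left turns it into C^t
    A^(a + a^2 + ... + a^t), and B^(A^t) is B times the inverse of this times A^t. *)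
Lemma conj_powA a b A B C t : mrels a b A B C ->
  B ^ (A ^+ t) = B * A ^- (a * geom a t) * A ^+ (t * a ^ t) * C ^- t.
Proof.
case=> h1 h2 h3; have e : (A ^+ t) ^ B = C ^+ t * A ^+ (a * geom a t).
  by rewrite conjXg h3 (expMC_rel _ h1).
have -> : B ^ (A ^+ t) = B * ((A ^+ t) ^ B)^-1 * A ^+ t.
  by rewrite -conjVg /conjg !mulgA mulgV mul1g.
by rewrite e invMg -!mulgA (mulXV_rel _ _ h1).
Qed.

Lemma mulXA a b A B C j : mrels a b A B C ->
  B ^+ j * A = A * C ^- j * B ^+ (b * geom b j).
Proof.
move=> h; have [h1 _ h3] := mrels_sym h.
by rewrite conjgC conjXg h3 (expMC_rel _ h1) expgVn mulgA.
Qed.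

(** The second way to compute the same conjugate: A^(a^j) is the conjugate of A by C^j, so B may be
    conjugated by C^-j, which raises it to the power b^j, then by A, then by C^j. Comparison with
    [conj_powA] drives both the nilpotency proof and the relations between powers. *)
Lemma conj_powAC a b A B C j : mrels a b A B C ->
  B ^ (A ^+ (a ^ j)) =
    C ^- (b ^ j) * (B ^+ (b * geom b (b ^ j))) ^ (C ^+ j).
Proof.
move=> h; have [h1 h2 h3] := h; have [h1' _ h3'] := mrels_sym h.
rewrite -(conjX_rel _ h1).
have -> : B ^ (A ^ (C ^+ j)) = ((B ^ (C ^- j)) ^ A) ^ (C ^+ j).
  by rewrite -!conjgM /conjg !invMg !invgK !mulgA.
rewrite -expgVn (conjX_rel _ h2) conjXg h3' (expMC_rel _ h1') conjMg expgVn.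
by congr (_ * _); rewrite conjVg conjXg (conjgE C) (commuteX j (commute_refl C)) mulKg.
Qed.

End Relations.

End Triples.

(** * Nilpotency *)

Lemma totient_ltn n : (1 < n)%N -> (totient n < n)%N.
Proof.
case: n => [|n] // n_gt0; rewrite totient_count_coprime big_nat_recl //.
rewrite /coprime gcdn0 gtn_eqF // add0n ltnS -[leqRHS]subn0.
rewrite -[leqRHS]muln1 -sum_nat_const_nat; apply: leq_sum => i _.
by case: (_ == _).
Qed.

Lemma geom_natr (R : pzRingType) b t :
  ((geom b t)%:R = \sum_(i < t) b%:R ^+ i :> R)%R.
Proof. by rewrite /geom natr_sum; apply: eq_bigr => i _; rewrite natrX. Qed.

Lemma Fp_natr_eq p m n : prime p -> (m%:R == n%:R :> 'F_p)%R = (m == n %[mod p]).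
Proof.
move=> p_pr; rewrite -(inj_eq val_inj) /= !val_Fp_nat //.
Qed.

(* A base whose order mod p equals d satisfies x^t = x for t = a^(phi(d)),
   which forces d | phi(d), i.e. d = 1. *)
Lemma tower_congr p r a :
  prime p -> (0 < r)%N -> coprime a r -> p %| r -> a ^ r = 1 %[mod p] ->
  (forall j, let t := a ^ j in
     ((a%:R - 1) * a%:R ^+ j * a%:R ^+ t + a%:R = a%:R ^+ t.+1 :> 'F_p)%R) ->
  a = 1 %[mod p].
Proof.
move=> p_pr r_gt0 co_ar p_r ar1 E; apply/eqP; rewrite -Fp_natr_eq //.
set x : 'F_p := (a%:R)%R in E *.
have xr1 : (x ^+ r = 1)%R.
  by apply/eqP; rewrite -natrX -[X in _ == X]/(1%:R)%R Fp_natr_eq //; apply/eqP.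
have [d prim_d d_r] := prim_order_exists r_gt0 xr1.
have co_ad : coprime a d := coprime_dvdr d_r co_ar.
have d_gt0 : (0 < d)%N := dvdn_gt0 r_gt0 d_r.
have := E (totient d); cbv zeta.
set t := a ^ _.
have xt : (x ^+ t = x)%R.
  rewrite -(prim_expr_mod prim_d t) (Euler_exp_totient co_ad).
  by rewrite (prim_expr_mod prim_d) expr1.
rewrite exprS xt => /eqP; rewrite -subr_eq0.
have -> : ((x - 1) * x ^+ totient d * x + x - x * x =
           x * (x - 1) * (x ^+ totient d - 1))%R.
  by ring.
rewrite !mulf_eq0 !subr_eq0.
have /negPf -> : (x != 0)%R.
  apply: contra_eq_neq xr1 => ->.
  by rewrite expr0n gtn_eqF // eq_sym oner_neq0.
rewrite /= => /orP[//|]; rewrite -(prim_order_dvd prim_d) => d_dvd.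
have d_le : (d <= totient d)%N by rewrite dvdn_leq // totient_gt0.
have d1 : d = 1%N.
  apply/eqP; rewrite eqn_leq d_gt0 andbT leqNgt; apply/negP => /totient_ltn.
  by rewrite ltnNge d_le.
by rewrite -(expr1 x) -[in X in (_ ^+ X)%R]d1 (prim_expr_order prim_d).
Qed.

(** Lifting the exponent: split a prime q off N and put x = a^(N/q). In x^q - 1 = (x - 1)(1 + ... +
    x^(q-1)) the second factor is a sum of q terms congruent to 1 modulo q. It serves to show that
    C^N centralises elements of order dividing M N on which C acts as the power a. *)
Lemma exp_congr_dvd a N M :
  (forall q, prime q -> q %| N -> a = 1 %[mod q]) -> a = 1 %[mod M] ->
  a ^ N = 1 %[mod M * N].
Proof.
have dvd1 x m : (0 < x)%N -> x = 1 %[mod m] <-> m %| x - 1.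
  by move=> x_gt0; rewrite -eqn_mod_dvd //; split=> /eqP.
case: (posnP a) => [-> hN hM | a_gt0].
  case: (posnP N) => [->|N_gt0]; first by rewrite expn0 muln0.
  have N1 : N = 1%N.
    apply/eqP; rewrite eqn_leq N_gt0 andbT leqNgt; apply/negP => N_gt1.
    have := hN _ (pdiv_prime N_gt1) (pdiv_dvd N).
    by rewrite mod0n modn_small ?prime_gt1 ?pdiv_prime.
  by rewrite N1 expn1 muln1.
elim/ltn_ind: N => N IHN hN hM.
have [N_le1|N_gt1] := leqP N 1.
  by case: N N_le1 {IHN hN} => [|[]] //; rewrite ?muln0 ?expn0 ?muln1 ?expn1.
set q := pdiv N; have q_pr : prime q := pdiv_prime N_gt1.
have qN : q %| N := pdiv_dvd N.
have /dvdnP[N' NE] := qN.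
have N'_gt0 : (0 < N')%N by case: N' NE N_gt1 => // ->.
have N'_lt : (N' < N)%N by rewrite NE -[ltnLHS]muln1 ltn_pmul2l // prime_gt1.
have IH : a ^ N' = 1 %[mod M * N'].
  apply: IHN => // l l_pr lN'; apply: hN => //.
  by rewrite NE dvdn_mulr.
have x_gt0 : (0 < a ^ N')%N by rewrite expn_gt0 a_gt0.
have xq1 : a ^ N' = 1 %[mod q].
  by rewrite -modnXm (hN q) // modnXm exp1n.
clearbody q; rewrite NE expnM mulnA; apply/dvd1; first by rewrite expn_gt0 x_gt0.
rewrite -[X in _ - X](exp1n q) subn_exp dvdn_mul //; first exact/dvd1.
rewrite /dvdn -modn_summ.
rewrite (eq_bigr (fun=> 1 %% q)) => [|i _]; last first.
  by rewrite exp1n muln1 -modnXm xq1 modnXm exp1n.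
by rewrite sum_nat_const card_ord modnMmr muln1 modnn.
Qed.

(** By geom a (ts) = geom a t * geom (a^t) s the sum splits into f factors, each with q terms
    congruent to 1 modulo q. *)
Lemma geom_dvd q a f : prime q -> a = 1 %[mod q] -> q ^ f %| geom a (q ^ f).
Proof.
move=> q_pr a1; elim: f => [|f IHf]; first exact: dvd1n.
have gM t s : geom a (t * s) = geom a t * geom (a ^ t) s.
  elim: s => [|s IHs]; first by rewrite muln0 /geom !big_ord0 muln0.
  have -> : geom (a ^ t) s.+1 = geom (a ^ t) s + a ^ (t * s).
    by rewrite /geom big_ord_recr /= expnM.
  have -> : geom a (t * s.+1) = geom a (t * s) + a ^ (t * s) * geom a t.
    rewrite mulnS addnC /geom big_split_ord /= big_distrr /=; congr addn.
    by apply: eq_bigr => i _; rewrite expnD.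
  by rewrite IHs mulnDr [a ^ _ * _]mulnC.
rewrite [in X in _ %| X]expnSr gM expnSr dvdn_mul // /dvdn /geom -modn_summ.
rewrite (eq_bigr (fun=> 1 %% q)) => [|i _]; last first.
  by rewrite -expnM -modnXm a1 modnXm exp1n.
by rewrite sum_nat_const card_ord modnMmr muln1 modnn.
Qed.

Section Nilpotency.
Local Open Scope group_scope.

Lemma gen2_centP (gT : finGroupType) (A B x : gT) :
  reflect (commute x A /\ commute x B) (x \in 'C(<<[set A; B]>>)).
Proof.
rewrite cent_gen; apply: (iffP centP) => [h|[hA hB] y].
  by split; apply: h; rewrite !inE eqxx ?orbT.
by rewrite !inE => /orP[] /eqP->.
Qed.

Lemma centerless1 (gT : finGroupType) (A B x : gT) :
  'Z(<<[set A; B]>>) = 1 -> x \in <<[set A; B]>> ->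
  commute x A -> commute x B -> x = 1.
Proof.
move=> Z1 xG xA xB; apply/set1gP; rewrite -Z1 inE xG.
exact/gen2_centP.
Qed.

Lemma conjX_norm (gT : finGroupType) (x y : gT) k :
  x ^ y = x ^+ k -> y \in 'N(<[x]>).
Proof. by move=> h; rewrite inE -cycleJ h cycleX. Qed.

(** Comparing the two formulas for B^(A^t) gives e = B^-1 C^(-b^j) Y C^t with Y in <B>. In e^C e^-1
    the powers of C cancel up to conjugation, and C normalises <B>. Since e is a power of A, the
    element lies in <A> as well. *)
Lemma tower_cycle (gT : finGroupType) (A B C : gT) a b j :
  mrels a b A B C ->
  let t := (a ^ j)%N in let e := A ^- (a * geom a t) * A ^+ (t * a ^ t) in
  e ^ C * e^-1 \in <[B]>.
Proof.
move=> rels; cbv zeta; set t := (a ^ j)%N.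
set e := A ^- (a * geom a t) * A ^+ (t * a ^ t); have [h1 h2 _] := rels.
have nB : C \in 'N(<[B]>) by rewrite -groupV (conjX_norm h2).
set Y := (B ^+ (b * geom b (b ^ j))) ^ (C ^+ j).
have YB : Y \in <[B]> by rewrite memJ_norm ?mem_cycle // groupX.
have eE : e = B^-1 * C ^- (b ^ j) * Y * C ^+ t.
  have := conj_powA t rels; rewrite (conj_powAC j rels) -/t -/Y => E.
  have shift (w y0 e0 x : gT) : w * y0 = B * e0 * x^-1 -> e0 = B^-1 * w * y0 * x.
    by move=> E0; rewrite -[B^-1 * w * y0]mulgA E0 -[B * e0 * _]mulgA mulKg mulgKV.
  by apply: shift; rewrite E /e !mulgA.
have -> : e ^ C * e^-1 = (B^-1) ^ C * ((Y ^ C * Y^-1) ^ (C ^+ (b ^ j))) * B.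
  have shift (x y w c r : gT) :
      x * c^-1 * y * r * (r^-1 * (w * (c * B))) = x * (y * w) ^ c * B.
    by rewrite conjgE !mulgA mulgK.
  have cC i : (C ^+ i) ^ C = C ^+ i.
    by rewrite conjgE -(commuteX i (commute_refl C)) mulKg.
  rewrite -(shift _ _ _ _ (C ^+ t)) eE !invMg !invgK 3!conjMg (conjVg (C ^+ _)) !cC.
  by rewrite !mulgA.
rewrite groupM ?cycle_id // groupM // memJ_norm ?groupV ?cycle_id //.
  by rewrite groupM ?groupV // memJ_norm.
by rewrite groupX.
Qed.

(** * Trivial centre: the exponents are 1 modulo the primes dividing the orders *)

Section Centerless.
Variables (gT : finGroupType) (A B C : gT) (a b : nat).
Let G := <<[set A; B]>>.
Hypotheses (rels : mrels a b A B C) (Z1 : 'Z(G) = 1).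

Lemma relA_in : A \in G. Proof. by rewrite mem_gen // !inE eqxx. Qed.
Lemma relB_in : B \in G. Proof. by rewrite mem_gen // !inE eqxx orbT. Qed.

Lemma centerless_coprime : coprime a #[A].
Proof.
have [h1 _ _] := rels.
have := orderXgcd A a; rewrite -h1 orderJ => E.
rewrite coprime_sym /coprime eqn_leq gcdn_gt0 order_gt0 andbT leqNgt.
by apply/negP => /(ltn_Pdiv)/(_ (order_gt0 A)); rewrite -E ltnn.
Qed.

(** At t = #[A] the formula for B^(A^t) puts C^t in <A>. So C^t centralises A, while it also acts on
    A as the power a^t. *)
Lemma order_exp_congr : a ^ #[A] = 1 %[mod #[A]].
Proof.
have [h1 _ _] := rels.
have := conj_powA #[A] rels; rewrite !expg_order conjg1 => E.
have CA : C ^+ #[A] \in <[A]>.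
  suff -> : C ^+ #[A] = A ^- (a * geom a #[A]) * A ^+ (#[A] * a ^ #[A]).
    by rewrite groupM ?groupV ?mem_cycle.
  apply: (mulIg (C ^- #[A])); rewrite mulgV; apply: (mulgI B).
  by rewrite mulg1 !mulgA -E.
have /cycleP[i Ci] := CA.
apply/eqP; rewrite -eq_expg_mod_order -(conjX_rel _ h1) expg1 Ci.
by rewrite conjgE (commuteX i (commute_refl A)) mulKg.
Qed.

(** The element of [tower_cycle] commutes with both generators, so it is trivial here; the resulting
    e^C = e is an equality of exponents of A, rearranged to avoid negative terms. *)
Lemma centerless_tower j : let t := (a ^ j)%N in
  A ^+ (t * a ^ t * a + a * geom a t) = A ^+ (t * a ^ t + a * geom a t * a).
Proof.
move=> t; have [h1 h2 _] := rels.
set e := A ^- (a * geom a t) * A ^+ (t * a ^ t).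
have eA : e \in <[A]> by rewrite groupM ?groupV ?mem_cycle.
have nA : C \in 'N(<[A]>) := conjX_norm h1.
have zB : e ^ C * e^-1 \in <[B]> := tower_cycle j rels.
have zA : e ^ C * e^-1 \in <[A]> by rewrite groupM ?groupV // memJ_norm.
have /eqP : e ^ C * e^-1 = 1.
  apply: centerless1 Z1 _ _ _.
  - by rewrite (subsetP _ _ zA) // cycle_subG relA_in.
  - by have /cycleP[i ->] := zA; apply/commute_sym/commuteX.
  - by have /cycleP[i ->] := zB; apply/commute_sym/commuteX.
rewrite -eq_mulgV1 /e conjMg conjVg !conjXg h1 -!expgM => /eqP E.
have cA i k : A ^+ i * A ^+ k = A ^+ k * A ^+ i by rewrite -!expgD addnC.
rewrite [(t * a ^ t * a)%N]mulnC expgD.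
have -> : A ^+ (a * (t * a ^ t)) =
    A ^+ (a * (a * geom a t)) * (A ^- (a * geom a t) * A ^+ (t * a ^ t)).
  by rewrite -E mulKVg.
by rewrite -!mulgA cA mulKg cA -expgD [(_ * a)%N in RHS]mulnC.
Qed.

(** Modulo q the geometric sum g occurs only in (x - 1) g = x^t - 1, and the coefficient t becomes
    x^j. Eliminating g from [centerless_tower] leaves exactly the hypothesis of [tower_congr]. *)
Lemma centerless_base q : prime q -> q %| #[A] -> a = 1 %[mod q].
Proof.
move=> q_pr qA; apply: (@tower_congr q #[A]) => //.
- exact: centerless_coprime.
- by apply/eqP; rewrite -(eqn_modDl 0) !add0n; apply/eqP;
    rewrite -(modn_dvdm _ qA) order_exp_congr modn_dvdm.
move=> j t.
have /eqP := centerless_tower j; rewrite -/t eq_expg_mod_order => /eqP E.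
have {}E : (t * a ^ t * a + a * geom a t)%N
         = (t * a ^ t + a * geom a t * a)%N %[mod q].
  by rewrite -(modn_dvdm _ qA) E modn_dvdm.
move/eqP: E; rewrite -Fp_natr_eq // !natrD !natrM !geom_natr !natrX.
set x : 'F_q := (a%:R)%R => /eqP E.
have x0 : (x != 0)%R.
  rewrite -[(0 : 'F_q)%R]/(0%:R)%R Fp_natr_eq // mod0n -/(dvdn _ _).
  by rewrite -prime_coprime // coprime_sym (coprime_dvdr qA centerless_coprime).
apply: (mulfI x0); rewrite exprS.
have := subrX1 x t; set g := (\sum_(i < t) _)%R in E * => E'.
have {}E' : (x ^+ t = 1 + (x - 1) * g)%R by rewrite -E' addrC subrK.
have {}E : (x ^+ j * x ^+ t * (x - 1) = x * g * (x - 1))%R.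
  by move/eqP: E; rewrite -subr_eq0 => /eqP E; apply/eqP; rewrite -subr_eq0;
     apply/eqP; rewrite -E; ring.
have -> : (x * ((x - 1) * x ^+ j * x ^+ t + x) =
           x * (x ^+ j * x ^+ t * (x - 1)) + x * x)%R by ring.
by rewrite E E'; ring.
Qed.

End Centerless.

(** * Splitting the relations into primary parts *)

Section Parts.
Variables (gT : finGroupType).
Implicit Types (A B C : gT) (pi : nat_pred).

(** With N the order of the pi-part of A, C^N acts on that part as the power a^N, and a^N is 1
    modulo N. The pi'-part of C has order prime to N, so it is a power of C^N. *)
Lemma commute_constt A C a pi :
  (forall q, prime q -> q %| #[A] -> a = 1 %[mod q]) ->
  A ^ C = A ^+ a -> commute A.`_pi C.`_pi^'.
Proof.
move=> a1 h; set x := A.`_pi; set N := #[x].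
have hx : x ^ C = x ^+ a by rewrite -consttJ h consttX.
have aN1 : a ^ N = 1 %[mod N].
  rewrite -{2 3}[N]mul1n; apply: exp_congr_dvd; last by rewrite !modn1.
  move=> q q_pr qN; apply: a1 => //; apply: dvdn_trans qN _.
  by rewrite /N /x order_constt dvdn_part.
have cx : commute x (C ^+ N).
  apply/commgP/conjg_fixP; rewrite (conjX_rel _ hx).
  by apply/eqP; rewrite -[X in _ == X]expg1 eq_expg_mod_order; apply/eqP.
have co : coprime #[C.`_pi^'] N.
  rewrite /N /x !order_constt coprime_sym; apply: (@pnat_coprime pi).
    exact: part_pnat.
  exact: part_pnat.
have [k ->] : exists k, C.`_pi^' = (C ^+ N) ^+ k.
  have /cycleP[i Ci] : C.`_pi^' \in <[C]> by rewrite mem_cycle.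
  have : C.`_pi^' \in <[C.`_pi^' ^+ N]>.
    have : generator <[C.`_pi^']> (C.`_pi^' ^+ N) by rewrite generator_coprime.
    by rewrite /generator => /eqP <-; apply: cycle_id.
  case/cycleP => k; rewrite {2}Ci -!expgM mulnCA expgM => ->.
  by exists (i * k)%N.
exact: commuteX.
Qed.

Lemma constt_mul_pelt A C a pi : A ^ C = A ^+ a -> pi.-elt (A.`_pi * C.`_pi).
Proof.
move=> h; rewrite -(p_eltJ _ _ A.`_pi) conjgE -mulgA mulKg; apply: p_eltM_norm.
- apply: groupX; apply: (@conjX_norm _ _ _ a).
  by rewrite -consttJ h consttX.
- exact: p_elt_constt.
- exact: p_elt_constt.
Qed.

Lemma constt_mulC A C a pi :
  (forall q, prime q -> q %| #[A] -> a = 1 %[mod q]) ->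
  A ^ C = A ^+ a -> (A * C).`_pi = A.`_pi * C.`_pi.
Proof.
move=> a1 h.
have c1 : commute A.`_pi C.`_pi^' := commute_constt pi a1 h.
have c2 : commute A.`_pi^' C.`_pi.
  by have := commute_constt pi^' a1 h; rewrite consttNK.
have cc (x : gT) (p1 p2 : nat_pred) : commute x.`_p1 x.`_p2.
  exact: commuteX2.
have c3 : commute (A.`_pi * C.`_pi) (A.`_pi^' * C.`_pi^').
  by apply: commuteM; apply: commute_sym; apply: commuteM => //;
    apply: commute_sym.
have pe (p1 : nat_pred) : p1.-elt (A.`_p1 * C.`_p1) := constt_mul_pelt p1 h.
have -> : A * C = A.`_pi * C.`_pi * (A.`_pi^' * C.`_pi^').
  rewrite -{1}(consttC pi A) -{1}(consttC pi C) -!mulgA; congr (_ * _).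
  by rewrite !mulgA c2.
rewrite consttM // (constt_p_elt (pe pi)).
have -> : (A.`_pi^' * C.`_pi^').`_pi = 1 by apply/constt1P; apply: pe.
by rewrite mulg1.
Qed.

Variables (A B C : gT) (a b : nat).
Hypothesis rels : mrels a b A B C.
Hypothesis a1 : forall q, prime q -> q %| #[A] -> a = 1 %[mod q].
Hypothesis b1 : forall q, prime q -> q %| #[B] -> b = 1 %[mod q].

Lemma conj_constt pi :
  A.`_pi ^ B.`_pi = A.`_pi * C.`_pi /\ commute A.`_(pi^') B.`_pi.
Proof.
have [h1 _ _] := rels; have [h1' _ h3'] := mrels_sym rels.
have BA : B.`_pi ^ A = B.`_pi * (C.`_pi)^-1.
  by rewrite -consttJ h3' (constt_mulC _ b1) // consttV.
have AB : A ^ B.`_pi = A * C.`_pi.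
  have -> : C.`_pi = (B.`_pi ^ A)^-1 * B.`_pi.
    by rewrite BA invMg invgK mulgKV.
  by rewrite /conjg !invMg invgK !mulgA mulgV mul1g.
have c1 : commute A.`_(pi^') C.`_pi.
  by have := commute_constt (pi^') a1 h1; rewrite consttNK.
have c2 : commute A.`_(pi^') A.`_pi by exact: commuteX2.
have E : A * C.`_pi = A.`_pi * C.`_pi * A.`_(pi^').
  by rewrite -{1}(consttC pi A) -mulgA c1 mulgA.
have c3 : commute (A.`_pi * C.`_pi) A.`_(pi^').
  by apply: commute_sym; apply: commuteM.
have pe := constt_mul_pelt pi h1.
have npe : (pi^').-elt A.`_(pi^') := p_elt_constt _ _.
split.
  rewrite -consttJ AB E consttM // (constt_p_elt pe).
  have -> : (A.`_(pi^')).`_pi = 1 by apply/constt1P.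
  by rewrite mulg1.
apply/commgP/conjg_fixP; rewrite -consttJ AB E consttM // (constt_p_elt npe).
have -> : (A.`_pi * C.`_pi).`_(pi^') = 1.
  by apply/constt1P; rewrite /p_elt (eq_pnat _ (negnK pi)).
by rewrite mul1g.
Qed.

(** Nilpotency is not yet known at this point, so taking pi-parts need not be multiplicative; that
    it respects these relations rests on the congruences for a and b. *)
Lemma mrels_constt pi : mrels a b A.`_pi B.`_pi C.`_pi.
Proof.
have [h1 h2 h3] := rels; have [h1' _ h3'] := mrels_sym rels.
have aux (X Y : gT) k : (forall q, prime q -> q %| #[X] -> k = 1 %[mod q]) ->
    X ^ Y = X ^+ k -> X.`_pi ^ Y.`_pi = X.`_pi ^+ k.
  move=> k1 h; have E : X.`_pi ^ Y = X.`_pi ^+ k by rewrite -consttJ h consttX.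
  have c : commute X.`_pi Y.`_pi^' := commute_constt pi k1 h.
  rewrite -E -[in RHS](consttC pi Y).
  have -> : Y.`_pi * Y.`_pi^' = Y.`_pi^' * Y.`_pi by apply: commuteX2.
  by rewrite conjgM; congr (_ ^ _); apply/esym/conjg_fixP/commgP.
split; first exact: aux.
  by rewrite -consttV; apply: aux.
by have [] := conj_constt pi.
Qed.

End Parts.

(* An automorphism x |-> x^c of l-power order of a group of order l is trivial. *)
Lemma conj_prime_fix (gT : finGroupType) (l c k : nat) (x y : gT) :
  prime l -> x ^+ l = 1 -> y ^+ (l ^ k) = 1 -> x ^ y = x ^+ c -> x ^ y = x.
Proof.
move=> l_pr xl yk h.
have fermat : c ^ (l ^ k) = c %[mod l].
  elim: k {yk} => [|k IHk]; first by rewrite expn1.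
  by rewrite expnSr expnM fermat_little.
have E : x = x ^+ (c ^ (l ^ k)).
  by rewrite -(conjX_rel (l ^ k) h) yk conjg1.
by rewrite h -(expg_mod c xl) -fermat (expg_mod _ xl) -E.
Qed.

Section PrimePart.
Variables (gT : finGroupType) (x y z : gT) (a b l : nat).
Hypotheses (rels : mrels a b x y z) (l_pr : prime l).
Hypothesis a1 : x != 1 -> a = 1 %[mod l].
Variable f : nat.
Hypothesis xf : x ^+ (l ^ f.+1) = 1.

Lemma commute_pow_prime : commute x (z ^+ (l ^ f)).
Proof.
have [h1 _ _] := rels.
have [-> | x1] := eqVneq x 1; first exact/commute_sym/commute1.
have := @exp_congr_dvd a (l ^ f) l; rewrite -expnS => E.
apply/commgP/conjg_fixP; rewrite (conjX_rel _ h1) -(expg_mod _ xf) E ?a1 //.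
  by rewrite (expg_mod _ xf) expg1.
move=> q q_pr; rewrite Euclid_dvdX // dvdn_prime2 // => /andP[/eqP-> _].
exact: a1.
Qed.

(** Let X = x^(l^f), so X^l = 1. As l^f divides [geom a (l ^ f)], [conj_powA] at t = l^f shows that
    y normalises <X>, and an element of l-power order acts trivially on a group of order l. *)
Lemma conj_pow_prime k :
  y ^+ (l ^ k) = 1 -> z ^+ (l ^ f) = 1 -> commute (x ^+ (l ^ f)) y.
Proof.
move=> yk z1; have [-> | x1] := eqVneq x 1.
  by rewrite expg1n; apply/commute_sym/commute1.
set X := x ^+ (l ^ f); have Xl : X ^+ l = 1 by rewrite /X -expgM -expnSr.
have /dvdnP[g gE] := geom_dvd f l_pr (a1 x1).
have := conj_powA (l ^ f) rels; rewrite z1 invg1 mulg1.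
have -> : (a * geom a (l ^ f) = l ^ f * (a * g))%N by rewrite gE mulnA mulnC.
rewrite !(expgM x (l ^ f)) -/X -mulgA; set W := _^-1 * _ => E.
have {}E : X^-1 ^ y = W * X^-1.
  by apply: (mulgI y); rewrite -conjgC mulgA -E conjgE -mulgA mulgK.
have : X^-1 ^ y \in <[X^-1]>.
  by rewrite E cycleV /W !groupM ?groupV ?cycle_id ?mem_cycle.
case/cycleP => c Ec.
have Xl' : X^-1 ^+ l = 1 by rewrite expgVn Xl invg1.
have /conjg_fixP/commgP cXy := conj_prime_fix l_pr Xl' yk Ec.
by rewrite -[X]invgK; apply/commute_sym/commuteV/commute_sym.
Qed.

End PrimePart.

Section CenterlessTrivial.
Variables (gT : finGroupType) (A B C : gT) (a b : nat).
Let G := <<[set A; B]>>.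
Hypotheses (rels : mrels a b A B C) (Z1 : 'Z(G) = 1).

Lemma centerless_constt l : prime l -> A.`_l = 1 /\ B.`_l = 1.
Proof.
move=> l_pr.
have Z1' : 'Z(<<[set B; A]>>) = 1 by rewrite setUC.
have a1 := centerless_base rels Z1.
have b1 := centerless_base (mrels_sym rels) Z1'.
have rl := mrels_constt rels a1 b1 l.
have [h1 h2 _] := rels.
have pbase (X : gT) k : (forall q, prime q -> q %| #[X] -> k = 1 %[mod q]) ->
    X.`_l != 1 -> k = 1 %[mod l].
  move=> k1 Xl; apply: k1 => //; apply: contraNT Xl => lX.
  rewrite -order_eq1 order_constt p_part.
  by rewrite lognE l_pr order_gt0 (negPf lX).
have AG : A \in G := relA_in A B.
have BG : B \in G := relB_in A B.
have CG : C \in G by rewrite (mrels_comm rels) groupR.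
have central g : g \in G -> commute g A.`_l -> commute g B.`_l ->
    commute g A.`_(l^') -> commute g B.`_(l^') -> g = 1.
  move=> gG cA cB cA' cB'; apply: centerless1 Z1 gG _ _.
    by rewrite -(consttC l A); apply: commuteM.
  by rewrite -(consttC l B); apply: commuteM.
have cCA : commute C.`_l A.`_(l^').
  by apply: commute_sym; have := commute_constt (l^') a1 h1; rewrite consttNK.
have cCB : commute C.`_l B.`_(l^').
  have := commute_constt (l^') b1 h2; rewrite consttNK consttV => c.
  by rewrite -[C.`_l]invgK; apply/commute_sym/commuteV.
have [_ cAB] := conj_constt rels a1 b1 l.
have [_ cBA] := conj_constt rels a1 b1 (l^'); rewrite consttNK in cBA.
have cself (X : gT) : commute X.`_l X.`_(l^') by exact: commuteX2.
(* Descent: if l^(f+1) kills the l-parts of A and B, the power l^f of the l-part of C is central,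
   hence trivial; this in turn makes the powers l^f of the l-parts of A and B central. *)
have step f : A.`_l ^+ (l ^ f) = 1 -> B.`_l ^+ (l ^ f) = 1 ->
    A.`_l = 1 /\ B.`_l = 1.
  elim: f => [|f IHf]; first by rewrite !expg1.
  move=> Af Bf.
  have powl (g h : gT) : commute g h -> commute (g ^+ (l ^ f)) h.
    by move=> c; apply/commute_sym/commuteX/commute_sym.
  have C1 : C.`_l ^+ (l ^ f) = 1.
    apply: central; rewrite ?groupX //.
    - exact/commute_sym/(commute_pow_prime rl l_pr (pbase _ _ a1) Af).
    - have := commute_pow_prime (mrels_sym rl) l_pr (pbase _ _ b1) Bf.
      by rewrite expgVn => c; rewrite -[_ ^+ _]invgK; apply/commute_sym/commuteV.
    - exact: powl.
    - exact: powl.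
  apply: IHf.
    apply: central; rewrite ?groupX //.
    - exact/powl/commute_refl.
    - exact: conj_pow_prime rl l_pr (pbase _ _ a1) _ Af _ Bf C1.
    - exact/powl/cself.
    - by apply/powl; apply: cBA.
  apply: central; rewrite ?groupX //.
  - apply: conj_pow_prime (mrels_sym rl) l_pr (pbase _ _ b1) _ Bf _ Af _.
    by rewrite expgVn C1 invg1.
  - exact/powl/commute_refl.
  - exact/powl/commute_sym/cAB.
  - exact/powl/cself.
have [i iE] : exists i, #[A.`_l] = (l ^ i)%N.
  by exists (logn l #[A]); rewrite order_constt p_part.
have [j jE] : exists j, #[B.`_l] = (l ^ j)%N.
  by exists (logn l #[B]); rewrite order_constt p_part.
apply: (step (i + j)); rewrite expnD.
  by rewrite -iE expgM expg_order expg1n.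
by rewrite mulnC -jE expgM expg_order expg1n.
Qed.

Lemma centerless_trivial : G = 1.
Proof.
have one (X : gT) : (forall l, prime l -> X.`_l = 1) -> X = 1.
  move=> h; apply/eqP; rewrite -order_eq1; apply: contraT => X1.
  have X_gt1 : (1 < #[X])%N by rewrite ltn_neqAle eq_sym X1 order_gt0.
  have := h _ (pdiv_prime X_gt1) => /(congr1 order); rewrite order1 order_constt.
  move/eqP; rewrite p_part_eq1 mem_primes pdiv_prime // order_gt0.
  by rewrite pdiv_dvd.
have [A1 B1] : A = 1 /\ B = 1.
  by split; apply: one => l /centerless_constt[].
by apply/trivgP; rewrite /G A1 B1 setUid gen_subG.
Qed.

End CenterlessTrivial.

(* Modulo its centre the group satisfies the same relations, so it suffices
   that a group with these relations and trivial centre is trivial. *)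
Theorem mrels_nilpotent (gT : finGroupType) (A B C : gT) a b :
  mrels a b A B C -> nilpotent <<[set A; B]>>.
Proof.
have [n] := ubnP #|<<[set A; B]>>|.
elim: n gT A B C => // n IHn gT A B C /ltnSE leGn rels.
set G := <<[set A; B]>>.
have [Z1|nZ1] := eqVneq 'Z(G) 1.
  by rewrite /G (centerless_trivial rels Z1) nilpotent1.
rewrite -quotient_center_nil.
have AG : A \in G := relA_in A B.
have BG : B \in G := relB_in A B.
have CG : C \in G by rewrite (mrels_comm rels) groupR.
have nZ : G \subset 'N('Z(G)) := normal_norm (center_normal _).
have -> : G / 'Z(G) = <<[set coset 'Z(G) A; coset 'Z(G) B]>>.
  rewrite /quotient morphim_gen; last first.
    by rewrite subUset !sub1set !(subsetP nZ).
  by rewrite morphimU !morphim_set1 // (subsetP nZ).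
have lt : (#|G / 'Z(G)| < #|G|)%N.
  by rewrite ltn_quotient // center_sub.
have [h1 h2 h3] := rels.
have [nA nB nC] : [/\ A \in 'N('Z(G)), B \in 'N('Z(G)) & C \in 'N('Z(G))].
  by split; apply: (subsetP nZ).
apply: (IHn _ _ _ (coset 'Z(G) C)).
  move: lt; rewrite /quotient morphim_gen; last first.
    by rewrite subUset !sub1set nA.
  by rewrite morphimU !morphim_set1 // => /leq_trans; apply.
split.
- by rewrite -morphJ // h1 morphX.
- by rewrite -morphV // -morphJ ?groupV // h2 morphX.
- by rewrite -morphJ // h3 morphM.
Qed.

End Nilpotency.

(** * A permutation model *)

Section PermutationModel.
Local Open Scope ring_scope.

(* Here y plays the role of e^2 / 12, so that alpha = 1 + 12 y u and
   beta = 1 + 12 y v.  When p = 3 only 3 y is divisible by e^2, whence the shape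
   of the hypotheses on y. *)
Section Model.
Variables (R : comPzRingType) (y u v : R).
Hypothesis nil3 : 27 * y ^+ 3 = 0.
Hypothesis nil4 : 9 * y ^+ 4 = 0.
Hypothesis nilj : forall j : R, 9 * y ^+ 3 * (j ^+ 3 - j) = 0.

(** Reduces an equality modulo the nilpotency relations to a polynomial identity for [ring]; X1, X3
    and X4 are the explicit cofactors of the vanishing terms. *)
Lemma nil_eq (X1 X3 X4 j L M : R) :
  L = M + 27 * y ^+ 3 * X1 + 9 * y ^+ 4 * X3 + 9 * y ^+ 3 * (j ^+ 3 - j) * X4 ->
  L = M.
Proof. by rewrite nil3 nil4 nilj !mul0r !addr0. Qed.

(* F(j) = b + b^2 + ... + b^j for b = 1 + 12 y v. *)
Definition Fm (j : R) : R :=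
  j + 6 * y * v * (j ^+ 2 + j) + 24 * y ^+ 2 * v ^+ 2 * (j ^+ 3 - j).

(* a^-k for a = 1 + 12 y u. *)
Definition am (k : R) : R :=
  1 - 12 * y * u * k + 72 * y ^+ 2 * u ^+ 2 * (k ^+ 2 + k).

(* The t-th iterate of Fm is j + 6 y Fx t (t choose 2) j, and the sum of its
   first t iterates is t j + 6 y Fx (t choose 2) (t choose 3) j. *)
Definition Fx (t n2 j : R) : R :=
  v * t * (j ^+ 2 + j) + 4 * y * v ^+ 2 * t * (j ^+ 3 - j)
  + 6 * y * n2 * v ^+ 2 * (j ^+ 2 + j) * (2 * j + 1)
  - 24 * n2 * y ^+ 2 * v ^+ 3 * (j ^+ 2 + j).

Definition Tm (t n2 n3 j : R) : R :=
  t + 12 * y * u * (j * n2 + 6 * y * v * (j ^+ 2 + j) * n3)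
  + 72 * y ^+ 2 * u ^+ 2 * (j ^+ 2 * (2 * n3 + n2) - j * n2).

Lemma Fm_shift j x :
  Fm (j + 6 * y * x) =
  Fm j + 6 * y * x + 36 * y ^+ 2 * v * (2 * j + 1) * x
    - 144 * y ^+ 3 * v ^+ 2 * x.
Proof. by apply: (@nil_eq (16 * j ^+ 2 * v ^+ 2 * x + 8 * v * x ^+ 2)
  (288 * j * v ^+ 2 * x ^+ 2 + 576 * v ^+ 2 * x ^+ 3 * y) (0) j); rewrite /Fm; ring. Qed.

(** Thanks to this recurrence A^B = A C holds exactly in the model, not merely modulo the
    lattice. *)
Lemma Fm_succ j : Fm (j + 1) = (1 + 12 * y * v) * (1 + Fm j).
Proof. by apply: (@nil_eq 0 0 (- 32 * v ^+ 3) j); rewrite /Fm; ring. Qed.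

Lemma Fm_iter t n2 j :
  Fm (j + 6 * y * Fx t n2 j) = j + 6 * y * Fx (t + 1) (n2 + t) j.
Proof.
rewrite Fm_shift.
by apply: (@nil_eq (8 * j * n2 * v ^+ 3 + 40 * j ^+ 2 * n2 * v ^+ 3
  + 64 * j ^+ 3 * n2 * v ^+ 3 + 32 * j ^+ 4 * n2 * v ^+ 3) (- 192 * j * n2 * v ^+ 4
  + 384 * j * n2 * v ^+ 5 * y + 64 * j * t * v ^+ 4 - 576 * j ^+ 2 * n2 * v ^+ 4
  + 384 * j ^+ 2 * n2 * v ^+ 5 * y - 384 * j ^+ 3 * n2 * v ^+ 4
  - 64 * j ^+ 3 * t * v ^+ 4) (32 * j * t * v ^+ 3 + 16 * t * v ^+ 3) j); rewrite /Fm /Fx; ring.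
Qed.

Lemma am_add k l : am (k + l) = am k * am l.
Proof. by apply: (@nil_eq (64 * k * l * u ^+ 3 + 32 * k * l ^+ 2 * u ^+ 3
  + 32 * k ^+ 2 * l * u ^+ 3) (- 576 * k * l * u ^+ 4 - 576 * k * l ^+ 2 * u ^+ 4
  - 576 * k ^+ 2 * l * u ^+ 4 - 576 * k ^+ 2 * l ^+ 2 * u ^+ 4) (0) 0); rewrite /am; ring. Qed.

Lemma Tm_step t n2 n3 j : t ^+ 2 = 2 * n2 + t ->
  Tm t n2 n3 j + am (- (t * j + 6 * y * Fx n2 n3 j)) =
  Tm (t + 1) (n2 + t) (n3 + n2) j.
Proof.
move=> ht; set r := Fx n2 n3 j.
have -> : am (- (t * j + 6 * y * r)) =
    1 + 12 * y * u * t * j + 72 * y ^+ 2 * u * r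
    + 72 * y ^+ 2 * u ^+ 2 * (t ^+ 2 * j ^+ 2 - t * j).
  by apply: (@nil_eq (32 * j * r * t * u ^+ 2 - 16 * r * u ^+ 2) (288 * r ^+ 2 * u ^+ 2)
    (0) 0); rewrite /am; ring.
have -> : 72 * y ^+ 2 * u * r = 72 * y ^+ 2 * u * v * n2 * (j ^+ 2 + j).
  by apply: (@nil_eq (16 * j * n3 * u * v ^+ 2 + 48 * j ^+ 2 * n3 * u * v ^+ 2
    + 32 * j ^+ 3 * n3 * u * v ^+ 2) (- 192 * j * n3 * u * v ^+ 3
    - 192 * j ^+ 2 * n3 * u * v ^+ 3) (32 * n2 * u * v ^+ 2) j); rewrite /r /Fx; ring.
by rewrite ht /Tm; ring.
Qed.

(* Right multiplication by A, where (i, k, j) stands for A^i C^k B^j. *)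
Definition mapA (q : R * R * R) : R * R * R :=
  let: (i, k, j) := q in (i + am k, k - j, Fm j).

Lemma sqr_bin2 (t : nat) : t%:R ^+ 2 = 2 * 'C(t, 2)%:R + t%:R :> R.
Proof.
elim: t => [|t IHt]; first by rewrite bin0n mulr0 addr0 expr0n.
by rewrite binS bin1 -natr1 natrD sqrrD IHt expr1n; ring.
Qed.

Lemma iter_mapA t i k j :
  iter t mapA (i, k, j) =
  (i + am k * Tm t%:R 'C(t, 2)%:R 'C(t, 3)%:R j,
   k - (t%:R * j + 6 * y * Fx 'C(t, 2)%:R 'C(t, 3)%:R j),
   j + 6 * y * Fx t%:R 'C(t, 2)%:R j).
Proof.
elim: t => [|t IHt].
  by rewrite /= !bin0n /Tm /Fx !mulr0n; congr (_, _, _); ring.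
rewrite iterS IHt /mapA Fm_iter !binS bin1 -!(natr1 t) !natrD.
congr (_, _, _).
  by rewrite am_add -(Tm_step _ _ (sqr_bin2 t)); ring.
by rewrite /Fx; ring.
Qed.

Lemma b_inv : (1 + 12 * y * v) * (1 - 12 * y * v + 144 * y ^+ 2 * v ^+ 2) = 1.
Proof. by apply: (@nil_eq (64 * v ^+ 3) (0) (0) 0); ring. Qed.

Section AtAlpha.
Variables (w : R).
Hypothesis nile : 9 * y ^+ 3 * w = 0.
Hypothesis vw : v = u - w.
(** [t], [n2], [n3] are alpha and its second and third binomial coefficients, written without
    division: alpha - 1 = 12 y u absorbs the denominators 2 and 6. *)
Let t := 1 + 12 * y * u.
Let n2 := 6 * y * u * t.
Let n3 := 2 * y * u * t * (12 * y * u - 1).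

Lemma Tm_alpha j :
  Tm t n2 n3 j = t + 72 * y ^+ 2 * u ^+ 2 * j * (1 + n3).
Proof.
have -> : Tm t n2 n3 j = t + 144 * y ^+ 3 * (u - v) * u ^+ 2 * (j ^+ 2 + j) +
    72 * y ^+ 2 * u ^+ 2 * j * (1 + n3).
  by apply: (@nil_eq (16 * j * u ^+ 3) (- 576 * j * u ^+ 4 + 2304 * j * u ^+ 4 * v * y
    - 2304 * j * u ^+ 5 * y + 576 * j ^+ 2 * u ^+ 4 + 2304 * j ^+ 2 * u ^+ 4 * v * y
    + 4608 * j ^+ 2 * u ^+ 5 * y) (0) 0); rewrite /Tm /n2 /n3 /t; ring.
have -> : 144 * y ^+ 3 * (u - v) * u ^+ 2 * (j ^+ 2 + j) =
    9 * y ^+ 3 * w * (16 * u ^+ 2 * (j ^+ 2 + j)) by rewrite vw; ring.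
by rewrite nile mul0r addr0.
Qed.

Lemma am_sq k X : am k * (72 * y ^+ 2 * X) = 72 * y ^+ 2 * X.
Proof.
apply: (@nil_eq (- 32 * u * k * X) (576 * u ^+ 2 * (k ^+ 2 + k) * X) 0 0).
by rewrite /am; ring.
Qed.

Lemma am1_alpha : am 1 * t = 1.
Proof.
by apply: (@nil_eq (64 * u ^+ 3) 0 0 0); rewrite /am /t; ring.
Qed.

(** This and the next two lemmas compute the coordinates of the defect of A C = C A^alpha, where j
    is the third coordinate reached after applying C. *)
Lemma alpha_coord1 k j :
  am k - am (k + 1) * Tm t n2 n3 j = - (72 * y ^+ 2 * (u ^+ 2 * j * (1 + n3))).
Proof.
have E : am (k + 1) * t = am k by rewrite am_add -mulrA am1_alpha mulr1.
rewrite Tm_alpha mulrDr E.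
have -> : 72 * y ^+ 2 * u ^+ 2 * j * (1 + n3) =
          72 * y ^+ 2 * (u ^+ 2 * j * (1 + n3)) by ring.
by rewrite am_sq; ring.
Qed.

Lemma alpha_coord2 j :
  t * j + 6 * y * Fx n2 n3 j - (1 + 12 * y * v) * j =
  12 * y * w * j + 36 * y ^+ 2 * u * v * (j ^+ 2 + j).
Proof.
have -> : w = u - v by rewrite vw; ring.
by apply: (@nil_eq (- 8 * j * u * v ^+ 2 + 16 * j * u ^+ 2 * v - 8 * j ^+ 2 * u * v ^+ 2
  + 16 * j ^+ 2 * u ^+ 2 * v) (32 * j * u * v ^+ 3 - 192 * j * u ^+ 2 * v ^+ 2
  + 1152 * j * u ^+ 3 * v ^+ 2 * y - 4608 * j * u ^+ 3 * v ^+ 3 * y ^+ 2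
  + 32 * j ^+ 2 * u * v ^+ 3 + 3456 * j ^+ 2 * u ^+ 3 * v ^+ 2 * y
  - 4608 * j ^+ 2 * u ^+ 3 * v ^+ 3 * y ^+ 2 + 192 * j ^+ 3 * u ^+ 2 * v ^+ 2
  + 2304 * j ^+ 3 * u ^+ 3 * v ^+ 2 * y) (0) j); rewrite /Fx /n2 /n3 /t; ring.
Qed.

Lemma alpha_coord3 j :
  Fm ((1 + 12 * y * v) * j) * (1 - 12 * y * v + 144 * y ^+ 2 * v ^+ 2)
    - (j + 6 * y * Fx t n2 j) =
  - (72 * y ^+ 2 * v * (w * j ^+ 2 + u * j)) - 288 * y ^+ 3 * v ^+ 3 * j.
Proof.
have -> : w = u - v by rewrite vw; ring.
have -> : (1 + 12 * y * v) * j = j + 6 * y * (2 * v * j) by ring.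
rewrite Fm_shift.
by apply: (@nil_eq (- 24 * j * u * v ^+ 2 + 64 * j * v ^+ 3 - 24 * j ^+ 2 * u * v ^+ 2
  - 32 * j ^+ 2 * v ^+ 3) (96 * j * u * v ^+ 3 - 288 * j * u ^+ 2 * v ^+ 2
  + 1152 * j * u ^+ 2 * v ^+ 3 * y + 1152 * j * v ^+ 4 - 4608 * j * v ^+ 5 * y
  + 96 * j ^+ 2 * u * v ^+ 3 - 864 * j ^+ 2 * u ^+ 2 * v ^+ 2
  + 1152 * j ^+ 2 * u ^+ 2 * v ^+ 3 * y + 2304 * j ^+ 2 * v ^+ 4
  - 576 * j ^+ 3 * u ^+ 2 * v ^+ 2 + 384 * j ^+ 3 * v ^+ 4) (- 80 * u * v ^+ 2
  - 32 * v ^+ 3) j); rewrite /Fm /Fx /n2 /n3 /t; ring.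
Qed.

End AtAlpha.
End Model.

(** * The lattice of translations and its invariance *)

Section Lattice.
Variables (R : comPzRingType) (y u e x h iu : R).
Hypothesis nil3 : 27 * y ^+ 3 = 0.
Hypothesis nil4 : 9 * y ^+ 4 = 0.
Hypothesis nilj : forall j : R, 9 * y ^+ 3 * (j ^+ 3 - j) = 0.
Hypothesis nile : 9 * y ^+ 3 * e = 0.
Hypothesis e2 : e ^+ 2 = 12 * y.
Hypothesis h2 : 2 * h = 1.
Hypothesis uiu : u * iu = 1.

Let v := u - e * x.
Let t := 1 + 12 * y * u.
Let n2 := 6 * y * u * t.
Let n3 := 2 * y * u * t * (12 * y * u - 1).
Let D := 2 * x ^+ 2 - u ^+ 3.

Lemma nile_eq (X1 X3 X5 Y1 Y2 Y3 L M : R) :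
  L = M + 27 * y ^+ 3 * X1 + 9 * y ^+ 4 * X3 + 9 * y ^+ 3 * e * X5
      + (e ^+ 2 - 12 * y) * Y1 + (2 * h - 1) * Y2 + (u * iu - 1) * Y3 ->
  L = M.
Proof. by rewrite nil3 nil4 nile e2 h2 uiu !subrr !mul0r !addr0. Qed.

(* Spanned by the part linear in j of the defect of A^C = A^a and by the
   vectors expressing C^(u e^4) = A^(2k e^5) and A^(D e^5) = 1. *)
Definition lat (q : R * R * R) : Prop :=
  exists c1 c2 c3,
    [/\ q.1.1 = - (72 * y ^+ 2 * u ^+ 2 * (1 + n3)) * c1
                - 288 * y ^+ 2 * x * iu * e * c2 + 144 * y ^+ 2 * e * D * c3,
        q.1.2 = (12 * y * (e * x) + 36 * y ^+ 2 * u * v) * c1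
                + 144 * y ^+ 2 * c2 &
        q.2 = - (72 * y ^+ 2 * u * v + 288 * y ^+ 3 * v ^+ 3) * c1].

Lemma lat0 : lat 0.
Proof. by exists 0, 0, 0; split; rewrite /= !mulr0; ring. Qed.

Lemma latB q q' : lat q -> lat q' -> lat (q - q').
Proof.
case=> [c1 [c2 [c3 [h1 h2' h3]]]] [d1 [d2 [d3 [k1 k2 k3]]]].
exists (c1 - d1), (c2 - d2), (c3 - d3).
by split; rewrite /= ?h1 ?h2' ?h3 ?k1 ?k2 ?k3; ring.
Qed.

Lemma latN q : lat q -> lat (- q).
Proof. by move=> lq; rewrite -sub0r; apply: latB => //; apply: lat0. Qed.

Lemma latD q q' : lat q -> lat q' -> lat (q + q').
Proof. by move=> lq lq'; rewrite -[q']opprK; apply/latB/latN. Qed.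

Definition mapC (q : R * R * R) : R * R * R :=
  let: (i, k, j) := q in
  (i, k + 1, j * (1 - 12 * y * v + 144 * y ^+ 2 * v ^+ 2)).

Lemma lat_mapC q d : lat d -> lat (mapC (q + d) - mapC q).
Proof.
case: q => [[i k] j]; case: d => [[i' k'] j'] ld.
suff -> : mapC ((i, k, j) + (i', k', j')) - mapC (i, k, j) = (i', k', j') by [].
case: ld => [c1 [c2 [c3 [/= _ _ hj]]]].
rewrite /mapC /=; congr (_, _, _) => /=; try by ring.
rewrite hj.
apply: (@nil_eq _ y nil3 nil4 nilj
  (32 * c1 * u * v ^+ 2) (128 * c1 * v ^+ 4 * (3 - 36 * y * v) - 1152 * c1 * u * v^+3) 0 0).
ring.
Qed.

(** This is the change that A makes to a lattice vector with first coefficient c; it is a multiple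
    of the second generator alone. *)
Lemma lat_shift c :
  lat (- (144 * y ^+ 2 * e * u * x * c),
       (72 * y ^+ 2 * u * v + 288 * y ^+ 3 * v ^+ 3) * c, 0).
Proof.
exists 0, (c * (u * v * h + 2 * y * v ^+ 3)), 0; split => /=.
- apply: (@nile_eq (- 64 * x ^+ 2 * c) 0 (64 * x * iu * c * v ^+ 3)
    (- 144 * y ^+ 2 * x ^+ 2 * c) (144 * y ^+ 2 * x * e * c * v)
    (288 * y ^+ 2 * x * e * c * v * h)).
  by rewrite /v; ring.
- by apply: (@nile_eq 0 0 0 0 (- 72 * y ^+ 2 * u * v * c) 0); ring.
- by ring.
Qed.

(** The quadratic part of the defect. The third coordinate dictates c1 = x e z / u, and the second
    then dictates c2. What remains in the first coordinate is 144 y^2 e D x z / u^2, absorbed by c3: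
    this is why the lattice must contain the vector with D. *)
Lemma lat_quad z :
  lat (0, 36 * y ^+ 2 * u * v * z, - (72 * y ^+ 2 * v * e * x * z)).
Proof.
exists (x * iu * e * z), (z * (h ^+ 2 * (u * v - v * x * e) - x ^+ 2 * iu)),
  (- (x * iu ^+ 2 * z)); split => /=.
- apply: (@nile_eq (- 64 * x ^+ 2 * z) (2304 * e * u ^+ 4 * x * y * z)
    (96 * iu * x ^+ 3 * z - 16 * u ^+ 2 * x * z)
    (72 * e * iu * x ^+ 3 * y ^+ 2 * z - 144 * x ^+ 2 * y ^+ 2 * z)
    (144 * e * h * u * x * y ^+ 2 * z + 72 * e * u * x * y ^+ 2 * z
     - 288 * e ^+ 2 * h * x ^+ 2 * y ^+ 2 * z
     - 144 * e ^+ 2 * x ^+ 2 * y ^+ 2 * z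
     + 144 * e ^+ 3 * h * iu * x ^+ 3 * y ^+ 2 * z
     + 72 * e ^+ 3 * iu * x ^+ 3 * y ^+ 2 * z)
    (288 * e * h ^+ 2 * u * x * y ^+ 2 * z
     - 144 * e * iu * u ^+ 2 * x * y ^+ 2 * z - 72 * e * u * x * y ^+ 2 * z
     - 144 * e * u ^+ 2 * x * y ^+ 3 * z + 20736 * e * u ^+ 4 * x * y ^+ 5 * z
     - 576 * e ^+ 2 * h ^+ 2 * x ^+ 2 * y ^+ 2 * z)).
  by rewrite /v /D /n3 /t; ring.
- apply: (@nile_eq 0 0 0 (- 12 * iu * x ^+ 2 * y * z)
    (144 * e * h * u * x * y ^+ 2 * z + 72 * e * u * x * y ^+ 2 * z
     - 72 * e ^+ 2 * h * x ^+ 2 * y ^+ 2 * z - 36 * e ^+ 2 * x ^+ 2 * y ^+ 2 * z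
     - 72 * h * u ^+ 2 * y ^+ 2 * z - 36 * u ^+ 2 * y ^+ 2 * z)
    (- 36 * e * u * x * y ^+ 2 * z + 36 * e ^+ 2 * x ^+ 2 * y ^+ 2 * z)).
  by rewrite /v; ring.
- apply: (@nile_eq 0 0 (32 * v ^+ 3 * x * iu * z) 0 0 (72 * y ^+ 2 * v * x * e * z)).
  by ring.
Qed.

Lemma lat_mapA q d : lat d -> lat (mapA y u v (q + d) - mapA y u v q).
Proof.
case: q => [[i k] j]; case: d => [[i' k'] j'] ld.
have [c1 [c2 [c3 [/= _ hk hj]]]] := ld.
suff -> : mapA y u v ((i, k, j) + (i', k', j')) - mapA y u v (i, k, j) =
    (i', k', j') + (- (144 * y ^+ 2 * e * u * x * c1),
      (72 * y ^+ 2 * u * v + 288 * y ^+ 3 * v ^+ 3) * c1, 0).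
  exact: latD (lat_shift c1).
rewrite /mapA /=; congr (_, _, _) => /=.
- have -> : am y u (k + k') = am y u k * am y u k' by apply: am_add nil3 nil4 nilj k k'.
  have -> : am y u k' = 1 + 72 * y ^+ 2 * (- 2 * e * u * x * c1).
      pose g := e * x * c1 + 3 * y * u * v * c1 + 12 * y * c2.
    have -> : k' = 12 * y * g by rewrite hk /g; ring.
    apply: (@nile_eq (32 * u ^+ 2 * g - 16 * u ^+ 2 * v * c1 - 64 * u * c2)
      (1152 * u ^+ 2 * g ^+ 2) 0 0 0 0).
    by rewrite /am /g; ring.
  rewrite mulrDr mulr1 (am_sq u nil3 nil4 nilj); ring.
- by rewrite hj; ring.
- have -> : j' = 6 * y * (- c1 * (12 * y * u * v + 48 * y ^+ 2 * v ^+ 3)).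
    by rewrite hj; ring.
  rewrite (Fm_shift v nil3 nil4 nilj).
  apply: (@nil_eq _ y nil3 nil4 nilj (- 32 * c1 * j * u * v ^+ 2 - 16 * c1 * u * v ^+ 2)
    (- 384 * c1 * j * v ^+ 4 + 192 * c1 * u * v ^+ 3 - 192 * c1 * v ^+ 4
    + 768 * c1 * v ^+ 5 * y) 0 0).
  by ring.
Qed.

Lemma lat_rel (a : nat) q :
  a%:R = t -> 'C(a, 2)%:R = n2 -> 'C(a, 3)%:R = n3 ->
  lat (mapC (mapA y u v q) - iter a (mapA y u v) (mapC q)).
Proof.
case: q => [[i k] j] ha ha2 ha3.
have vw : v = u - e * x by [].
have nilw : 9 * y ^+ 3 * (e * x) = 0 by rewrite mulrA nile mul0r.
set J := j * (1 - 12 * y * v + 144 * y ^+ 2 * v ^+ 2).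
have jE : j = (1 + 12 * y * v) * J.
  by rewrite /J [RHS]mulrCA (b_inv v nil3 nil4 nilj) mulr1.
rewrite /mapC /= -/J (iter_mapA u v nil3 nil4 nilj) ha ha2 ha3.
have lJ : lat (- (72 * y ^+ 2 * (u ^+ 2 * J * (1 + n3))),
   12 * y * (e * x) * J + 36 * y ^+ 2 * u * v * J,
   - (72 * y ^+ 2 * u * v * J + 288 * y ^+ 3 * v ^+ 3 * J)).
  by exists J, 0, 0; split => /=; ring.
have := latD lJ (lat_quad (J ^+ 2)); congr lat.
congr (_, _, _) => /=.
- have := alpha_coord1 nil3 nil4 nilj nilw vw k J; rewrite -/t -/n2 -/n3 => <-.
  by ring.
- have := alpha_coord2 nil3 nil4 nilj vw J; rewrite -/t -/n2 -/n3 -jE => E.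
  have -> : k - j + 1 - (k + 1 - (t * J + 6 * y * Fx y v n2 n3 J)) =
      t * J + 6 * y * Fx y v n2 n3 J - j by ring.
  by rewrite E; ring.
- have := alpha_coord3 nil3 nil4 nilj vw J; rewrite -/t -/n2 -jE => ->.
  by ring.
Qed.

End Lattice.

(** * Permutations modulo lattice translations *)

Section PermModel.
Variables (R : finComNzRingType) (y u e x h iu : R).
Hypothesis nil3 : 27 * y ^+ 3 = 0.
Hypothesis nil4 : 9 * y ^+ 4 = 0.
Hypothesis nilj : forall j : R, 9 * y ^+ 3 * (j ^+ 3 - j) = 0.
Hypothesis nile : 9 * y ^+ 3 * e = 0.
Hypothesis e2 : e ^+ 2 = 12 * y.
Hypothesis h2 : 2 * h = 1.
Hypothesis uiu : u * iu = 1.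

Let v := u - e * x.
Let t := 1 + 12 * y * u.

Variables (a b N : nat).
Hypothesis aE : a%:R = t.
Hypothesis a2E : 'C(a, 2)%:R = 6 * y * u * t.
Hypothesis a3E : 'C(a, 3)%:R = 2 * y * u * t * (12 * y * u - 1).
Hypothesis bE : b%:R = 1 + 12 * y * v.
Hypothesis N_gt0 : (0 < N)%N.
Hypothesis NE : N%:R = 0 :> R.
Hypothesis N2E : 'C(N, 2)%:R = 0 :> R.
Hypothesis N3E : 'C(N, 3)%:R = 0 :> R.

Let Y : finType := (R * R * R)%type.
Let lat := lat y u e x iu.
Let fA : Y -> Y := mapA y u v.
Let fC : Y -> Y := mapC y u e x.
Let fB (q : Y) : Y := let: (i, k, j) := q in (i, k, j + 1).

Definition latb (q : Y) : bool :=
  [exists c1, exists c2, exists c3,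
    q == (- (72 * y ^+ 2 * u ^+ 2 *
              (1 + 2 * y * u * t * (12 * y * u - 1))) * c1
          - 288 * y ^+ 2 * x * iu * e * c2
          + 144 * y ^+ 2 * e * (2 * x ^+ 2 - u ^+ 3) * c3,
          (12 * y * (e * x) + 36 * y ^+ 2 * u * v) * c1 + 144 * y ^+ 2 * c2,
          - (72 * y ^+ 2 * u * v + 288 * y ^+ 3 * v ^+ 3) * c1)].

Lemma latP q : reflect (lat q) (latb q).
Proof.
apply: (iffP existsP) => [[c1 /existsP[c2 /existsP[c3 /eqP->]]]|].
  by exists c1, c2, c3.
case: q => [[i k] j] [c1 [c2 [c3 [/= hi hk hj]]]].
exists c1; apply/existsP; exists c2; apply/existsP; exists c3.
by apply/eqP; congr (_, _, _).
Qed.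

Lemma iterN_fA q : iter N fA q = q.
Proof.
case: q => [[i k] j]; rewrite /fA (iter_mapA u v nil3 nil4 nilj) NE N2E N3E.
by rewrite /Tm /Fx; congr (_, _, _); ring.
Qed.

Lemma fA_inj : injective fA.
Proof.
move=> q q' E; rewrite -(iterN_fA q) -(iterN_fA q').
by rewrite -(prednK N_gt0) !iterSr E.
Qed.

Lemma fB_inj : injective fB.
Proof. by case=> [[i k] j] [[i' k'] j'] [-> -> /addIr->]. Qed.

Lemma fC_inj : injective fC.
Proof.
case=> [[i k] j] [[i' k'] j'] [-> /addIr-> E]; congr (_, _, _).
have bi := b_inv v nil3 nil4 nilj.
have split z : z = z * (1 - 12 * y * v + 144 * y ^+ 2 * v ^+ 2) * (1 + 12 * y * v).
  by rewrite -mulrA [_ * (1 + _)]mulrC bi mulr1.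
by rewrite (split j) (split j'); congr (_ * _).
Qed.

Definition pA : {perm Y} := perm fA_inj.
Definition pB : {perm Y} := perm fB_inj.
Definition pC : {perm Y} := perm fC_inj.

Lemma pA_pow i q : (pA ^+ i)%g q = iter i fA q.
Proof. by rewrite permX; apply: eq_iter => z; rewrite permE. Qed.

Lemma pB_pow i q : (pB ^+ i)%g q = (q.1, q.2 + i%:R).
Proof.
rewrite permX; elim: i => [|i IHi]; first by rewrite addr0; case: q.
by rewrite iterS IHi permE; case: q {IHi} => [[i' k] j] /=; rewrite -natr1 addrA.
Qed.

Lemma pB_pC : (pB ^ pC^-1 = pB ^+ b)%g.
Proof.
apply: (mulIg pC); rewrite conjgE invgK -!mulgA mulVg mulg1.
apply/permP => q; rewrite !permM pB_pow !permE.
case: q => [[i k] j] /=; congr (_, _, _).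
by rewrite [RHS]mulrDl bE; congr (_ + _); apply/esym/(b_inv v nil3 nil4 nilj).
Qed.

Lemma pA_pB : (pA ^ pB = pA * pC)%g.
Proof.
apply: (mulgI pB); rewrite -conjgC; apply/permP => q; rewrite !permM !permE.
case: q => [[i k] j] /=; congr (_, _, _); first by ring.
rewrite (Fm_succ v nil3 nil4 nilj) mulrAC addrC -[LHS]mul1r; congr (_ * _).
exact/esym/(b_inv v nil3 nil4 nilj).
Qed.

(** Rather than dividing the coordinate space by the lattice, one divides out the permutations that
    move every point by a lattice vector. Permutations respecting congruence modulo the lattice
    normalise them, so the model lives in N(latK) / latK. *)
Definition lat_equiv (s : {perm Y}) : bool := [forall q, latb (s q - q)].
Definition latK : {set {perm Y}} := [set s | lat_equiv s].

Lemma latK_group : group_set latK.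
Proof.
apply/group_setP; split=> [|s s'].
  rewrite inE; apply/forallP => q; apply/latP.
  by rewrite perm1 subrr; apply: lat0.
rewrite !inE => /forallP hs /forallP hs'; apply/forallP => q; apply/latP.
rewrite permM; have -> : s' (s q) - q = (s' (s q) - s q) + (s q - q).
  by rewrite addrA subrK.
by apply: latD; apply/latP.
Qed.
Canonical latKG := Group latK_group.

Definition lat_compat (s : {perm Y}) := forall q d, lat d -> lat (s (q + d) - s q).

Lemma lat_compatM s s' : lat_compat s -> lat_compat s' -> lat_compat (s * s')%g.
Proof.
move=> hs hs' q d ld; rewrite !permM -[s (q + d)](subrK (s q)) [_ + s q]addrC.
exact/hs'/hs.
Qed.

Lemma lat_compatX s n : lat_compat s -> lat_compat (s ^+ n)%g.
Proof.
move=> hs; elim: n => [|n IHn]; last by rewrite expgS; apply: lat_compatM.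
by move=> q d ld; rewrite !perm1 addrC addKr.
Qed.

Lemma lat_compat_norm s : lat_compat s -> s \in ('N(latK))%g.
Proof.
move=> hs; rewrite inE; apply/subsetP => _ /imsetP[g gK ->].
have {gK} /forallP gK : lat_equiv g by move: gK; rewrite in_set.
rewrite in_set; apply/forallP => q; apply/latP; rewrite conjgE !permM -{2}[q](permKV s).
set q0 := (s^-1)%g q.
have /latP l0 := gK q0.
by have := hs q0 _ l0; rewrite [q0 + _]addrC subrK.
Qed.

Lemma compat_A : lat_compat pA.
Proof.
move=> q d ld; rewrite !permE.
exact: (lat_mapA nil3 nil4 nilj nile e2 h2 uiu q ld).
Qed.

Lemma compat_B : lat_compat pB.
Proof.
move=> [[i k] j] [[i' k'] j'] ld; rewrite !permE.
suff -> : fB ((i, k, j) + (i', k', j')) - fB (i, k, j) = (i', k', j') by [].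
by congr (_, _, _) => /=; ring.
Qed.

Lemma compat_C : lat_compat pC.
Proof.
move=> q d ld; rewrite !permE.
exact: (lat_mapC nil3 nil4 nilj q ld).
Qed.

Local Notation co s := (coset latK s).

Lemma pA_pC : co (pA ^ pC)%g = co (pA ^+ a)%g.
Proof.
have nA := lat_compat_norm compat_A; have nC := lat_compat_norm compat_C.
have : ((pC * pA ^+ a)^-1 * (pA * pC))%g \in latK.
  rewrite inE; apply/forallP => q; apply/latP.
  rewrite permM -[X in _ - X](permKV (pC * pA ^+ a)%g); set q2 := ((pC * pA ^+ a)^-1)%g q.
  rewrite !permM pA_pow !permE.
  exact: (lat_rel _ nil3 nil4 nilj nile e2 h2 uiu q2 aE a2E a3E).
have n1 : (pC * pA ^+ a)%g \in ('N(latK))%g by rewrite groupM // groupX.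
have n2 : (pA * pC)%g \in ('N(latK))%g by rewrite groupM.
move/coset_id; rewrite morphM ?groupV // morphV //.
move/eqP; rewrite -eq_mulVg1 => /eqP E.
have nX : (pA ^+ a)%g \in ('N(latK))%g by rewrite groupX.
apply: (mulgI (co pC)); rewrite -morphM ?groupJ // -conjgC -E.
by rewrite morphM.
Qed.

(** Evaluation at the origin suffices for separation, because A^i C^k B^j sends the origin to (i, k,
    j). *)
Lemma coset_inj_lat s s' : lat_compat s -> lat_compat s' ->
  co s = co s' -> lat (s 0 - s' 0).
Proof.
move=> hs hs' E; have ns := lat_compat_norm hs; have ns' := lat_compat_norm hs'.
have : s \in (latK :* s')%g.
  by apply/rcoset_kercosetP.
case/rcosetP => g; rewrite inE => /forallP/(_ 0)/latP; rewrite subr0 => lg ->.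
by rewrite permM -[g 0]add0r; apply: hs'.
Qed.

Lemma perm_model : exists (hT : finGroupType) (X Z W : hT),
  [/\ mrels a b X Z W, X ^+ N = 1,
      forall M, M%:R = 0 :> R -> Z ^+ M = 1 &
      forall i k j i' k' j' : nat,
        X ^+ i * W ^+ k * Z ^+ j = X ^+ i' * W ^+ k' * Z ^+ j' ->
        lat (i%:R - i'%:R, k%:R - k'%:R, j%:R - j'%:R)]%g.
Proof.
exists (coset_of latK), (co pA), (co pB), (co pC).
have cA := compat_A; have cB := compat_B; have cC := compat_C.
have nA := lat_compat_norm cA; have nB := lat_compat_norm cB.
have nC := lat_compat_norm cC.
split.
- split.
  + by have := pA_pC; rewrite morphJ // morphX.
  + by have := congr1 (coset latK) pB_pC; rewrite morphJ ?groupV // morphV // morphX.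
  + by have := congr1 (coset latK) pA_pB; rewrite morphJ // morphM.
- rewrite -morphX //; have -> : (pA ^+ N)%g = 1%g; last exact: morph1.
  by apply/permP => q; rewrite pA_pow iterN_fA perm1.
- move=> M M0; rewrite -morphX //; have -> : (pB ^+ M)%g = 1%g; last exact: morph1.
  by apply/permP => q; rewrite pB_pow M0 addr0 perm1; case: q.
move=> i k j i' k' j'.
rewrite -!morphX // -!morphM ?groupM ?groupX //.
move/coset_inj_lat; have compat i1 k1 j1 : lat_compat (pA ^+ i1 * pC ^+ k1 * pB ^+ j1)%g.
  by apply: lat_compatM; [apply: lat_compatM|]; apply: lat_compatX.
move/(_ (compat _ _ _) (compat _ _ _)).
have eval i1 k1 j1 : (pA ^+ i1 * pC ^+ k1 * pB ^+ j1)%g 0 = (i1%:R, k1%:R, j1%:R).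
  have -> : (0 : Y) = (0, 0, 0) by [].
  rewrite !permM pA_pow /fA (iter_mapA u v nil3 nil4 nilj).
  have -> : (pC ^+ k1)%g (0 + am y u 0 * Tm y u v i1%:R 'C(i1, 2)%:R 'C(i1, 3)%:R 0,
      0 - (i1%:R * 0 + 6 * y * Fx y v 'C(i1, 2)%:R 'C(i1, 3)%:R 0),
      0 + 6 * y * Fx y v i1%:R 'C(i1, 2)%:R 0) = (i1%:R, k1%:R, 0).
    rewrite permX; elim: k1 => [|k1 IHk].
      by rewrite /am /Tm /Fx /=; congr (_, _, _); ring.
    by rewrite iterS IHk permE /= mul0r natr1.
  by rewrite pB_pow /= add0r.
by rewrite !eval.
Qed.

End PermModel.

Lemma bin3_mul6 (R : comPzRingType) (a : nat) :
  6 * 'C(a, 3)%:R = a%:R * (a%:R - 1) * (a%:R - 2) :> R.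
Proof.
elim: a => [|a IHa]; first by rewrite bin0n mulr0 !mul0r.
rewrite binS natrD mulrDr IHa -(natr1 a).
have -> : 6 * 'C(a, 2)%:R = 3 * (a%:R ^+ 2 - a%:R) :> R.
  by rewrite sqr_bin2; ring.
by ring.
Qed.

Lemma cube_sub_div3 (R : comPzRingType) (a : nat) :
  exists c : R, a%:R ^+ 3 - a%:R = 3 * c.
Proof.
elim: a => [|a [c IHc]]; first by exists 0; rewrite expr0n subrr mulr0.
exists (c + a%:R ^+ 2 + a%:R); rewrite !mulrDr -IHc -natr1; ring.
Qed.

Section Zpn.
Variables (p r : nat).
Hypotheses (p_pr : prime p) (r_gt0 : (0 < r)%N).
Let q := (p ^ r)%N.
Let R := 'Z_q.

Lemma q_gt1 : (1 < q)%N.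
Proof. by rewrite -(exp1n r) ltn_exp2r // prime_gt1. Qed.

Lemma Zq_natr_eq m n : (m%:R == n%:R :> R) = (m == n %[mod q]).
Proof. by rewrite -(inj_eq val_inj) /= !val_Zp_nat ?q_gt1. Qed.

Lemma Zq_natr_eq0 m : (m%:R == 0 :> R) = (q %| m)%N.
Proof. by rewrite -[0]/(0%:R) Zq_natr_eq mod0n. Qed.

Lemma Zq_intr_eq0 (z : int) : (q%:Z %| z)%Z -> z%:~R = 0 :> R.
Proof.
case/dvdzP => w ->; rewrite intrM -[X in _ * X]/(q%:R).
by rewrite (eqP (_ : q%:R == 0 :> R)) ?mulr0 // Zq_natr_eq0.
Qed.

Lemma Zq_valK (c : R) : c = (val c)%:R.
Proof. by rewrite natr_Zp. Qed.

Lemma Zq_inv (z : int) : ~~ (p%:Z %| z)%Z -> exists w : R, z%:~R * w = 1.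
Proof.
move=> pz; pose m := `|(z %% q)%Z|%N.
have q0 : q%:Z != 0 by rewrite eqz_nat -lt0n (ltnW q_gt1).
have zm : z%:~R = m%:R :> R.
  rewrite {1}(divz_eq z q) rmorphD rmorphM /=.
  rewrite [X in _ * X]Zq_intr_eq0 // mulr0 add0r.
  by rewrite -[RHS]/((m%:Z)%:~R) /m gez0_abs // modz_ge0.
have um : (m%:R : R) \is a GRing.unit.
  rewrite unitZpE ?q_gt1 // /q coprime_sym coprimeXr // coprime_sym.
  rewrite prime_coprime //; apply: contra pz => pm.
  rewrite (divz_eq z q) rpredD //.
    by rewrite dvdz_mull // dvdzE !absz_nat dvdn_exp.
by exists (m%:R)^-1; rewrite zm mulrV.
Qed.

Lemma Zq_small_eq a i i' (c : R) : (a <= r)%N -> (i < p ^ a)%N -> (i' < p ^ a)%N ->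
  i%:R - i'%:R = (p ^ a)%:R * c -> i = i'.
Proof.
move=> le_ar li li' /eqP; rewrite subr_eq (Zq_valK c) -natrM -natrD Zq_natr_eq.
have d : (p ^ a %| q)%N by rewrite dvdn_exp2l.
move/eqP => E; have : i = i' %[mod p ^ a].
  by rewrite -(modn_dvdm _ d) E modn_dvdm // mulnC modnMDl.
by rewrite !modn_small.
Qed.

Lemma Zq_cancel a (c : R) : (a <= r)%N -> (p ^ a)%:R * c = 0 ->
  exists c', c = (p ^ (r - a))%:R * c'.
Proof.
move=> le_ar /eqP; rewrite (Zq_valK c) -natrM Zq_natr_eq0 /q.
rewrite -{1}(subnKC le_ar) expnD dvdn_pmul2l ?expn_gt0 ?prime_gt0 //.
by case/dvdnP => w ->; exists w%:R; rewrite mulnC natrM.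
Qed.

End Zpn.

(** * The model over the integers modulo p^(6n) *)

Section Concrete.
Variables (p n s : nat) (u k : int) (a b : nat).
Hypotheses (p_pr : prime p) (p_gt2 : (2 < p)%N) (n_gt0 : (0 < n)%N) (le_sn : (s <= n)%N).
Hypotheses (pu : ~~ (p%:Z %| u)%Z).
Hypothesis aE : a%:Z = 1 + (p ^ (2 * n))%:Z * u.
Hypothesis bE : b%:Z = 1 + (p ^ (2 * n))%:Z * (u - (p ^ n)%:Z * k).
Hypothesis pD : ((p ^ s)%:Z %| 2 * k ^+ 2 - u ^+ 3)%Z.
Let R := 'Z_(p ^ (6 * n)).
Let e : R := (p ^ n)%:R.
Let uR : R := u%:~R.
Let kR : R := k%:~R.

Let r_gt0 : (0 < 6 * n)%N. Proof. by rewrite muln_gt0. Qed.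

Lemma pow_eq0 i : (6 * n <= i)%N -> (p ^ i)%:R = 0 :> R.
Proof. by move=> le; apply/eqP; rewrite (Zq_natr_eq0 p_pr r_gt0); exact: dvdn_exp2l. Qed.

Lemma e_exp i : e ^+ i = (p ^ (n * i))%:R.
Proof. by rewrite /e !natrX exprM. Qed.

Lemma natr_inv m : ~~ (p %| m)%N -> exists w : R, m%:R * w = 1.
Proof. by move=> pm; apply: (Zq_inv p_pr r_gt0 (z := m%:Z)). Qed.

Lemma inv2 : exists h : R, 2 * h = 1.
Proof. by apply: natr_inv; rewrite gtnNdvd. Qed.

Lemma aR : a%:R = 1 + e ^+ 2 * uR.
Proof.
rewrite -[a%:R]/((a%:Z)%:~R) aE rmorphD rmorphM /= e_exp [(n * 2)%N]mulnC.
by [].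
Qed.

(** For p > 3 the witness is e^2 / 12. For p = 3 it is 3^(2n-1) / 4: one factor 3 is lost, and the
    last two vanishing statements rest on 8n - 2 >= 6n and 7n - 1 >= 6n. *)
Lemma eta_exists : exists y : R,
  [/\ e ^+ 2 = 12 * y, 27 * y ^+ 3 = 0, 9 * y ^+ 4 = 0, 9 * y ^+ 3 * e = 0 &
   (exists c, 3 * y = e ^+ 2 * c) /\
   'C(a, 3)%:R = 2 * y * uR * a%:R * (a%:R - 2)].
Proof.
pose f : R := (p ^ (2 * n).-1)%:R.
have pf : p%:R * f = e ^+ 2.
  by rewrite /f -natrM -expnS prednK ?muln_gt0 // e_exp [(n * 2)%N]mulnC.
suff [y [g [h1 h2 h3 h4]]] : exists y g, [/\ e ^+ 2 = 12 * y, y = f * g,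
   exists c, 3 * y = e ^+ 2 * c & 'C(a, 3)%:R = 2 * y * uR * a%:R * (a%:R - 2)].
  have [c hc] := h3; exists y; split=> //.
  - have -> : 27 * y ^+ 3 = (3 * y) ^+ 3 by ring.
    rewrite hc exprMn -exprM e_exp pow_eq0 ?mul0r //; lia.
  - have -> : 9 * y ^+ 4 = (3 * y) ^+ 2 * y ^+ 2 by ring.
    rewrite hc h2; have -> : (e ^+ 2 * c) ^+ 2 * (f * g) ^+ 2 =
      e ^+ 4 * f ^+ 2 * (c * g) ^+ 2 by ring.
    rewrite e_exp /f -natrX -natrM -expnM -expnD pow_eq0 ?mul0r //; lia.
  - have -> : 9 * y ^+ 3 * e = (3 * y) ^+ 2 * (e * y) by ring.
    rewrite hc h2; have -> : (e ^+ 2 * c) ^+ 2 * (e * (f * g)) =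
      e ^+ 5 * f * (c ^+ 2 * g) by ring.
    by rewrite e_exp /f -natrM -expnD pow_eq0 ?mul0r //; lia.
have [p3|p_neq3] := eqVneq p 3.
  have [c4 hc] : exists w : R, 4%:R * w = 1 by apply: natr_inv; rewrite p3.
  have e3 : e ^+ 2 = 3 * f.
    have p3R : p%:R = 3%:R :> R by congr (_%:R).
    by rewrite -pf p3R.
  exists (f * c4), c4; split=> //.
  - by rewrite e3 -[in LHS](mulr1 f) -hc; ring.
  - by exists c4; rewrite e3; ring.
  have [h h2] := inv2.
  (* The factor 3 has to be cancelled over the integers, since it is a zero divisor modulo
     3^(6n). *)
  have E : 2 * 'C(a, 3)%:Z = a%:Z * ((p ^ (2 * n).-1)%:Z * u) * (a%:Z - 2).
    have := bin3_mul6 int a; rewrite !(natz a) (natz 'C(a, 3)) => E.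
    apply: (@mulfI _ (3 : int)) => //.
    have -> : 3 * (2 * 'C(a, 3)%:Z) = 6 * 'C(a, 3)%:Z by ring.
    rewrite E.
    have -> : a%:Z - 1 = 3 * ((p ^ (2 * n).-1)%:Z * u).
      have pp : (p ^ (2 * n))%:Z = 3 * (p ^ (2 * n).-1)%:Z.
        have n2 : (0 < 2 * n)%N by rewrite muln_gt0.
        by rewrite -[in LHS](prednK n2) expnS PoszM p3.
      by rewrite aE pp; ring.
    by ring.
  move/(congr1 (fun z : int => z%:~R : R)): E.
  rewrite !rmorphM rmorphB /= -![_%:~R]/(_%:R) => E.
  have {}E : 2 * 'C(a, 3)%:R = 4 * (f * c4) * (uR * a%:R * (a%:R - 2)).
    have -> : 4 * (f * c4) = 4 * c4 * f by ring.
    rewrite hc mul1r; apply: etrans E _.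
    by rewrite /f /uR; ring.
  have -> : 'C(a, 3)%:R = h * (2 * 'C(a, 3)%:R) by rewrite mulrCA mulrA h2 mul1r.
  rewrite E.
  have -> : h * (4 * (f * c4) * (uR * a%:R * (a%:R - 2))) =
     (2 * h) * (2 * (f * c4) * (uR * a%:R * (a%:R - 2))) by ring.
  by rewrite h2; ring.
have [c hc] : exists w : R, 12%:R * w = 1.
  apply: natr_inv; rewrite (Euclid_dvdM (2 ^ 2) 3) // negb_or Euclid_dvdX //.
  by rewrite gtnNdvd //= dvdn_prime2.
exists (e ^+ 2 * c), (p%:R * c); split.
- have -> : 12 * (e ^+ 2 * c) = 12 * c * e ^+ 2 by ring.
  by rewrite hc mul1r.
- by rewrite -pf; ring.
- by exists (3 * c); ring.
have := @bin3_mul6 R a.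
have -> : a%:R - 1 = e ^+ 2 * uR :> R by rewrite aR; ring.
move/(congr1 (fun z => 2 * c * z)).
have -> : 2 * c * (6 * 'C(a, 3)%:R) = 12 * c * 'C(a, 3)%:R by ring.
by rewrite hc mul1r => ->; ring.
Qed.

Lemma mulrI2 (h z z' : R) : 2 * h = 1 -> 2 * z = 2 * z' -> z = z'.
Proof.
move=> h2 E; have h2K w : w = h * (2 * w) by rewrite mulrCA mulrA h2 mul1r.
by rewrite (h2K z) (h2K z') E.
Qed.

(** The exponent 6n + 1 makes up for the factor 3 lost in the third binomial coefficient when p =
    3. *)
Lemma bin_pow0 : let N := (p ^ (6 * n).+1)%N in
  [/\ N%:R = 0 :> R, 'C(N, 2)%:R = 0 :> R & 'C(N, 3)%:R = 0 :> R].
Proof.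
move=> N; have [h h2] := inv2.
have N0 : N%:R = 0 :> R by rewrite pow_eq0 // leqnSn.
have h0 (z : R) : 2 * z = 0 -> z = 0.
  move=> z0; have -> : z = h * (2 * z) by rewrite mulrCA mulrA h2 mul1r.
  by rewrite z0 mulr0.
split=> //.
  by apply: h0; have := sqr_bin2 R N; rewrite N0 expr0n addr0.
have [p3|p_neq3] := eqVneq p 3.
  apply: h0.
  have E : 2 * 'C(N, 3)%:Z = (p ^ (6 * n))%:Z * ((N%:Z - 1) * (N%:Z - 2)).
    have := bin3_mul6 int N; rewrite !(natz N) (natz 'C(N, 3)) => E.
    apply: (@mulfI _ (3 : int)) => //.
    have -> : 3 * (2 * 'C(N, 3)%:Z) = 6 * 'C(N, 3)%:Z by ring.
    have NE : N%:Z = 3 * (p ^ (6 * n))%:Z by rewrite /N expnS PoszM p3.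
    by rewrite E {1}NE; ring.
  move/(congr1 (fun z : int => z%:~R : R)): E.
  rewrite !rmorphM /= -![_%:~R]/(_%:R) => E; apply: etrans E _.
  by rewrite -[X in X * _]/((p ^ (6 * n))%:R) pow_eq0 // mul0r.
have [c hc] : exists w : R, 6%:R * w = 1.
  apply: natr_inv; rewrite (Euclid_dvdM 2 3) // negb_or gtnNdvd //=.
  by rewrite dvdn_prime2.
have := bin3_mul6 R N; rewrite N0 !mul0r => E.
have -> : 'C(N, 3)%:R = c * (6 * 'C(N, 3)%:R) by rewrite mulrCA mulrA hc mul1r.
by rewrite E mulr0.
Qed.

Lemma p_model : exists (hT : finGroupType) (X Z W : hT),
  [/\ mrels a b X Z W, X ^+ (p ^ (6 * n).+1) = 1, Z ^+ (p ^ (6 * n).+1) = 1 &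
    forall i j c i' j' c' : nat,
      (i < p ^ (5 * n + s))%N -> (i' < p ^ (5 * n + s))%N ->
      (c < p ^ (4 * n))%N -> (c' < p ^ (4 * n))%N ->
      (j < p ^ (4 * n))%N -> (j' < p ^ (4 * n))%N ->
      X ^+ i * W ^+ c * Z ^+ j = X ^+ i' * W ^+ c' * Z ^+ j' ->
      [/\ i = i', c = c' & j = j']]%g.
Proof.
have [y [e2 nil3 nil4 nile [[g yg] a3]]] := eta_exists.
have [h h2] := inv2; have [iu uiu] := Zq_inv p_pr r_gt0 pu.
have nilj (j : R) : 9 * y ^+ 3 * (j ^+ 3 - j) = 0.
  have [w jw] := cube_sub_div3 R (val j); rewrite -Zq_valK // in jw.
  rewrite jw; have -> : 9 * y ^+ 3 * (3 * w) = 27 * y ^+ 3 * w by ring.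
  by rewrite nil3 mul0r.
have aE' : a%:R = 1 + 12 * y * uR by rewrite aR e2.
have bE' : b%:R = 1 + 12 * y * (uR - e * kR).
  rewrite -[b%:R]/((b%:Z)%:~R) bE rmorphD rmorphM rmorphB rmorphM /= -e2.
  by rewrite e_exp [(n * 2)%N]mulnC.
have a2E : 'C(a, 2)%:R = 6 * y * uR * (1 + 12 * y * uR).
  have := sqr_bin2 R a; rewrite aE' => E.
  have {}E : 2 * 'C(a, 2)%:R = 2 * (6 * y * uR * (1 + 12 * y * uR)).
    by apply: (addIr (1 + 12 * y * uR)); rewrite -E; ring.
  by apply: (mulrI2 h2).
have a3E : 'C(a, 3)%:R = 2 * y * uR * (1 + 12 * y * uR) * (12 * y * uR - 1).
  by rewrite a3 aE'; ring.
have [N0 N20 N30] := bin_pow0.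
have N_gt0 : (0 < p ^ (6 * n).+1)%N by rewrite expn_gt0 prime_gt0.
have [hT [X [Z [W [rels XN ZN sep]]]]] :=
  perm_model nil3 nil4 nilj nile e2 h2 uiu aE' a2E a3E bE' N_gt0 N0 N20 N30.
exists hT, X, Z, W; split=> //; first exact: ZN.
move=> i j c i' j' c' li li' lc lc' lj lj' /sep[c1 [c2 [c3 /= [E1 E2 E3]]]].
set v := uR - e * kR in E1 E2 E3.
have [iv viv] : exists w : R, v * w = 1.
  have pv : ~~ (p%:Z %| u - (p ^ n)%:Z * k)%Z.
    apply: contra pu => pv; rewrite -[u](subrK ((p ^ n)%:Z * k)) rpredD //.
    by rewrite dvdz_mulr // dvdzE !absz_nat dvdn_exp.
  have [w w1] := Zq_inv p_pr r_gt0 pv; exists w; apply: etrans w1.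
  by congr (_ * _); rewrite rmorphB rmorphM.
have e4 : e ^+ 4 = 144 * y ^+ 2 by rewrite -[4%N]/(2 * 2)%N exprM e2; ring.
have e6 : e ^+ 6 = 0 by rewrite e_exp pow_eq0 // mulnC.
have eN m : (p ^ (m * n))%:R = e ^+ m by rewrite e_exp [(n * m)%N]mulnC.
have le_r m : (m <= 6)%N -> (m * n <= 6 * n)%N by move=> lm; rewrite leq_mul2r lm orbT.
have kill m z : (m <= 6)%N -> e ^+ m * z = 0 -> exists w, z = e ^+ (6 - m) * w.
  move=> lm; rewrite -eN => /(Zq_cancel p_pr r_gt0 (le_r _ lm))[w ->].
  by exists w; rewrite -mulnBl eN.
have nil := @nile_eq _ y uR e h iu nil3 nil4 nile e2 h2 uiu.
(* The third coordinate of a lattice vector is a multiple of e^4; this gives j = j' and then e^2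
   divides c1. The second coordinate is now a multiple of e^4 too, giving c = c' and c2 = e^2 d2 - e
   k d1. After both substitutions only the multiple of e^5 D survives in the first coordinate. *)
have E3' : j%:R - j'%:R = e ^+ 4 * (- (h * uR * v + 2 * y * v ^+ 3) * c1).
  rewrite E3 e4; apply: (nil 0 0 0 0 (72 * y ^+ 2 * uR * v * c1) 0); ring.
have jj : j = j'.
  by rewrite -eN in E3'; apply: (Zq_small_eq p_pr r_gt0 (le_r 4 _) lj lj' E3').
have [d1 d1E] : exists d1, c1 = e ^+ 2 * d1.
  apply: (kill 4) => //; rewrite jj subrr in E3'.
  (* The factor is minus the inverse of u v / 2 + 2 y v^3 as far as e^4 can see: 2 / (u v) times a
     geometric series in 4 y v^2 / u, cut after the linear term since e^4 y^2 = 0. *)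
  have -> : e ^+ 4 * c1 =
     e ^+ 4 * (- (h * uR * v + 2 * y * v ^+ 3) * c1) *
       (- 2 * iu * iv * (1 - 4 * iu * y * v ^+ 2)).
    have inv : (h * uR * v + 2 * y * v ^+ 3) * (2 * iu * iv) =
        1 + 4 * y * v ^+ 2 * iu.
      have -> : (h * uR * v + 2 * y * v ^+ 3) * (2 * iu * iv) =
        2 * h * (uR * iu) * (v * iv) + 4 * y * v ^+ 2 * iu * (v * iv) by ring.
      by rewrite h2 uiu viv; ring.
    have -> : e ^+ 4 * (- (h * uR * v + 2 * y * v ^+ 3) * c1) *
        (- 2 * iu * iv * (1 - 4 * iu * y * v ^+ 2)) =
        e ^+ 4 * ((h * uR * v + 2 * y * v ^+ 3) * (2 * iu * iv)) *
        ((1 - 4 * iu * y * v ^+ 2) * c1) by ring.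
    by rewrite inv e4; apply: (nil 0 (256 * iu ^+ 2 * v ^+ 4 * c1) 0 0 0 0); ring.
  by rewrite -E3' mul0r.
have E2' : c%:R - c'%:R = e ^+ 4 * (e * kR * d1 + c2).
  rewrite E2 d1E e4; apply: (nil (16 * uR * v * d1) 0 0
    (12 * y * e * kR * d1 + 36 * y ^+ 2 * uR * v * d1) 0 0); ring.
have cc : c = c'.
  by rewrite -eN in E2'; apply: (Zq_small_eq p_pr r_gt0 (le_r 4 _) lc lc' E2').
have [d2 d2E] : exists d2, e * kR * d1 + c2 = e ^+ 2 * d2.
  by apply: (kill 4) => //; rewrite -E2' cc subrr.
have [D' D'E] : exists D' : R, 2 * kR ^+ 2 - uR ^+ 3 = (p ^ s)%:R * D'.
  have /dvdzP[w wE] := pD; exists w%:~R.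
  have := congr1 (fun z : int => z%:~R : R) wE.
  rewrite rmorphB !rmorphM !rmorphXn /= mulrC => E; apply: etrans E _.
  by rewrite mulrC.
have E1' : i%:R - i'%:R = (p ^ (5 * n + s))%:R * (D' * c3).
  rewrite expnD natrM eN -mulrA [_ * (D' * _)]mulrA -D'E E1.
  have -> : c2 = e ^+ 2 * d2 - e * kR * d1 by rewrite -d2E; ring.
  set n3 := 2 * y * uR * (1 + 12 * y * uR) * (12 * y * uR - 1).
  rewrite d1E; apply: (nil (- 32 * uR ^+ 2 * (1 + n3) * d1 + 128 * kR ^+ 2 * iu * d1)
    0 (- 384 * kR * iu * d2)
    (- (e ^+ 3 + 12 * y * e) * (2 * kR ^+ 2 - uR ^+ 3) * c3
     - 72 * y ^+ 2 * uR ^+ 2 * (1 + n3) * d1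
     - 288 * y ^+ 2 * kR * iu * e * d2 + 288 * y ^+ 2 * kR ^+ 2 * iu * d1) 0 0); ring.
split=> //; apply: (Zq_small_eq p_pr r_gt0 _ li li' E1').
by rewrite (@leq_trans (5 * n + n)) ?leq_add2l // -mulSnr.
Qed.

End Concrete.

End PermutationModel.

(** * Relations between powers in a p-group *)

Section Powers.
Local Open Scope group_scope.
Local Open Scope ring_scope.

Section IntPower.
Variable gT : finGroupType.
Implicit Types (x y : gT) (i j : int) (m n : nat).

Lemma zpowgN x i : zpowg x (- i) = (zpowg x i)^-1%g.
Proof.
case: i => [[|m]|m] //=; first by rewrite invg1.
by rewrite invgK.
Qed.

Lemma zpowgB_nat x m n : zpowg x (m%:Z - n%:Z) = (x ^+ m * x ^- n)%g.
Proof.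
case: (leqP n m) => le.
  by rewrite subzn //= -{2}(subnK le) expgD mulgK.
rewrite -opprB zpowgN subzn ?(ltnW le) //= -{2}(subnK (ltnW le)) expgD.
by rewrite -[RHS]invgK invMg invgK mulgK.
Qed.

Lemma int_subn i : exists m n, i = m%:Z - n%:Z.
Proof.
case: i => m; first by exists m, 0%N; rewrite subr0.
by exists 0%N, m.+1; rewrite NegzE sub0r.
Qed.

Lemma zpowgD x i j : zpowg x (i + j) = (zpowg x i * zpowg x j)%g.
Proof.
have [m [n ->]] := int_subn i; have [m' [n' ->]] := int_subn j.
rewrite addrACA -opprD -!PoszD !zpowgB_nat !expgD invMg.
have c : commute (x ^- n)%g (x ^+ m' * x ^- n')%g.
  apply: commuteM; last apply: commuteV; apply/commute_sym/commuteV/commuteX2;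
  exact: commute_refl.
rewrite -!mulgA; congr (_ * _)%g; rewrite [RHS]c -mulgA.
by [].
Qed.

Lemma zpowg1 x : zpowg x 1 = x. Proof. exact: expg1. Qed.

Lemma zpowgMn x i m : zpowg x (i * m%:Z) = (zpowg x i ^+ m)%g.
Proof.
elim: m => [|m IHm]; first by rewrite mulr0.
by rewrite -addn1 PoszD mulrDr mulr1 zpowgD IHm expgD expg1.
Qed.

Lemma zpowgM x i j : zpowg x (i * j) = zpowg (zpowg x i) j.
Proof.
case: j => m; first exact: zpowgMn.
by rewrite NegzE mulrN !zpowgN; congr (_ ^-1)%g; apply: zpowgMn.
Qed.

Lemma zpowgMl x m i : zpowg x (m%:Z * i) = zpowg (x ^+ m)%g i.
Proof. by rewrite zpowgM. Qed.

Lemma zpowgJ x y i : (zpowg x i ^ y)%g = zpowg (x ^ y)%g i.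
Proof. by case: i => m /=; rewrite ?conjVg conjXg. Qed.

Lemma zpowgV x i : zpowg x^-1%g i = (zpowg x i)^-1%g.
Proof. by rewrite -zpowgN -mulN1r zpowgM /= expg1. Qed.

Lemma mem_zpowg (G : {group gT}) x i : x \in G -> zpowg x i \in G.
Proof. by case: i => m Gx /=; rewrite ?groupV groupX. Qed.

Lemma zpowgMg x y i : commute x y -> zpowg (x * y)%g i = (zpowg x i * zpowg y i)%g.
Proof.
move=> c; case: i => m /=; first exact: expgMn.
rewrite (expgMn _ c) invMg; apply/commuteV/commute_sym/commuteV.
exact/commute_sym/commuteX2.
Qed.

Lemma zpowg1n i : zpowg (1%g : gT) i = 1%g.
Proof. by case: i => m /=; rewrite expg1n ?invg1. Qed.

Lemma zpowg_eqmod x M i j :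
  (x ^+ M = 1)%g -> (M%:Z %| i - j)%Z -> zpowg x i = zpowg x j.
Proof.
move=> x1 /dvdzP[w E]; rewrite -(subrK j i) E zpowgD mulrC zpowgMl x1 zpowg1n.
by rewrite mul1g.
Qed.

Lemma zpowg_dvd x M i : (x ^+ M = 1)%g -> (M%:Z %| i)%Z -> zpowg x i = 1%g.
Proof. by move=> x1 d; rewrite (@zpowg_eqmod x M i 0) // subr0. Qed.

End IntPower.

Section PadicInt.
Variable p : nat.
Hypotheses (p_pr : prime p) (p_gt2 : (2 < p)%N).

Lemma coprimez_pX (z : int) M : ~~ (p%:Z %| z)%Z -> coprimez ((p ^ M)%N%:Z) z.
Proof.
move=> pz; rewrite coprimezE absz_nat coprimeXl // prime_coprime //.
Qed.

Lemma inv_mod_pX (z : int) M : ~~ (p%:Z %| z)%Z ->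
  exists w : int, ((p ^ M)%N%:Z %| z * w - 1)%Z.
Proof.
move=> /(coprimez_pX M)/coprimezP[[s t] /= E]; exists t.
by rewrite -E; apply/dvdzP; exists (- s); ring.
Qed.

(* p-elements generate the same cyclic group as their prime-to-p powers. *)
Lemma pelt_root (gT : finGroupType) (H : {group gT}) (x : gT) M (z : int) :
  (x ^+ (p ^ M) = 1)%g -> ~~ (p%:Z %| z)%Z -> zpowg x z \in H -> x \in H.
Proof.
move=> x1 /(inv_mod_pX M)[w d] xz.
by rewrite -[x]zpowg1 -(zpowg_eqmod x1 d) zpowgM mem_zpowg.
Qed.

Lemma dvd_mul2 (z : int) j :
  ((p ^ j)%N%:Z %| 2 * z)%Z -> ((p ^ j)%N%:Z %| z)%Z.
Proof.
have p2 : ~~ (p%:Z %| 2)%Z by rewrite dvdzE /= gtnNdvd.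
by rewrite (Gauss_dvdzr _ (coprimez_pX j p2)).
Qed.

Lemma dvd_mul6 (z : int) j :
  ((p ^ j.+1)%N%:Z %| 6 * z)%Z -> ((p ^ j)%N%:Z %| z)%Z.
Proof.
have -> : 6 * z = 2 * (3 * z) by ring.
move/dvd_mul2.
have [-> | p3] := eqVneq p 3.
  by rewrite expnS PoszM dvdz_mul2l.
have np3 : ~~ (p%:Z %| 3)%Z by rewrite dvdzE /= dvdn_prime2.
rewrite (Gauss_dvdzr _ (coprimez_pX _ np3)); apply: dvdz_trans.
by rewrite dvdzE !absz_nat dvdn_exp2l.
Qed.

End PadicInt.

Lemma PoszX_exp (m i : nat) : (m ^ i)%N%:Z = m%:Z ^+ i.
Proof. by elim: i => // i IHi; rewrite expnS PoszM IHi exprS. Qed.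

Lemma pow_expand (x : int) i :
  exists c, (1 + x) ^+ i = 1 + i%:Z * x + 'C(i, 2)%:Z * x ^+ 2 + x ^+ 3 * c.
Proof.
elim: i => [|i [c IHi]]; first by exists 0; rewrite expr0 bin0n /=; ring.
exists (c + c * x + 'C(i, 2)%:Z).
by rewrite exprSr IHi binS bin1 PoszD (intS i); ring.
Qed.

Lemma geom_expand (b : nat) (x : int) t : b%:Z = 1 + x ->
  exists c, (geom b t)%:Z =
    t%:Z + 'C(t, 2)%:Z * x + 'C(t, 3)%:Z * x ^+ 2 + x ^+ 3 * c.
Proof.
move=> bE; elim: t => [|t [c IHt]].
  by exists 0; rewrite /geom big_ord0 !bin0n /=; ring.
have [d hd] := pow_expand x t; exists (c + d).
rewrite /geom big_ord_recr /= PoszD -/(geom b t) IHt PoszX_exp bE hd.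
by rewrite !binS bin1 !PoszD (intS t); ring.
Qed.

(** * Expansions of the exponents in powers of P = p^n *)

Section Expansions.
Variables (p n b : nat) (v : int).
Hypotheses (p_pr : prime p) (p_gt2 : (2 < p)%N) (n_gt0 : (0 < n)%N).
Let P : int := (p ^ n)%N%:Z.
Hypothesis bE : b%:Z = 1 + P ^+ 2 * v.

Lemma P_exp j : (p ^ (n * j))%N%:Z = P ^+ j.
Proof. by rewrite /P expnM PoszX_exp. Qed.

Lemma P_dvd6 j (z : int) : (P ^+ j.+1 %| 6 * z)%Z -> (P ^+ j %| z)%Z.
Proof.
rewrite -!P_exp => d; apply: (dvd_mul6 p_pr p_gt2); apply: dvdz_trans d.
by rewrite dvdzE !absz_nat dvdn_exp2l // mulnS -[(n * j).+1]add1n leq_add2r.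
Qed.

Lemma P_dvd2 j (z : int) : (P ^+ j %| 2 * z)%Z -> (P ^+ j %| z)%Z.
Proof. by rewrite -P_exp; apply: (dvd_mul2 p_pr p_gt2). Qed.

Lemma bin2_dvd j t : (P ^+ j %| t%:Z)%Z -> (P ^+ j %| 'C(t, 2)%:Z)%Z.
Proof.
move=> d; apply: P_dvd2; have := sqr_bin2 int t; rewrite !natz => E.
have -> : 2 * 'C(t, 2)%:Z = (t%:Z - 1) * t%:Z.
  by apply: (addIr (t%:Z)); rewrite -E; ring.
by rewrite dvdz_mull.
Qed.

Lemma bin3_dvd j t : (P ^+ j.+1 %| t%:Z)%Z -> (P ^+ j %| 'C(t, 3)%:Z)%Z.
Proof.
move=> d; apply: P_dvd6; have := bin3_mul6 int t; rewrite !natz => ->.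
by rewrite -mulrA dvdz_mulr.
Qed.

(** With a for b, this difference is the exponent of A in B^(A^t) = B A^x C^-t. The constant terms t
    cancel, and each linear term gains P^2; j <= 4 ensures that the cubic remainders, multiples of
    P^6, are divisible by P^(j+2). *)
Lemma geom_defect_dvd j t : (0 < j <= 4)%N -> (P ^+ j %| t%:Z)%Z ->
  (P ^+ j.+2 %| t%:Z * b%:Z ^+ t - b%:Z * (geom b t)%:Z)%Z.
Proof.
case/andP=> j0 j4 d; have d2 := bin2_dvd d.
have d3 : (P ^+ j.-1 %| 'C(t, 3)%:Z)%Z by apply: bin3_dvd; rewrite prednK.
have [c hc] := pow_expand (P ^+ 2 * v) t; have [c' hc'] := geom_expand t bE.
have [i ji] : exists i, P ^+ 6 = P ^+ j * P ^+ 2 * i.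
  by exists (P ^+ (4 - j)); rewrite -!exprD addnAC subnKC.
have x3 : (P ^+ 2 * v) ^+ 3 = P ^+ j * P ^+ 2 * i * v ^+ 3.
  by rewrite -ji; ring.
have jj : P ^+ j = P ^+ j.-1 * P by rewrite -exprSr prednK.
rewrite hc' bE hc x3.
case/dvdzP: d => s ->; case/dvdzP: d2 => s2 ->; case/dvdzP: d3 => s3 ->.
have -> : P ^+ j.+2 = P ^+ j * P ^+ 2 by rewrite -exprD addn2.
rewrite jj; set Q := P ^+ j.-1; apply/dvdzP.
exists (s ^+ 2 * Q * P * v + s * s2 * Q * P * P ^+ 2 * v ^+ 2
  + s * Q * P * i * v ^+ 3 * c - s * v
  - (1 + P ^+ 2 * v) * (s2 * v + s3 * P * v ^+ 2 + i * v ^+ 3 * c')).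
by ring.
Qed.

(* The exponent H = b^b - (1 + b + ... + b^(b-1)) is (b-1)^2 / 2 to leading order. *)
Lemma geom_top_expand : exists z,
  2 * (b%:Z ^+ b - (geom b b)%:Z) = P ^+ 4 * v ^+ 2 + P ^+ 5 * z.
Proof.
have [c hc] := pow_expand (P ^+ 2 * v) b; have [c' hc'] := geom_expand b bE.
have C2 := sqr_bin2 int b; rewrite !natz in C2.
have d3 : (P ^+ 1 %| 'C(b, 3)%:Z)%Z.
  apply: P_dvd6; have := bin3_mul6 int b; rewrite !natz => ->.
  rewrite -mulrA mulrCA dvdz_mulr // bE; apply/dvdzP; exists v; ring.
case/dvdzP: d3 => s3 E3.
exists (P ^+ 3 * v ^+ 4 - 2 * s3 * v ^+ 2 + 2 * P * v ^+ 3 * (c - c')).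
rewrite hc' bE hc -bE E3.
have {}C2 : 2 * 'C(b, 2)%:Z = b%:Z ^+ 2 - b%:Z by rewrite C2 addrK.
rewrite bE in C2 *.
have -> : 2 * (1 + (1 + P ^+ 2 * v) * (P ^+ 2 * v) +
    'C(b, 2)%:Z * (P ^+ 2 * v) ^+ 2 + (P ^+ 2 * v) ^+ 3 * c -
    (1 + P ^+ 2 * v + 'C(b, 2)%:Z * (P ^+ 2 * v) +
     s3 * P ^+ 1 * (P ^+ 2 * v) ^+ 2 + (P ^+ 2 * v) ^+ 3 * c')) =
   2 * (P ^+ 2 * v) ^+ 2 - 2 * 'C(b, 2)%:Z * (P ^+ 2 * v)
   + 2 * 'C(b, 2)%:Z * (P ^+ 2 * v) ^+ 2 - 2 * s3 * P ^+ 1 * (P ^+ 2 * v) ^+ 2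
   + 2 * (P ^+ 2 * v) ^+ 3 * (c - c') by ring.
by rewrite C2; ring.
Qed.

(** Lifting the exponent for odd p. That w stays prime to p matters: exponents prime to p are later
    removed by [pelt_root]. *)
Lemma pow_pexp j : ~~ (p%:Z %| v)%Z -> exists w,
  ~~ (p%:Z %| w)%Z /\ b%:Z ^+ (p ^ j) = 1 + (p ^ (2 * n + j))%N%:Z * w.
Proof.
move=> pv; elim: j => [|j [w [pw IHj]]].
  by exists v; rewrite expr1 addn0 bE mulnC P_exp.
set q := (p ^ (2 * n + j))%N%:Z in IHj.
have [c hc] := pow_expand (q * w) p.
have [q' qE] : exists q', q = p%:Z * q'.
  exists (p ^ (2 * n + j).-1)%N%:Z; rewrite -PoszM -expnS prednK //.
  by rewrite addn_gt0 muln_gt0 n_gt0.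
have [s sE] : exists s, 'C(p, 2)%:Z = s * p%:Z.
  apply/dvdzP; rewrite dvdzE !absz_nat prime_dvd_bin // p_gt2 andbT //.
exists (w + p%:Z * (s * q' * w ^+ 2 + q' ^+ 2 * w ^+ 3 * c)); split.
  apply: contra pw => pw; rewrite -[w](addrK (p%:Z *
    (s * q' * w ^+ 2 + q' ^+ 2 * w ^+ 3 * c))) rpredB //.
  by rewrite dvdz_mulr.
rewrite expnSr exprM IHj hc sE addnS expnS PoszM -/q qE; ring.
Qed.

End Expansions.

Section TopExponent.
Variables (p n b : nat) (v : int).
Hypotheses (p_pr : prime p) (p_gt2 : (2 < p)%N) (n_gt0 : (0 < n)%N).
Let P : int := (p ^ n)%N%:Z.
Hypothesis bE : b%:Z = 1 + P ^+ 2 * v.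
Hypothesis pv : ~~ (p%:Z %| v)%Z.

Lemma p_dvd_P : (p%:Z %| P)%Z.
Proof. by rewrite dvdzE !absz_nat dvdn_exp. Qed.

Lemma P_neq0 : P != 0.
Proof. by rewrite eqz_nat -lt0n expn_gt0 prime_gt0. Qed.

Lemma p_ndvd_add (z z' : int) : ~~ (p%:Z %| z)%Z -> ~~ (p%:Z %| z + P * z')%Z.
Proof.
apply: contra => d; rewrite -[z](addrK (P * z')) rpredB //.
by rewrite dvdz_mulr // p_dvd_P.
Qed.

Lemma p_ndvdM (z z' : int) :
  ~~ (p%:Z %| z)%Z -> ~~ (p%:Z %| z')%Z -> ~~ (p%:Z %| z * z')%Z.
Proof. by rewrite !dvdzE abszM !absz_nat Euclid_dvdM // => /negPf-> /negPf->. Qed.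

Lemma p_ndvd2 : ~~ (p%:Z %| 2)%Z. Proof. by rewrite dvdzE /= gtnNdvd. Qed.

Lemma p_ndvd_half (z z' : int) :
  ~~ (p%:Z %| z)%Z -> 2 * z' = z -> ~~ (p%:Z %| z')%Z.
Proof. by move=> pz E; apply: contra pz => d; rewrite -E dvdz_mull. Qed.

Lemma base_pow_expand i : exists c, b%:Z ^+ i = 1 + P ^+ 2 * c.
Proof.
have [c hc] := pow_expand (P ^+ 2 * v) i.
exists (i%:Z * v + 'C(i, 2)%:Z * P ^+ 2 * v ^+ 2 + P ^+ 4 * v ^+ 3 * c).
by rewrite bE hc; ring.
Qed.

Lemma p_ndvd1 (c : int) : ~~ (p%:Z %| 1 + P * c)%Z.
Proof.
apply: p_ndvd_add; rewrite dvdzE /= dvdn1.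
by apply: contraTneq p_gt2 => ->.
Qed.

Lemma top_unit : exists w z, [/\ b%:Z ^+ b - (geom b b)%:Z = P ^+ 4 * w,
  2 * w = v ^+ 2 + P * z & ~~ (p%:Z %| w)%Z].
Proof.
have [z hz] := geom_top_expand p_pr p_gt2 n_gt0 bE.
have d : (P ^+ 4 %| b%:Z ^+ b - (geom b b)%:Z)%Z.
  apply: (P_dvd2 p_pr p_gt2 (n := n)); rewrite hz; apply/dvdzP.
  by exists (v ^+ 2 + P * z); rewrite -/P; ring.
case/dvdzP: d => w wE; exists w, z.
have E : 2 * w = v ^+ 2 + P * z.
  apply: (mulfI (expf_neq0 4 P_neq0)); rewrite mulrCA [_ * w]mulrC -wE hz.
  by rewrite -/P; ring.
split=> //; first by rewrite wE mulrC.
by apply: p_ndvd_half E; apply/p_ndvd_add/p_ndvdM.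
Qed.

(** b^b is invertible modulo p^M, so h exists, and it equals -P^4 v^2 / 2 to leading order. It is
    the exponent for which B^h = B^-1 C^-b B^(geom b b) C^b. *)
Lemma top_solve M : (5 * n <= M)%N -> exists (h : nat) (h1 z : int),
  [/\ ((p ^ M)%N%:Z %| h%:Z * b%:Z ^+ b + (b%:Z ^+ b - (geom b b)%:Z))%Z,
      h%:Z = P ^+ 4 * h1, 2 * h1 = - v ^+ 2 + P * z & ~~ (p%:Z %| h1)%Z].
Proof.
move=> leM; have [w [z [wE w2 pw]]] := top_unit.
set H := b%:Z ^+ b - _ in wE *.
have [c bb] := base_pow_expand b.
have pbb : ~~ (p%:Z %| b%:Z ^+ b)%Z.
  by rewrite bb -[P ^+ 2]/(P * P) -mulrA p_ndvd1.
have [y hy] := inv_mod_pX p_pr M pbb.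
have pM0 : (p ^ M)%N%:Z != 0 by rewrite eqz_nat -lt0n expn_gt0 prime_gt0.
exists `|(- (H * y) %% (p ^ M)%N)%Z|%N.
have -> : `|(- (H * y) %% (p ^ M)%N)%Z|%N%:Z = (- (H * y) %% (p ^ M)%N)%Z.
  by rewrite gez0_abs // modz_ge0.
set h := (_ %% _)%Z.
have dh : ((p ^ M)%N%:Z %| h * b%:Z ^+ b + H)%Z.
  have -> : h * b%:Z ^+ b + H =
      - (- (H * y) %/ (p ^ M)%N)%Z * b%:Z ^+ b * (p ^ M)%N%:Z
      - H * (b%:Z ^+ b * y - 1).
    rewrite /h {1}/modz; set q := (_ %/ _)%Z; ring.
  by rewrite rpredB // dvdz_mull.
have [s hs] : exists s, h * b%:Z ^+ b + H = P ^+ 5 * s.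
  have d5 : (P ^+ 5 %| h * b%:Z ^+ b + H)%Z.
    rewrite -P_exp; apply: dvdz_trans dh.
    by rewrite dvdzE !absz_nat dvdn_exp2l // mulnC.
  by case/dvdzP: d5 => s ->; exists s; rewrite mulrC.
have d4 : (P ^+ 4 %| h)%Z.
  rewrite -P_exp -(Gauss_dvdzr _ (coprimez_pX p_pr (n * 4) pbb)) P_exp mulrC.
  have -> : h * b%:Z ^+ b = P ^+ 5 * s - P ^+ 4 * w by rewrite -hs -wE addrK.
  by apply/dvdzP; exists (P * s - w); ring.
case/dvdzP: d4 => h1 h1E.
have E1 : h1 * (1 + P ^+ 2 * c) = P * s - w.
  apply: (mulfI (expf_neq0 4 P_neq0)); rewrite -bb.
  have -> : P ^+ 4 * (h1 * b%:Z ^+ b) = h * b%:Z ^+ b by rewrite h1E; ring.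
  by rewrite -[LHS](addrK H) hs wE; ring.
have E2 : 2 * h1 = - v ^+ 2 + P * (2 * s - z - 2 * P * c * h1).
  have -> : 2 * h1 = 2 * (h1 * (1 + P ^+ 2 * c)) - 2 * P ^+ 2 * c * h1 by ring.
  by rewrite E1 mulrBr w2; ring.
exists h1, (2 * s - z - 2 * P * c * h1); split=> //; first by rewrite h1E mulrC.
apply: p_ndvd_half E2; apply: p_ndvd_add.
by rewrite -mulN1r p_ndvdM // ?p_ndvdM // dvdzE /= dvdn1; apply: contraTneq p_gt2 => ->.
Qed.

End TopExponent.

(** * Power relations: one half of the symmetric argument *)

Section Half.
Variables (gT : finGroupType) (A B C : gT) (p n a b M : nat) (u v k : int).
Hypotheses (p_pr : prime p) (p_gt2 : (2 < p)%N) (n_gt0 : (0 < n)%N).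
Let P : int := (p ^ n)%N%:Z.
Hypotheses (rels : mrels a b A B C).
Hypotheses (aE : a%:Z = 1 + P ^+ 2 * u) (bE : b%:Z = 1 + P ^+ 2 * v).
Hypotheses (abE : a%:Z - b%:Z = P ^+ 3 * k).
Hypotheses (pu : ~~ (p%:Z %| u)%Z) (pv : ~~ (p%:Z %| v)%Z).
Hypotheses (leM : (6 * n <= M)%N).
Hypotheses (AM : (A ^+ (p ^ M) = 1)%g) (BM : (B ^+ (p ^ M) = 1)%g)
  (CM : (C ^+ (p ^ M) = 1)%g).

Let Ha := a%:Z ^+ a - (geom a a)%:Z.

Let eA : (A ^- (a * geom a a) * A ^+ (a * a ^ a))%g = zpowg A (a%:Z * Ha).
Proof.
rewrite /Ha mulrBr -PoszX_exp -!PoszM zpowgB_nat.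
exact/commute_sym/commuteV/commuteX2/commute_refl.
Qed.

Lemma zpowg_P j (x : gT) i : zpowg x (P ^+ j * i) = zpowg (x ^+ (p ^ (j * n)))%g i.
Proof. by rewrite -P_exp mulnC zpowgMl. Qed.

(** Equates [conj_powA] at t = a with [conj_powAC] at j = 1; the two powers of B separated by C^-b
    are merged into B^h by [top_solve]. *)
Lemma half_relation : exists (h : nat) (h1 z : int),
  [/\ h%:Z = P ^+ 4 * h1, 2 * h1 = - v ^+ 2 + P * z, ~~ (p%:Z %| h1)%Z &
      zpowg A (a%:Z * Ha) = (B ^+ h * (C ^- b * C ^+ a))%g].
Proof.
have [|h [h1 [z [dh hE h2 ph]]]] := top_solve p_pr p_gt2 n_gt0 bE pv (M := M).
  by apply: leq_trans leM; rewrite leq_mul2r orbT.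
exists h, h1, z; split=> //; have [h1' h2' _] := rels.
have := conj_powA a rels; have := conj_powAC 1 rels; rewrite !expn1 => -> E.
have BC : ((B ^+ (b * geom b b)) ^ C = B ^+ geom b b)%g.
  by rewrite expgM -h2' -conjXg -conjgM mulVg conjg1.
rewrite expg1 BC in E.
have {}E : zpowg A (a%:Z * Ha) = (B^-1 * (C ^- b * B ^+ geom b b) * C ^+ a)%g.
  rewrite E -eA -!mulgA mulKg; congr (_ * _)%g.
  by rewrite mulVg mulg1.
have Bh : ((B ^+ h) ^ (C ^- b) = (B^-1 * (C ^- b * B ^+ geom b b * C ^+ b)) ^ (C ^- b))%g.
  have -> : ((B^-1 * (C ^- b * B ^+ geom b b * C ^+ b)) ^ (C ^- b) =
     (B ^ (C ^- b))^-1 * B ^+ geom b b)%g.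
    by rewrite conjMg conjVg; congr (_ * _)%g; rewrite conjgE mulgK mulKg.
  rewrite -expgVn (conjXX_rel _ _ h2') (conjX_rel _ h2').
  have -> : ((B ^+ (b ^ b))^-1 * B ^+ geom b b)%g =
      zpowg B (- (b ^ b)%N%:Z + (geom b b)%:Z) by rewrite zpowgD zpowgN.
  apply: (zpowg_eqmod BM (i := (h * b ^ b)%N%:Z)).
  have -> : (h * b ^ b)%N%:Z - (- (b ^ b)%N%:Z + (geom b b)%:Z) =
      h%:Z * b%:Z ^+ b + (b%:Z ^+ b - (geom b b)%:Z).
    by rewrite PoszM PoszX_exp; ring.
  exact: dh.
by rewrite E (conjg_inj (C ^- b)%g Bh) -!mulgA mulKVg.
Qed.

(** [tower_cycle] at j = 1 puts A^(a (a - 1) Ha) into <B>, where a - 1 is P^2 and Ha is P^4 up to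
    factors prime to p. *)
Lemma half_cycle : (A ^+ (p ^ (6 * n)))%g \in <[B]>%g.
Proof.
have [w [z [wE _ pw]]] := top_unit p_pr p_gt2 n_gt0 aE pu.
have := tower_cycle 1 rels; cbv zeta; rewrite !expn1 eA zpowgJ.
have [h1 _ _] := rels; rewrite h1 -zpowgMl -zpowgN -zpowgD => H.
apply: (@pelt_root _ p_pr _ _ _ M (a%:Z * u * w)).
- by rewrite -expgM mulnC expgM AM expg1n.
- apply: p_ndvdM => //; apply: p_ndvdM => //.
  by rewrite aE -[P ^+ 2]/(P * P) -mulrA p_ndvd1.
suff <- : zpowg A (a%:Z * (a%:Z * Ha) + - (a%:Z * Ha)) =
          zpowg (A ^+ (p ^ (6 * n)))%g (a%:Z * u * w) by [].
rewrite -zpowg_P; congr zpowg; rewrite /Ha wE {1}aE -/P; ring.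
Qed.

(** This is [half_cycle] for the mirrored triple, and [B6] below is the mirrored [half_expA]; both
    are supplied when the two halves are combined. *)
Hypothesis Bcyc : (B ^+ (p ^ (6 * n)))%g \in <[A]>%g.

(** B^h is a power of A times C^-a C^b, so both conjugate A in the same way. The conjugate by B^h
    comes from the mirrored [conj_powA], whose defect is a multiple of P^6 because P^4 divides h. *)
Lemma half_conj (h : nat) (h1 : int) : h%:Z = P ^+ 4 * h1 ->
  zpowg A (a%:Z * Ha) = (B ^+ h * (C ^- b * C ^+ a))%g ->
  exists e, (A ^ (C ^- a * C ^+ b) =
    A * zpowg (B ^+ (p ^ (6 * n))) e * C ^+ h)%g.
Proof.
move=> hE E; have d4 : (P ^+ 4 %| h%:Z)%Z by rewrite hE dvdz_mulr.
have := geom_defect_dvd p_pr p_gt2 n_gt0 bE (j := 4) isT d4.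
case/dvdzP => e eE; exists e.
have := conj_powA h (mrels_sym rels); rewrite expgVn invgK.
have -> : (A * B ^- (b * geom b h) * B ^+ (h * b ^ h))%g =
    (A * zpowg B (h%:Z * b%:Z ^+ h - b%:Z * (geom b h)%:Z))%g.
  rewrite -mulgA; congr (_ * _)%g; rewrite -PoszX_exp -!PoszM addrC.
  by rewrite zpowgD zpowgN.
rewrite eE mulrC zpowg_P => <-.
have {}E : (B ^+ h = zpowg A (a%:Z * Ha) * (C ^- a * C ^+ b))%g.
  by rewrite E -mulgA [(C ^- b * _ * _)%g]mulgA mulgK mulVg mulg1.
rewrite E [RHS]conjgM; congr (_ ^ _)%g.
apply/esym/conjg_fixP/commgP.
by have /cycleP[i ->] : zpowg A (a%:Z * Ha) \in <[A]>%g;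
  [rewrite mem_zpowg ?cycle_id | apply: commuteX].
Qed.

Lemma half_cycleC : (C ^+ (p ^ (4 * n)))%g \in <[A]>%g.
Proof.
have [h [h1 [z [hE _ ph E]]]] := half_relation.
have [e Ee] := half_conj hE E; have [h1' _ _] := rels.
have nA : C \in 'N(<[A]>)%g := conjX_norm h1'.
apply: (@pelt_root _ p_pr _ _ _ M h1) => //.
  by rewrite -expgM mulnC expgM CM expg1n.
rewrite -zpowg_P -hE.
have : (A * zpowg (B ^+ (p ^ (6 * n))) e * C ^+ h)%g \in <[A]>%g.
  by rewrite -Ee memJ_norm ?cycle_id // groupM ?groupV ?groupX.
by rewrite groupMl // groupM ?cycle_id ?mem_zpowg.
Qed.

Lemma half_commute : commute A (C ^+ (p ^ (4 * n)))%g.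
Proof.
have /cycleP[i ->] := half_cycleC.
exact/commuteX/commute_refl.
Qed.

(** C^(P^4) lies in <A> and so fixes A, yet it acts as the power a^(P^4), which exceeds 1 by P^6
    times a number prime to p. *)
Lemma half_expA : (A ^+ (p ^ (6 * n)) = 1)%g.
Proof.
have [h1 _ _] := rels; have [w [pw wE]] := pow_pexp p_pr p_gt2 n_gt0 aE (4 * n) pu.
apply/set1gP; apply: (@pelt_root _ p_pr _ 1%G _ M w) => //.
  by rewrite -expgM mulnC expgM AM expg1n.
have -> : (6 * n = 2 * n + 4 * n)%N by rewrite -mulnDl.
apply/set1gP; apply: (mulgI A); rewrite mulg1 -zpowgMl -{1}(zpowg1 A) -zpowgD -wE.
rewrite -PoszX_exp -[zpowg _ _]/(A ^+ (a ^ (p ^ (4 * n))))%g -(conjX_rel _ h1).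
exact/conjg_fixP/commgP/half_commute.
Qed.

Lemma pow_diff : (P ^+ 6 %| a%:Z ^+ b - a%:Z ^+ a + P ^+ 5 * k * u)%Z.
Proof.
have [c hc] := pow_expand (P ^+ 2 * u) a; have [d hd] := pow_expand (P ^+ 2 * u) b.
have Ca := sqr_bin2 int a; have Cb := sqr_bin2 int b; rewrite !natz in Ca Cb.
have dC : (P ^+ 3 %| 'C(b, 2)%:Z - 'C(a, 2)%:Z)%Z.
  apply: (P_dvd2 p_pr p_gt2 (n := n)); apply/dvdzP.
  exists (- k * (a%:Z + b%:Z - 1)).
  have -> : 2 * ('C(b, 2)%:Z - 'C(a, 2)%:Z) =
     (2 * 'C(b, 2)%:Z + b%:Z) - (2 * 'C(a, 2)%:Z + a%:Z) + (a%:Z - b%:Z) by ring.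
  rewrite -Ca -Cb.
  have -> : - k * (a%:Z + b%:Z - 1) * (p ^ n)%N%:Z ^+ 3 =
     - (P ^+ 3 * k) * (a%:Z + b%:Z - 1) by rewrite -/P; ring.
  by rewrite -abE; ring.
case/dvdzP: dC => s sE; apply/dvdzP; exists (P * s * u ^+ 2 + u ^+ 3 * (d - c)).
rewrite aE hc hd.
have -> : 1 + b%:Z * (P ^+ 2 * u) + 'C(b, 2)%:Z * (P ^+ 2 * u) ^+ 2 +
    (P ^+ 2 * u) ^+ 3 * d -
    (1 + a%:Z * (P ^+ 2 * u) + 'C(a, 2)%:Z * (P ^+ 2 * u) ^+ 2 +
     (P ^+ 2 * u) ^+ 3 * c) + P ^+ 5 * k * u =
   - (a%:Z - b%:Z) * (P ^+ 2 * u)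
   + ('C(b, 2)%:Z - 'C(a, 2)%:Z) * (P ^+ 2 * u) ^+ 2
   + (P ^+ 2 * u) ^+ 3 * (d - c) + P ^+ 5 * k * u by ring.
by rewrite abE sE; ring.
Qed.

Hypothesis B6 : (B ^+ (p ^ (6 * n)) = 1)%g.

(** Conjugating [half_conj] by C^a gives C^h = A^(a^b - a^a) = A^(-P^5 k u). A further power P kills
    the right side, so C^(P^5) = 1; then 2h may be replaced by -P^4 u^2, and the exponent u
    cancels. *)
Lemma half_powC : (C ^+ (p ^ (5 * n)) = 1)%g /\
  zpowg C (P ^+ 4 * u) = zpowg A (2 * (P ^+ 5 * k)).
Proof.
have A6 := half_expA; have [h1' _ _] := rels.
have A6' i : (P ^+ 6 %| i)%Z -> zpowg A i = 1%g.
  by move=> d; apply: (zpowg_dvd A6); rewrite mulnC P_exp.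
have [h [h1 [z [hE h2 ph E]]]] := half_relation.
have [e] := half_conj hE E; rewrite B6 zpowg1n mulg1 => Ee.
have Ch : zpowg C h%:Z = zpowg A (- (P ^+ 5 * k * u)).
  have : ((A ^ (C ^- a * C ^+ b)) ^ (C ^+ a) = (A * C ^+ h) ^ (C ^+ a))%g.
    by rewrite Ee.
  have cC i j : ((C ^+ i) ^ (C ^+ j) = C ^+ i)%g.
    exact/conjg_fixP/commgP/commuteX2/commute_refl.
  rewrite -conjgM conjMg cC.
  have -> : (C ^- a * C ^+ b * C ^+ a = C ^+ b)%g.
    by rewrite -mulgA -expgD addnC expgD mulKg.
  rewrite !(conjX_rel _ h1') => E'.
  have -> : zpowg C h%:Z = zpowg A (- (a ^ a)%N%:Z + (a ^ b)%N%:Z).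
    by rewrite zpowgD zpowgN /= E' mulKg.
  apply: (zpowg_eqmod A6); rewrite [(6 * n)%N]mulnC P_exp -/P !PoszX_exp.
  have -> : - a%:Z ^+ a + a%:Z ^+ b - - (P ^+ 5 * k * u) =
      a%:Z ^+ b - a%:Z ^+ a + P ^+ 5 * k * u by ring.
  exact: pow_diff.
have C5 : (C ^+ (p ^ (5 * n)) = 1)%g.
  apply/set1gP; apply: (@pelt_root _ p_pr _ 1%G _ M h1) => //.
    by rewrite -expgM mulnC expgM CM expg1n.
  rewrite -zpowg_P; have -> : P ^+ 5 * h1 = h%:Z * P by rewrite hE -/P; ring.
  rewrite zpowgM Ch -zpowgM A6' ?inE //.
  by apply/dvdzP; exists (- (k * u)); ring.
split=> //.
have C5' i : (P ^+ 5 %| i)%Z -> zpowg C i = 1%g.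
  by move=> d; apply: (zpowg_dvd C5); rewrite mulnC P_exp.
have vE : v = u - P * k.
  apply: (mulfI (expf_neq0 2 (P_neq0 n p_pr))); rewrite -/P.
  have -> : P ^+ 2 * (u - P * k) = P ^+ 2 * u - P ^+ 3 * k by ring.
  by rewrite -abE aE bE; ring.
have E1 : zpowg C (- (P ^+ 4 * u) * u) = zpowg A (- (2 * (P ^+ 5 * k)) * u).
  have -> : - (2 * (P ^+ 5 * k)) * u = - (P ^+ 5 * k * u) * 2 by ring.
  rewrite [RHS]zpowgM -Ch -zpowgM; apply: (zpowg_eqmod C5).
  rewrite mulnC P_exp hE -/P.
  have -> : - (P ^+ 4 * u) * u - P ^+ 4 * h1 * 2 =
     - P ^+ 4 * u ^+ 2 - P ^+ 4 * (2 * h1) by ring.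
  rewrite h2 vE -/P; apply/dvdzP.
  exists (- 2 * u * k + P * k ^+ 2 - z); ring.
have cAC i j : commute (zpowg C (P ^+ 4 * i)) (zpowg A j).
  rewrite zpowg_P; have c : commute A (C ^+ (p ^ (4 * n)))%g := half_commute.
  by have /cycleP[i' ->] : zpowg (C ^+ (p ^ (4 * n)))%g i \in <[(C ^+ (p ^ (4 * n)))]>%g;
    [rewrite mem_zpowg ?cycle_id | have /cycleP[j' ->] : zpowg A j \in <[A]>%g;
    [rewrite mem_zpowg ?cycle_id | apply: commuteX2; apply: commute_sym]].
suff : (zpowg C (P ^+ 4 * u) * zpowg A (- (2 * (P ^+ 5 * k))))%g \in (1%G : {group gT}).
  by rewrite inE zpowgN -eq_mulgV1 => /eqP.
apply: (@pelt_root _ p_pr _ _ _ M u) => //.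
  have pow1 (x : gT) i : (x ^+ (p ^ M) = 1 -> zpowg x i ^+ (p ^ M) = 1)%g.
    by move=> x1; rewrite -zpowgMn mulrC zpowgMl x1 zpowg1n.
  by rewrite expgMn // !pow1 // mulg1.
rewrite zpowgMg // -!zpowgM -E1 -zpowgD inE.
by rewrite [X in zpowg C X](_ : _ = 0) //; ring.
Qed.

End Half.

(** * Combining both halves *)

Section Full.
Variables (gT : finGroupType) (A B C : gT) (p n a b M : nat) (u v k : int).
Hypotheses (p_pr : prime p) (p_gt2 : (2 < p)%N) (n_gt0 : (0 < n)%N).
Let P : int := (p ^ n)%N%:Z.
Hypotheses (rels : mrels a b A B C).
Hypotheses (aE : a%:Z = 1 + P ^+ 2 * u) (bE : b%:Z = 1 + P ^+ 2 * v).
Hypotheses (abE : a%:Z - b%:Z = P ^+ 3 * k).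
Hypotheses (pu : ~~ (p%:Z %| u)%Z) (pv : ~~ (p%:Z %| v)%Z) (pk : ~~ (p%:Z %| k)%Z).
Hypotheses (leM : (6 * n <= M)%N).
Hypotheses (AM : (A ^+ (p ^ M) = 1)%g) (BM : (B ^+ (p ^ M) = 1)%g)
  (CM : (C ^+ (p ^ M) = 1)%g).

Let relsV := mrels_sym rels.
Let CVM : (C^-1 ^+ (p ^ M) = 1)%g. Proof. by rewrite expgVn CM invg1. Qed.
Let baE : b%:Z - a%:Z = P ^+ 3 * (- k).
Proof. by rewrite mulrN -abE opprB. Qed.

Lemma cycA : (A ^+ (p ^ (6 * n)))%g \in <[B]>%g.
Proof. exact: (half_cycle p_pr p_gt2 n_gt0 rels aE pu AM). Qed.

Lemma cycB : (B ^+ (p ^ (6 * n)))%g \in <[A]>%g.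
Proof. exact: (half_cycle p_pr p_gt2 n_gt0 relsV bE pv BM). Qed.

Lemma expA6 : (A ^+ (p ^ (6 * n)) = 1)%g.
Proof. exact: (half_expA p_pr p_gt2 n_gt0 rels aE bE pu pv leM AM BM CM cycB). Qed.

Lemma expB6 : (B ^+ (p ^ (6 * n)) = 1)%g.
Proof. exact: (half_expA p_pr p_gt2 n_gt0 relsV bE aE pv pu leM BM AM CVM cycA). Qed.

Lemma powC_A : (C ^+ (p ^ (4 * n)))%g \in <[A]>%g.
Proof. exact: (half_cycleC p_pr p_gt2 n_gt0 rels bE pv leM BM CM cycB). Qed.

Lemma powC_B : (C ^+ (p ^ (4 * n)))%g \in <[B]>%g.
Proof.
have := half_cycleC p_pr p_gt2 n_gt0 relsV aE pu leM AM CVM cycA.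
by rewrite expgVn groupV.
Qed.

Lemma expC5 : (C ^+ (p ^ (5 * n)) = 1)%g.
Proof.
by have [] := half_powC p_pr p_gt2 n_gt0 rels aE bE abE pu pv leM AM BM CM cycB expB6.
Qed.

Lemma powC_eqA : zpowg C (P ^+ 4 * u) = zpowg A (2 * (P ^+ 5 * k)).
Proof.
by have [] := half_powC p_pr p_gt2 n_gt0 rels aE bE abE pu pv leM AM BM CM cycB expB6.
Qed.

Lemma vE : v = u - P * k.
Proof.
apply: (mulfI (expf_neq0 2 (P_neq0 n p_pr))); rewrite -/P.
have -> : P ^+ 2 * (u - P * k) = P ^+ 2 * u - P ^+ 3 * k by ring.
by rewrite -abE aE bE; ring.
Qed.

(** Mirroring changes the sign of k, inverts C and puts v in place of u; as v = u - P k, the last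
    change is invisible once C^(P^5) = 1. *)
Lemma powC_eqB : zpowg C (P ^+ 4 * u) = zpowg B (2 * (P ^+ 5 * k)).
Proof.
have [_] := half_powC p_pr p_gt2 n_gt0 relsV bE aE baE pv pu leM BM AM CVM cycA expA6.
rewrite -/P => E.
have {}E : zpowg C (P ^+ 4 * v) = zpowg B (2 * (P ^+ 5 * k)).
  have -> : 2 * (P ^+ 5 * k) = - (2 * (P ^+ 5 * - k)) by ring.
  rewrite zpowgN -E -zpowgN -[C in LHS]invgK -[(C^-1)^-1%g]/(zpowg C^-1 (- 1)).
  by rewrite -zpowgM; congr zpowg; ring.
rewrite -E; apply: (zpowg_eqmod expC5).
by rewrite mulnC P_exp -/P vE; apply/dvdzP; exists k; ring.
Qed.

Lemma pX_pow (x : gT) i : (x ^+ (p ^ M) = 1 -> (x ^+ i) ^+ (p ^ M) = 1)%g.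
Proof. by move=> x1; rewrite -expgM mulnC expgM x1 expg1n. Qed.

Let p2k : ~~ (p%:Z %| 2 * k)%Z.
Proof. exact: p_ndvdM p_pr _ _ (p_ndvd2 p_gt2) pk. Qed.

Lemma powA_C : (A ^+ (p ^ (5 * n)))%g \in <[(C ^+ (p ^ (4 * n)))%g]>%g.
Proof.
apply: (@pelt_root _ p_pr _ _ _ M (2 * k)) => //; first exact: pX_pow.
have -> : zpowg (A ^+ (p ^ (5 * n)))%g (2 * k) = zpowg (C ^+ (p ^ (4 * n)))%g u.
  rewrite -!(zpowg_P p n) -/P powC_eqA; congr zpowg; ring.
by rewrite mem_zpowg ?cycle_id.
Qed.

Lemma powA_cB : commute (A ^+ (p ^ (5 * n)))%g B.
Proof.
have : (A ^+ (p ^ (5 * n)))%g \in <[B]>%g.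
  by apply: subsetP powA_C; rewrite cycle_subG powC_B.
by case/cycleP => i ->; apply/commute_sym/commuteX/commute_refl.
Qed.

Lemma exp_eqAB : (A ^+ (p ^ (5 * n)) = B ^+ (p ^ (5 * n)))%g.
Proof.
have cAB : commute (A ^+ (p ^ (5 * n)))%g (B ^+ (p ^ (5 * n)))^-1%g.
  exact/commuteV/commuteX/powA_cB.
apply/eqP; rewrite eq_mulgV1 -in_set1 -[[set 1%g]]/(gval 1%G).
apply: (@pelt_root _ p_pr _ _ _ M (2 * k)) => //.
  by rewrite expgMn // expgVn !pX_pow // invg1 mulg1.
rewrite zpowgMg // zpowgV -!(zpowg_P p n) -/P inE -eq_mulgV1; apply/eqP.
have -> : P ^+ 5 * (2 * k) = 2 * (P ^+ 5 * k) by ring.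
by rewrite -powC_eqA powC_eqB.
Qed.

Lemma powB_commC : commute (B ^+ (p ^ (4 * n)))%g C.
Proof.
have [_ h2 _] := rels; have : commute (B ^+ (p ^ (4 * n)))%g C^-1%g.
  apply/commgP/conjg_fixP; rewrite conjXg h2 -expgM mulnC expgM.
  rewrite -[RHS]zpowg1 -[LHS]/(zpowg _ b%:Z) bE zpowgD zpowg1.
  rewrite -!(zpowg_P p n) -/P.
  have -> : P ^+ 4 * (P ^+ 2 * v) = P ^+ 6 * v by ring.
  by rewrite (zpowg_P p n) expB6 zpowg1n mulg1.
by move/commuteV; rewrite invgK.
Qed.

(** Compares [powC_eqA] with [half_relation] raised to the power 2P. The power can be taken factor
    by factor because P^4 divides h and B^(P^4) commutes with C. *)
Lemma exp_disc : zpowg (A ^+ (p ^ (5 * n)))%g (2 * k ^+ 2 - u ^+ 3) = 1%g.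
Proof.
have [h [h1 [z [hE h2 ph E]]]] :=
  half_relation p_pr p_gt2 n_gt0 rels bE pv leM BM.
have [w [z' [wE w2 _]]] := top_unit p_pr p_gt2 n_gt0 aE pu.
have A6 i : (P ^+ 6 %| i)%Z -> zpowg A i = 1%g.
  by move=> d; apply: (zpowg_dvd expA6); rewrite mulnC P_exp.
have cT : (C ^- b * C ^+ a)%g = zpowg C (P ^+ 3 * k).
  rewrite -abE zpowgB_nat; apply/commute_sym/commuteV/commuteX2.
  exact: commute_refl.
have E1 : zpowg A (2 * (a%:Z * (a%:Z ^+ a - (geom a a)%:Z)) * P) =
    (zpowg B (2 * h%:Z * P) * zpowg C (2 * (P ^+ 4 * k)))%g.
  have -> : 2 * (a%:Z * (a%:Z ^+ a - (geom a a)%:Z)) * P =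
      a%:Z * (a%:Z ^+ a - (geom a a)%:Z) * (2 * P) by ring.
  rewrite [LHS]zpowgM E cT zpowgMg.
    rewrite -[(B ^+ h)%g]/(zpowg B h%:Z) -!zpowgM.
    by congr (zpowg _ _ * zpowg _ _)%g; ring.
  rewrite -[(B ^+ h)%g]/(zpowg B h%:Z) hE zpowg_P -/P.
  have /cycleP[i ->] : zpowg (B ^+ (p ^ (4 * n)))%g h1 \in <[B ^+ (p ^ (4 * n))]>%g.
    by rewrite mem_zpowg ?cycle_id.
  have /cycleP[j ->] : zpowg C (P ^+ 3 * k) \in <[C]>%g.
    by rewrite mem_zpowg ?cycle_id.
  exact/commuteX2/powB_commC.
have EA : zpowg A (2 * (a%:Z * (a%:Z ^+ a - (geom a a)%:Z)) * P) =
    zpowg A (P ^+ 5 * u ^+ 2).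
  apply: (zpowg_eqmod expA6); rewrite mulnC P_exp wE -/P.
  have -> : 2 * (a%:Z * (P ^+ 4 * w)) * P = a%:Z * P ^+ 5 * (2 * w) by ring.
  rewrite w2 aE -/P; apply/dvdzP.
  exists (z' + P * u * (u ^+ 2 + P * z')); ring.
have EB : zpowg B (2 * h%:Z * P) = zpowg A (- (P ^+ 5 * u ^+ 2)).
  have -> : - (P ^+ 5 * u ^+ 2) = P ^+ 5 * (- u ^+ 2) by ring.
  rewrite [RHS](zpowg_P p n) exp_eqAB -(zpowg_P p n) -/P.
  apply: (zpowg_eqmod expB6); rewrite mulnC P_exp hE -/P.
  have -> : 2 * (P ^+ 4 * h1) * P - P ^+ 5 * (- u ^+ 2) =
     P ^+ 5 * (2 * h1) + P ^+ 5 * u ^+ 2 by ring.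
  rewrite h2 vE -/P; apply/dvdzP; exists (2 * u * k - P * k ^+ 2 + z); ring.
have E2 : zpowg C (2 * (P ^+ 4 * k)) = zpowg A (2 * (P ^+ 5 * u ^+ 2)).
  apply: (mulgI (zpowg A (- (P ^+ 5 * u ^+ 2)))); rewrite -{1}EB -E1 EA -zpowgD.
  by congr zpowg; ring.
apply/set1gP; apply: (@pelt_root _ p_pr _ 1%G _ M 2) => //.
- rewrite -zpowgMn mulrC zpowgMl pX_pow ?zpowg1n //.
- exact: p_ndvd2.
rewrite -zpowgM -(zpowg_P p n) -/P inE.
have -> : P ^+ 5 * ((2 * k ^+ 2 - u ^+ 3) * 2) =
   2 * (P ^+ 5 * k) * (2 * k) - 2 * (P ^+ 5 * u ^+ 2) * u by ring.
rewrite zpowgD zpowgN [X in (_ * X^-1)%g]zpowgM -E2 zpowgM -powC_eqA -!zpowgM.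
by rewrite -zpowgN -zpowgD [X in zpowg C X](_ : _ = 0) //; ring.
Qed.

Lemma powB_AC : (B ^+ (p ^ (4 * n)))%g \in <[A]>%g <*> <[C]>%g.
Proof.
have [h [h1 [z [hE h2 ph E]]]] :=
  half_relation p_pr p_gt2 n_gt0 rels bE pv leM BM.
apply: (@pelt_root _ p_pr _ _ _ M h1) => //; first exact: pX_pow.
rewrite -(zpowg_P p n) -/P -hE /=.
have -> : (B ^+ h = zpowg A (a%:Z * (a%:Z ^+ a - (geom a a)%:Z)) * (C ^- b * C ^+ a)^-1)%g.
  by rewrite E mulgK.
have AA : A \in <[A]>%g <*> <[C]>%g by rewrite mem_gen // inE cycle_id.
have CC : C \in <[A]>%g <*> <[C]>%g by rewrite mem_gen // inE cycle_id orbT.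
by rewrite groupM ?mem_zpowg // groupV groupM ?groupV ?groupX.
Qed.

End Full.

End Powers.

(** * Orders and nilpotency class *)

Section Counting.
Local Open Scope group_scope.

(** Words are collected from left to right as q B^j with q in <A><C>: a new B raises j, and a new A
    moves past B^j by [mulXA], leaving A C^-j in q. *)
Lemma mrels_normal_form (gT : finGroupType) (A B C : gT) a b x y z g :
  mrels a b A B C -> (0 < x)%N -> (0 < y)%N -> (0 < z)%N ->
  A ^+ x = 1 -> C ^+ y \in <[A]> -> B ^+ z \in <[A]> <*> <[C]> ->
  g \in <<[set A; B]>> ->
  exists i c j, [/\ (i < x)%N, (c < y)%N, (j < z)%N & g = A ^+ i * C ^+ c * B ^+ j].
Proof.
move=> rels x0 y0 z0 Ax Cy Bz; have [h1 _ _] := rels.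
set Q := (<[A]> <*> <[C]>)%G.
have nA : <[C]> \subset 'N(<[A]>) by rewrite cycle_subG; apply: conjX_norm h1.
have AQ : A \in Q by rewrite mem_gen // inE cycle_id.
have CQ : C \in Q by rewrite mem_gen // inE cycle_id orbT.
case/gen_prodgP => n [w wAB ->].
have [q [j [qQ ->]]] : exists q j, q \in Q /\ \prod_(i < n) w i = q * B ^+ j.
  elim: n w wAB => [|n IHn] w wAB; first by exists 1, 0; rewrite group1 big_ord0 mulg1.
  have [i|q [j [qQ E]]] := IHn (fun i => w (widen_ord (leqnSn n) i)); first exact: wAB.
  rewrite big_ord_recr /= E; have := wAB ord_max; rewrite !inE => /orP[]/eqP->.
    exists (q * A * C ^- j), (b * geom b j)%N.
    by rewrite !groupM ?groupV ?groupX // -!mulgA (mulXA j rels) !mulgA.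
  by exists q, j.+1; rewrite expgSr mulgA.
have [q' q'Q E] : exists2 q', q' \in Q & q * B ^+ j = q' * B ^+ (j %% z).
  exists (q * (B ^+ z) ^+ (j %/ z)); first by rewrite groupM // groupX.
  by rewrite -mulgA -expgM -expgD mulnC -divn_eq.
rewrite E; move: q'Q; rewrite /Q /= norm_joinEr //.
case/mulsgP => _ _ /cycleP[i ->] /cycleP[c ->] ->.
have /cycleP[i' Ei] : (C ^+ y) ^+ (c %/ y) \in <[A]> by rewrite groupX.
exists ((i + i') %% x)%N, (c %% y)%N, (j %% z)%N; rewrite !ltn_mod; split=> //.
rewrite (expg_mod _ Ax) expgD -Ei -expgM mulnC {1}(divn_eq c y) expgD.
by rewrite [(c %/ y * y)%N]mulnC !mulgA.
Qed.

Lemma mrels_card_le (gT : finGroupType) (A B C : gT) a b x y z :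
  mrels a b A B C -> (0 < x)%N -> (0 < y)%N -> (0 < z)%N ->
  A ^+ x = 1 -> C ^+ y \in <[A]> -> B ^+ z \in <[A]> <*> <[C]> ->
  (#|<<[set A; B]>>| <= x * y * z)%N.
Proof.
move=> rels x0 y0 z0 Ax Cy Bz.
pose F (t : 'I_x * 'I_y * 'I_z) : gT := A ^+ t.1.1 * C ^+ t.1.2 * B ^+ t.2.
have -> : (x * y * z = #|[set: 'I_x * 'I_y * 'I_z]|)%N.
  by rewrite cardsT !card_prod !card_ord.
apply: leq_trans (leq_imset_card F _); apply/subset_leq_card/subsetP => g gG.
have [i [c [j [li lc lj ->]]]] := mrels_normal_form rels x0 y0 z0 Ax Cy Bz gG.
by apply/imsetP; exists (Ordinal li, Ordinal lc, Ordinal lj); rewrite ?inE.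
Qed.

Lemma ucn_gen2 (gT : finGroupType) (G : {group gT}) (A B x : gT) i :
  G :=: <<[set A; B]>> -> x \in G ->
  commute (coset 'Z_i(G) x) (coset 'Z_i(G) A) ->
  commute (coset 'Z_i(G) x) (coset 'Z_i(G) B) -> x \in 'Z_i.+1(G).
Proof.
move=> defG xG cA cB; have nZ : G \subset 'N('Z_i(G)) := gFnorm _ _.
have [AG BG] : A \in G /\ B \in G by rewrite defG; split; [apply: relA_in | apply: relB_in].
rewrite ucnSn mem_morphpre ?(subsetP nZ) //= inE mem_quotient //=.
have -> : G / 'Z_i(G) = <<[set coset 'Z_i(G) A; coset 'Z_i(G) B]>>.
  have -> : G / 'Z_i(G) = coset 'Z_i(G) @* <<[set A; B]>> by rewrite -defG.
  rewrite morphim_gen; last by rewrite subUset !sub1set !(subsetP nZ).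
  by rewrite morphimU !morphim_set1 // (subsetP nZ).
exact/gen2_centP.
Qed.

Lemma commute_coset (gT : finGroupType) (H : {group gT}) (x y z : gT) :
  x \in 'N(H) -> y \in 'N(H) -> z \in H -> x ^ y = x * z ->
  commute (coset H y) (coset H x).
Proof.
move=> nx ny zH E; apply/commute_sym/commgP/conjg_fixP.
have nz : z \in 'N(H) := subsetP (normG H) z zH.
by rewrite -morphJ // E morphM //= (coset_id zH) mulg1.
Qed.

End Counting.

Section OrdersAndClass.
Local Open Scope group_scope.
Local Open Scope ring_scope.

(** * Moving along the upper and lower central series *)

Section CentralSteps.
Variables (gT : finGroupType) (G : {group gT}) (A B C : gT) (p n a b : nat) (u v : int).
Hypotheses (p_pr : prime p) (p_gt2 : (2 < p)%N) (n_gt0 : (0 < n)%N).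
Hypotheses (rels : mrels a b A B C) (defG : G :=: <<[set A; B]>>%g).
Hypotheses (aE : a%:Z = 1 + (p ^ n)%N%:Z ^+ 2 * u).
Hypotheses (pu : ~~ (p%:Z %| u)%Z).

Let AG : A \in G. Proof. by rewrite defG; apply: relA_in. Qed.
Let BG : B \in G. Proof. by rewrite defG; apply: relB_in. Qed.
Let CG : C \in G. Proof. by rewrite (mrels_comm rels) groupR. Qed.

Lemma conjB_powA t :
  (B ^ (A ^+ t) = B * (zpowg A (t%:Z * a%:Z ^+ t - a%:Z * (geom a t)%:Z) * C ^- t))%g.
Proof.
rewrite (conj_powA t rels) -!mulgA; congr (_ * _)%g; rewrite !mulgA.
by congr (_ * _)%g; rewrite addrC -PoszX_exp -!PoszM zpowgD zpowgN.
Qed.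

Lemma zpowg_defect j : (0 < j <= 4)%N -> exists e,
  zpowg A ((p ^ (j * n))%N%:Z * a%:Z ^+ (p ^ (j * n)) -
    a%:Z * (geom a (p ^ (j * n)))%:Z) = zpowg (A ^+ (p ^ (j.+2 * n)))%g e.
Proof.
move=> j4; have dt : ((p ^ n)%N%:Z ^+ j %| (p ^ (j * n))%N%:Z)%Z.
  by rewrite -P_exp mulnC dvdzz.
have /dvdzP[e ->] := geom_defect_dvd p_pr p_gt2 n_gt0 aE j4 dt.
by exists e; rewrite mulrC zpowg_P.
Qed.

Lemma commA_powC j : exists2 w, ~~ (p%:Z %| w)%Z &
  (A ^ (C ^+ (p ^ j)) = A * zpowg (A ^+ (p ^ (2 * n + j))) w)%g.
Proof.
have [w [pw wE]] := pow_pexp p_pr p_gt2 n_gt0 aE j pu; exists w => //.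
have [h1 _ _] := rels; rewrite (conjX_rel _ h1) -zpowgMl -{2}[A]zpowg1 -zpowgD -wE.
by rewrite -PoszX_exp.
Qed.

Lemma ucn_powA i j : (0 < j <= 4)%N ->
  (C ^+ (p ^ (j * n)))%g \in 'Z_i(G)%g -> (A ^+ (p ^ (j.+2 * n)))%g \in 'Z_i(G)%g ->
  (A ^+ (p ^ (j * n)))%g \in 'Z_i.+1(G)%g.
Proof.
move=> j4 Cz Az; have nZ : G \subset 'N('Z_i(G))%g := gFnorm _ _.
apply: (ucn_gen2 defG); rewrite ?groupX //.
  by rewrite morphX ?(subsetP nZ) //; apply/commute_sym/commuteX.
have [e eE] := zpowg_defect j4.
apply: (commute_coset _ _ _ (conjB_powA _)); rewrite ?groupX ?(subsetP nZ) //.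
by rewrite eE groupM ?groupV // mem_zpowg.
Qed.

Lemma ucn_genA i : C \in 'Z_i(G)%g -> A \in 'Z_i.+1(G)%g.
Proof.
move=> Cz; have nZ : G \subset 'N('Z_i(G))%g := gFnorm _ _.
apply: (ucn_gen2 defG) => //; have := conjB_powA 1; rewrite !expg1 => E.
apply: (commute_coset _ _ _ E); rewrite ?(subsetP nZ) //.
by rewrite /geom big_ord1 expn0 mulr1 mul1r expr1 subrr mul1g groupV.
Qed.

Variable M : nat.
Hypothesis AM : (A ^+ (p ^ M) = 1)%g.

Lemma lcn_powC_A i j : (C ^+ (p ^ j))%g \in 'L_i.+1(G)%g ->
  (A ^+ (p ^ (2 * n + j)))%g \in 'L_i.+2(G)%g.
Proof.
move=> Cl; have [w pw E] := commA_powC j.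
apply: (pelt_root p_pr (pX_pow _ AM) pw).
have -> : zpowg (A ^+ (p ^ (2 * n + j)))%g w = [~ A, C ^+ (p ^ j)]%g.
  by rewrite commgEl E mulKg.
by rewrite /= lcnSn -groupV invg_comm mem_commg.
Qed.

Lemma lcn_powA i t : (A ^+ (p ^ t))%g \in 'L_i.+1(G)%g ->
  (A ^+ (p ^ (2 * n + t)))%g \in 'L_i.+2(G)%g.
Proof.
move=> Al; have [h1 _ _] := rels; apply: (pelt_root p_pr (pX_pow _ AM) pu).
rewrite /= lcnSn; have <- : [~ A ^+ (p ^ t), C]%g = zpowg (A ^+ (p ^ (2 * n + t)))%g u.
  rewrite commgEl conjXg h1 -expgM mulnC expgM.
  apply: (mulgI (A ^+ (p ^ t))%g); rewrite mulKVg -{2}[(A ^+ (p ^ t))%g]zpowg1.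
  by rewrite expnD mulnC expgM -zpowg_P -zpowgD -aE.
exact: mem_commg.
Qed.

Lemma lcn_powA_C i j : (0 < j <= 4)%N -> (A ^+ (p ^ (j * n)))%g \in 'L_i.+1(G)%g ->
  (A ^+ (p ^ (j.+2 * n)))%g \in 'L_i.+2(G)%g ->
  (C ^+ (p ^ (j * n)))%g \in 'L_i.+2(G)%g.
Proof.
move=> j4 Al Al'; have [e eE] := zpowg_defect j4.
have := mem_commg Al BG; rewrite -lcnSn -groupV invg_comm commgEl conjB_powA mulKg.
by rewrite eE groupMl ?groupV // mem_zpowg.
Qed.

End CentralSteps.

Lemma ucn_powC (gT : finGroupType) (G : {group gT}) (A B C : gT) p n a b u v i j :
  prime p -> (2 < p)%N -> (0 < n)%N -> mrels a b A B C -> G :=: <<[set A; B]>>%g ->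
  a%:Z = 1 + (p ^ n)%N%:Z ^+ 2 * u -> b%:Z = 1 + (p ^ n)%N%:Z ^+ 2 * v ->
  ~~ (p%:Z %| u)%Z -> ~~ (p%:Z %| v)%Z ->
  (A ^+ (p ^ (2 * n + j)))%g \in 'Z_i(G)%g -> (B ^+ (p ^ (2 * n + j)))%g \in 'Z_i(G)%g ->
  (C ^+ (p ^ j))%g \in 'Z_i.+1(G)%g.
Proof.
move=> p_pr p_gt2 n_gt0 rels defG aE bE pu pv Az Bz.
have [AG BG] : A \in G /\ B \in G by rewrite defG; split; [apply: relA_in | apply: relB_in].
have CG : C \in G by rewrite (mrels_comm rels) groupR.
have nZ : G \subset 'N('Z_i(G))%g := gFnorm _ _.
apply: (ucn_gen2 defG); rewrite ?groupX //.
  have [w _ E] := commA_powC p_pr p_gt2 n_gt0 rels aE pu j.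
  by apply: (commute_coset _ _ _ E); rewrite ?mem_zpowg // (subsetP nZ) ?groupX.
have [w _ E] := commA_powC p_pr p_gt2 n_gt0 (mrels_sym rels) bE pv j.
have := commute_coset _ _ (mem_zpowg w Bz) E.
rewrite expgVn groupV ?(subsetP nZ) ?groupX // => /(_ isT isT).
rewrite morphV ?(subsetP nZ) ?groupX // => /commute_sym/commuteV/commute_sym.
by rewrite invgK.
Qed.

(** The counting bound read backwards, with [#[A]] itself as the range of the exponent of A. *)
Lemma order_ge (gT : finGroupType) (A B C : gT) a b p x y : prime p ->
  mrels a b A B C -> (C ^+ (p ^ x))%g \in <[A]>%g ->
  (B ^+ (p ^ x))%g \in <[A]>%g <*> <[C]>%g ->
  (p ^ (y + 2 * x) <= #|<<[set A; B]>>%g|)%N -> (p ^ y <= #[A]%g)%N.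
Proof.
move=> p_pr rels Cx Bx; have p0 i : (0 < p ^ i)%N by rewrite expn_gt0 prime_gt0.
move/leq_trans/(_ (mrels_card_le rels (order_gt0 A) (p0 x) (p0 x) (expg_order A) Cx Bx)).
by rewrite mul2n -addnn addnA !expnD !leq_pmul2r.
Qed.

Section Sylow.
Variables (gT : finGroupType) (G : {group gT}) (A B C : gT).
Variables (p n s a b M : nat) (u v k : int).
Hypotheses (p_pr : prime p) (p_gt2 : (2 < p)%N) (n_gt0 : (0 < n)%N).
Let P : int := (p ^ n)%N%:Z.
Hypotheses (rels : mrels a b A B C) (defG : G :=: <<[set A; B]>>%g).
Hypotheses (aE : a%:Z = 1 + P ^+ 2 * u) (bE : b%:Z = 1 + P ^+ 2 * v).
Hypotheses (abE : a%:Z - b%:Z = P ^+ 3 * k).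
Hypotheses (pu : ~~ (p%:Z %| u)%Z) (pv : ~~ (p%:Z %| v)%Z) (pk : ~~ (p%:Z %| k)%Z).
Hypotheses (leM : (6 * n <= M)%N).
Hypotheses (AM : (A ^+ (p ^ M) = 1)%g) (BM : (B ^+ (p ^ M) = 1)%g)
  (CM : (C ^+ (p ^ M) = 1)%g).
Hypotheses (le_sn : (s <= n)%N).
Hypothesis (sD : (s < n)%N -> ~~ ((p ^ s.+1)%N%:Z %| 2 * k ^+ 2 - u ^+ 3)%Z).
Hypothesis (pD : ((p ^ s)%N%:Z %| 2 * k ^+ 2 - u ^+ 3)%Z).
Hypothesis (cardG : (p ^ (13 * n + s) <= #|G|)%N).

Let relsV := mrels_sym rels.
Let CVM : (C^-1 ^+ (p ^ M) = 1)%g. Proof. by rewrite expgVn CM invg1. Qed.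
Let p2k : ~~ (p%:Z %| 2 * k)%Z.
Proof. exact: p_ndvdM p_pr _ _ (p_ndvd2 p_gt2) pk. Qed.
Let defGV : G :=: <<[set B; A]>>%g. Proof. by rewrite setUC. Qed.
Let p0 i : (0 < p ^ i)%N. Proof. by rewrite expn_gt0 prime_gt0. Qed.

Let A6 := expA6 p_pr p_gt2 n_gt0 rels aE bE pu pv leM AM BM CM.
Let C4A := powC_A p_pr p_gt2 n_gt0 rels bE pv leM BM CM.

Lemma expA5s : (A ^+ (p ^ (5 * n + s)) = 1)%g.
Proof.
have AD := exp_disc p_pr p_gt2 n_gt0 rels aE bE abE pu pv pk leM AM BM CM.
have [sn|ns] := ltnP s n; last first.
  by rewrite (_ : 5 * n + s = 6 * n)%N //; lia.
have /dvdzP[D' E] := pD.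
have pD' : ~~ (p%:Z %| D')%Z.
  apply: contra (sD sn) => /dvdzP[w wE]; apply/dvdzP; exists w.
  by rewrite E wE expnS PoszM; ring.
apply/set1gP; apply: (pelt_root p_pr (pX_pow _ AM) pD').
by rewrite inE expnD expgM -zpowgMl mulrC -E AD.
Qed.

Lemma sylow_orderA : #[A]%g = (p ^ (5 * n + s))%N.
Proof.
apply/eqP; rewrite eqn_leq dvdn_leq ?order_dvdn ?expA5s //=.
apply: (order_ge p_pr rels C4A (powB_AC p_pr p_gt2 n_gt0 rels bE pv leM BM)).
by rewrite -defG (_ : _ + _ = 13 * n + s)%N //; lia.
Qed.

Lemma sylow_orderB : #[B]%g = (p ^ (5 * n + s))%N.
Proof.
apply/eqP; rewrite eqn_leq dvdn_leq //=; last first.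
  rewrite order_dvdn expnD expgM.
  rewrite -(exp_eqAB p_pr p_gt2 n_gt0 rels aE bE abE pu pv pk leM AM BM CM).
  by rewrite -expgM -expnD expA5s.
have C4B := powC_A p_pr p_gt2 n_gt0 relsV aE pu leM AM CVM.
apply: (order_ge p_pr relsV C4B (powB_AC p_pr p_gt2 n_gt0 relsV aE pu leM AM)).
by rewrite -defGV (_ : _ + _ = 13 * n + s)%N //; lia.
Qed.

Lemma sylow_card : #|G| = (p ^ (13 * n + s))%N.
Proof.
apply/eqP; rewrite eqn_leq cardG andbT.
have B4 := powB_AC p_pr p_gt2 n_gt0 rels bE pv leM BM.
rewrite defG; apply: leq_trans (mrels_card_le rels (p0 _) (p0 _) (p0 _) expA5s C4A B4) _.
by rewrite -!expnD leq_pexp2l ?prime_gt0 //; lia.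
Qed.

Let powC_powA i : (zpowg (C ^+ (p ^ (4 * n + i))) u =
  zpowg (A ^+ (p ^ (5 * n + i))) (2 * k))%g.
Proof.
have E := powC_eqA p_pr p_gt2 n_gt0 rels aE bE abE pu pv leM AM BM CM.
have {}E : zpowg (zpowg C (P ^+ 4 * u)) (p ^ i)%N%:Z =
    zpowg (zpowg A (2 * (P ^+ 5 * k))) (p ^ i)%N%:Z by rewrite E.
have e4 (q : int) : P ^+ 4 * u * q = P ^+ 4 * (q * u) by ring.
have e5 (q : int) : 2 * (P ^+ 5 * k) * q = P ^+ 5 * (q * (2 * k)) by ring.
move: E; rewrite -!zpowgM e4 e5 !zpowg_P.
set q := (p ^ i)%N; rewrite (zpowgMl _ q u) (zpowgMl _ q (2 * k)).
rewrite /q -!expgM -!expnD; exact (fun h => h).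
Qed.

Lemma sylow_orderC : #[C]%g = (p ^ (4 * n + s))%N.
Proof.
have CE : (C ^+ (p ^ (4 * n + s)) = 1)%g.
  apply/set1gP; apply: (pelt_root p_pr (pX_pow _ CM) pu).
  by rewrite powC_powA expA5s zpowg1n group1.
have /(dvdn_pfactor _ _ p_pr)[j le_j Ej] : (#[C]%g %| p ^ (4 * n + s))%N.
  by rewrite order_dvdn CE.
rewrite Ej; congr (p ^ _)%N; apply/eqP; rewrite eqn_leq le_j /= leqNgt.
apply/negP => lt_j; have Cj : (C ^+ (p ^ j) = 1)%g by rewrite -Ej expg_order.
(* If j < 4n, the counting bound with p^j for p^(4n) contradicts the order of G. If j >= 4n,
   [powC_powA] would lower the order of A. *)
have [lt4|le4] := ltnP j (4 * n)%N.
  have CjA : (C ^+ (p ^ j))%g \in <[A]>%g by rewrite Cj group1.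
  have B4 := powB_AC p_pr p_gt2 n_gt0 rels bE pv leM BM.
  have := mrels_card_le rels (p0 _) (p0 _) (p0 _) expA5s CjA B4.
  rewrite -defG sylow_card -!expnD leq_exp2l ?prime_gt1 // => le.
  by move: le lt4; clear; lia.
have A1 : (A ^+ (p ^ (5 * n + (j - 4 * n))) = 1)%g.
  apply/set1gP; apply: (pelt_root p_pr (pX_pow _ AM) p2k).
  by rewrite -powC_powA subnKC // Cj zpowg1n group1.
have := order_dvdn A (p ^ (5 * n + (j - 4 * n))); rewrite A1 eqxx sylow_orderA.
rewrite dvdn_Pexp2l ?prime_gt1 // => le.
by move: le le4 lt_j; clear; lia.
Qed.

Lemma sylow_class_le : (nil_class G <= (s > 0) + 5)%N.
Proof.
(* [c0] records whether the central element A^(e^5) is nontrivial, which shifts the whole series by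
   one. *)
pose c0 : nat := (0 < s)%N; pose Z i := ('Z_i(G))%G.
have nilG : nilpotent G by rewrite defG; apply: mrels_nilpotent rels.
have AG : A \in G by rewrite defG; apply: relA_in.
have sZ i x : x \in Z i -> x \in Z i.+1 by apply/subsetP/ucn_subS.
have CVz t i : (C ^+ t)%g \in Z i -> (C^-1 ^+ t)%g \in Z i by rewrite expgVn groupV.
have B6 := expB6 p_pr p_gt2 n_gt0 rels aE bE pu pv leM AM BM CM.
have A5 : (A ^+ (p ^ (5 * n)))%g \in Z c0.
  rewrite /Z /c0; case: posnP => [s0|_].
    by have := expA5s; rewrite s0 addn0 /= ucn0 inE => ->.
  rewrite /= ucn1 inE groupX //= defG; apply/gen2_centP; split.
    exact/commute_sym/commuteX/commute_refl.
  exact: (powA_cB p_pr p_gt2 n_gt0 rels aE bE abE pu pv pk leM AM BM CM).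
have C4 : (C ^+ (p ^ (4 * n)))%g \in Z c0.
  apply: (pelt_root p_pr (pX_pow _ CM) pu).
  by rewrite -[(4 * n)%N]addn0 powC_powA addn0 mem_zpowg.
have A4 : (A ^+ (p ^ (4 * n)))%g \in Z c0.+1.
  by apply: (ucn_powA p_pr p_gt2 n_gt0 rels defG aE (j := 4)); rewrite ?A6.
have B4 : (B ^+ (p ^ (4 * n)))%g \in Z c0.+1.
  by apply: (ucn_powA p_pr p_gt2 n_gt0 relsV defGV bE (j := 4)); rewrite ?B6 ?CVz.
have C2 : (C ^+ (p ^ (2 * n)))%g \in Z c0.+2.
  apply: (ucn_powC p_pr p_gt2 n_gt0 rels defG aE bE pu pv);
  by rewrite -mulnDl.
have A2 : (A ^+ (p ^ (2 * n)))%g \in Z c0.+3.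
  by apply: (ucn_powA p_pr p_gt2 n_gt0 rels defG aE (j := 2)) => //; apply: sZ.
have B2 : (B ^+ (p ^ (2 * n)))%g \in Z c0.+3.
  by apply: (ucn_powA p_pr p_gt2 n_gt0 relsV defGV bE (j := 2)) => //; [apply: CVz | apply: sZ].
have C0 : C \in Z c0.+4.
  rewrite -[C]expg1 -(expn0 p).
  by apply: (ucn_powC p_pr p_gt2 n_gt0 rels defG aE bE pu pv); rewrite addn0.
have A0 : A \in Z c0.+4.+1 by apply: (ucn_genA rels defG).
have CV0 : (C^-1)%g \in Z c0.+4 by rewrite groupV.
have B0 : B \in Z c0.+4.+1 := ucn_genA relsV defGV CV0.
have sub : G \subset Z c0.+4.+1.
  by rewrite {1}defG gen_subG subUset !sub1set A0 B0.
rewrite addnC; apply/(ucn_nil_classP c0.+4.+1 nilG)/eqP; rewrite eqEsubset.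
by apply/andP; split; [apply: ucn_sub | apply: sub].
Qed.

Lemma sylow_class_ge : ((s > 0) + 5 <= nil_class G)%N.
Proof.
have [AG BG] : A \in G /\ B \in G by rewrite defG; split; [apply: relA_in | apply: relB_in].
have nilG : nilpotent G by rewrite defG; apply: mrels_nilpotent rels.
have LC := lcn_powC_A p_pr p_gt2 n_gt0 rels defG aE pu AM.
have LA := lcn_powA p_pr rels defG aE pu AM.
have LAC := lcn_powA_C p_pr p_gt2 n_gt0 rels defG aE.
have C0 : (C ^+ (p ^ 0))%g \in 'L_2(G)%g.
  by rewrite expg1 (mrels_comm rels) mem_commg.
have A2 := LC 1 0%N C0; rewrite addn0 in A2.
have A4 : (A ^+ (p ^ (4 * n)))%g \in 'L_4(G)%g.
  by have := LA _ _ A2; rewrite -mulnDl.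
have C2 := LAC _ 2 isT A2 A4.
(* The detour through C^(e^2) places A^(e^4) one term deeper than the direct step from A^(e^2). *)
have {A4}A4 : (A ^+ (p ^ (4 * n)))%g \in 'L_5(G)%g.
  by have := LC _ _ C2; rewrite -mulnDl.
have C4 : (C ^+ (p ^ (4 * n)))%g \in 'L_6(G)%g.
  by apply: (LAC 4 4); rewrite ?A6.
rewrite leqNgt; apply/negP => lt; have le5 : (nil_class G <= 5)%N.
  by rewrite -ltnS (leq_trans lt) //; case: (0 < s)%N.
have [s0|s_gt0] := posnP s.
  have /(lcn_nil_classP _ nilG)L5 : (nil_class G <= 4)%N by move: lt; rewrite s0.
  have := order_dvdn A (p ^ (4 * n)); move: A4; rewrite L5 => /set1gP ->.
  rewrite eqxx sylow_orderA dvdn_Pexp2l ?prime_gt1 // => le.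
  by move: le n_gt0; clear; lia.
have /(lcn_nil_classP _ nilG)L6 := le5.
have := order_dvdn C (p ^ (4 * n)); move: C4; rewrite L6 => /set1gP ->.
rewrite eqxx sylow_orderC dvdn_Pexp2l ?prime_gt1 // => le.
by move: le s_gt0; clear; lia.
Qed.

Lemma sylow_class : nil_class G = if (0 < s)%N then 6 else 5.
Proof.
by apply/eqP; rewrite eqn_leq; have := sylow_class_le; have := sylow_class_ge;
  case: (0 < s)%N => /= -> ->.
Qed.

End Sylow.

End OrdersAndClass.

(** * The Sylow subgroup of the presented group *)

Section NilpotentProjection.
Local Open Scope group_scope.

Section SylowProjection.
Variables (gT : finGroupType) (G : {group gT}) (p : nat).
Hypothesis nilG : nilpotent G.

Lemma constt_nilpotentM : {in G &, {morph (fun x => x.`_p) : x y / x * y}}.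
Proof.
move=> x y xG yG /=.
have in_pcore (pi : nat_pred) z : z \in G -> z.`_pi \in 'O_pi(G).
  move=> zG; rewrite (mem_normal_Hall (nilpotent_pcore_Hall _ nilG) (pcore_normal _ _)).
    exact: p_elt_constt.
  by rewrite groupX.
have cpp u v : u \in 'O_p(G) -> v \in 'O_p^'(G) -> commute u v.
  have /dprodP[_ _ cent _] := nilpotent_pcoreC p nilG.
  by move=> uO vO; apply/commute_sym; apply: (centsP cent).
have px : x = x.`_p * x.`_p^' by rewrite consttC.
have py : y = y.`_p * y.`_p^' by rewrite consttC.
have -> : x * y = (x.`_p * y.`_p) * (x.`_p^' * y.`_p^').
  rewrite {1}px {1}py -!mulgA; congr (_ * _); rewrite !mulgA; congr (_ * _).
  by apply/commute_sym/cpp; apply: in_pcore.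
rewrite consttM; last by apply: cpp; rewrite groupM ?in_pcore.
rewrite (constt_p_elt (mem_p_elt (pcore_pgroup p G) _)) ?groupM ?in_pcore //.
have qE : p^'.-elt (x.`_p^' * y.`_p^').
  by apply: mem_p_elt (pcore_pgroup _ G) _; rewrite groupM ?in_pcore.
by rewrite (constt1P qE) mulg1.
Qed.

Canonical constt_morphism := Morphism constt_nilpotentM.

Lemma constt_mrels a b A B C : A \in G -> B \in G -> C \in G ->
  mrels a b A B C -> mrels a b A.`_p B.`_p C.`_p.
Proof.
move=> AG BG CG [h1 h2 h3]; pose f := constt_morphism.
rewrite /mrels -[A.`_p]/(f A) -[B.`_p]/(f B) -[C.`_p]/(f C).
by split; rewrite -?morphV -?morphJ ?groupV // ?h1 ?h2 ?h3 ?morphX ?morphM.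
Qed.

Lemma constt_gen2 A B (P : {group gT}) : G :=: <<[set A; B]>> -> P \in 'Syl_p(G) ->
  P :=: <<[set A.`_p; B.`_p]>>.
Proof.
move=> defG; rewrite inE => sylP; pose f := constt_morphism.
have AG : A \in G by rewrite defG; apply: relA_in.
have BG : B \in G by rewrite defG; apply: relB_in.
have -> : <<[set A.`_p; B.`_p]>> = f @* G.
  have -> : f @* G = f @* <<[set A; B]>> by rewrite -defG.
  rewrite morphim_gen ?subUset ?sub1set ?AG ?BG //.
  by rewrite morphimU !morphim_set1.
have PE := nilpotent_Hall_pcore nilG sylP.
apply/eqP; rewrite eqEsubset; apply/andP; split; apply/subsetP => x.
  move=> xP; have xG := subsetP (pHall_sub sylP) x xP.
  apply/morphimP; exists x => //=.
  by rewrite constt_p_elt // (mem_p_elt (pHall_pgroup sylP)).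
case/morphimP => y yG _ -> /=; rewrite PE.
rewrite (mem_normal_Hall (nilpotent_pcore_Hall _ nilG) (pcore_normal _ _)) ?groupX //.
exact: p_elt_constt.
Qed.

End SylowProjection.

Lemma Grels_mrels (gT : finGroupType) (alpha beta : int) a b (A B : gT) :
  zpowg A alpha = A ^+ a -> zpowg B beta = B ^+ b ->
  Grels alpha beta A B <-> mrels a b A B [~ A, B].
Proof.
move=> Aa Bb; rewrite /Grels /mrels Aa Bb invg_comm commgEl mulKVg.
by split => [[]|[]].
Qed.

Lemma constt_morph_id (gT hT : finGroupType) (G : {group gT})
    (f : {morphism G >-> hT}) p M (x : gT) (y : hT) :
  prime p -> x \in G -> f x = y -> y ^+ (p ^ M) = 1 -> f x.`_p = y.
Proof.
move=> p_pr xG fx y1; rewrite morph_constt // fx constt_p_elt //.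
rewrite /p_elt; apply: pnat_dvd (_ : p.-nat (p ^ M)%N); last by rewrite pnatX pnat_id.
by rewrite order_dvdn y1.
Qed.

Lemma card_ge_model (gT hT : finGroupType) (G P : {group gT})
    (f : {morphism G >-> hT}) (a b c : gT) x y z :
  P \subset G -> a \in P -> b \in P -> c \in P ->
  (forall i j l i' j' l', (i < x)%N -> (i' < x)%N -> (l < y)%N -> (l' < y)%N ->
     (j < z)%N -> (j' < z)%N ->
     f a ^+ i * f c ^+ l * f b ^+ j = f a ^+ i' * f c ^+ l' * f b ^+ j' ->
     [/\ i = i', l = l' & j = j']) ->
  (x * y * z <= #|P|)%N.
Proof.
move=> sPG aP bP cP inj.
have [aG bG cG] : [/\ a \in G, b \in G & c \in G] by split; apply: (subsetP sPG).
pose F (t : 'I_x * 'I_y * 'I_z) : gT := a ^+ t.1.1 * c ^+ t.1.2 * b ^+ t.2.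
have injF : injective F.
  move=> [[i l] j] [[i' l'] j'] /(congr1 f).
  rewrite /F !morphM ?morphX ?groupM ?groupX //= => /inj[] // Ei El Ej.
  by congr (_, _, _); apply: val_inj.
have -> : (x * y * z = #|F @: [set: 'I_x * 'I_y * 'I_z]|)%N.
  by rewrite card_imset // cardsT !card_prod !card_ord.
apply/subset_leq_card/subsetP => _ /imsetP[t _ ->].
by rewrite /F !groupM ?groupX.
Qed.

End NilpotentProjection.

Section PresentedSylow.
Local Open Scope group_scope.
Local Open Scope ring_scope.

Lemma presents_sylow (p n s : nat) (alpha beta : int) (gT : finGroupType)
    (G P : {group gT}) (A B : gT) (u k : int) :
  prime p -> (2 < p)%N -> (0 < n)%N -> (s <= n)%N -> presents alpha beta G A B ->
  alpha = 1 + (p ^ (2 * n))%N%:Z * u -> alpha - beta = (p ^ (3 * n))%N%:Z * k ->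
  ~~ (p%:Z %| u)%Z -> ~~ (p%:Z %| k)%Z ->
  ((s < n)%N -> ~~ ((p ^ s.+1)%N%:Z %| 2 * k ^+ 2 - u ^+ 3)%Z) ->
  ((p ^ s)%N%:Z %| 2 * k ^+ 2 - u ^+ 3)%Z -> P \in 'Syl_p(G)%g ->
  [/\ nil_class P = (if (0 < s)%N then 6 else 5), #|P| = (p ^ (13 * n + s))%N,
      #[A.`_p]%g = (p ^ (5 * n + s))%N, #[B.`_p]%g = (p ^ (5 * n + s))%N &
      #[[~ A, B].`_p]%g = (p ^ (4 * n + s))%N].
Proof.
move=> p_pr p_gt2 n_gt0 le_sn [defG relG univ] alE abE pu pk sD pD sylP.
have [AG BG] : A \in G /\ B \in G by rewrite defG; split; [apply: relA_in | apply: relB_in].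
(* Adding T makes the exponents natural numbers. It changes nothing on G, being a multiple of #|G|,
   nor on the model, being a multiple of p^(7n) with 7n >= 6n + 1. *)
have [T [pT GT T_ge]] : exists T, [/\ forall i, (i <= 7 * n)%N -> (p ^ i %| T)%N,
    forall x, x \in G -> (x ^+ T = 1)%g & (`|alpha| + `|beta| < T)%N].
  exists (#|G| * (`|alpha| + `|beta|).+1 * p ^ (7 * n))%N; split=> [i le_i|x xG|].
  - by rewrite dvdn_mull // dvdn_exp2l.
  - by rewrite -mulnA expgM expg_cardG // expg1n.
  - by rewrite mulnAC leq_pmull // muln_gt0 cardG_gt0 expn_gt0 prime_gt0.
pose a := `|(alpha + T%:Z)%R|%N; pose b := `|(beta + T%:Z)%R|%N.
have aT : a%:Z = alpha + T%:Z by rewrite gez0_abs //; move: T_ge; clear; lia.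
have bT : b%:Z = beta + T%:Z by rewrite gez0_abs //; move: T_ge; clear; lia.
have zT (hT : finGroupType) (x : hT) : (x ^+ T = 1)%g ->
  zpowg x alpha = (x ^+ a)%g /\ zpowg x beta = (x ^+ b)%g.
  move=> x1; rewrite -[(x ^+ a)%g]/(zpowg x a%:Z) -[(x ^+ b)%g]/(zpowg x b%:Z) aT bT.
  by rewrite !zpowgD -[zpowg x T%:Z]/(x ^+ T)%g x1 !mulg1.
have rels : mrels a b A B [~ A, B]%g.
  by apply/(Grels_mrels (zT _ _ (GT _ AG)).1 (zT _ _ (GT _ BG)).2).
have nilG : nilpotent G by rewrite defG; apply: mrels_nilpotent rels.
have le3 : (2 * n + n <= 7 * n)%N by rewrite -mulSnr leq_mul2r orbT.
have /dvdnP[w wE] := pT _ le3.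
(* As p^(3n) divides T, u moves by a multiple of p^n and k not at all. So D is unchanged modulo p^n,
   which is all that s records. *)
pose u0 := u + (p ^ n)%N%:Z * w%:Z; pose v0 := u0 - (p ^ n)%N%:Z * k.
have aE0 : a%:Z = 1 + (p ^ (2 * n))%N%:Z * u0.
  by rewrite aT alE wE /u0 expnD !PoszM; set x := (p ^ (2 * n))%N; set y := (p ^ n)%N; ring.
have bE0 : b%:Z = 1 + (p ^ (2 * n))%N%:Z * v0.
  have -> : b%:Z = a%:Z - (alpha - beta) by rewrite aT bT; ring.
  rewrite aE0 abE /v0 (_ : 3 * n = 2 * n + n)%N; last by rewrite -mulSnr.
  by rewrite expnD PoszM; set x := (p ^ (2 * n))%N; set y := (p ^ n)%N; ring.
have P2 : (p ^ (2 * n))%N%:Z = (p ^ n)%N%:Z ^+ 2 by rewrite mulnC P_exp.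
have P3 : (p ^ (3 * n))%N%:Z = (p ^ n)%N%:Z ^+ 3 by rewrite mulnC P_exp.
have abE0 : a%:Z - b%:Z = (p ^ n)%N%:Z ^+ 3 * k.
  by rewrite -P3 -abE aT bT; ring.
have pu0 : ~~ (p%:Z %| u0)%Z by apply: p_ndvd_add.
have pv0 : ~~ (p%:Z %| v0)%Z by rewrite /v0 -mulrN; apply: p_ndvd_add.
have DE : exists w0, 2 * k ^+ 2 - u0 ^+ 3 = 2 * k ^+ 2 - u ^+ 3 + (p ^ n)%N%:Z * w0.
  exists (- (w%:Z * (3 * u ^+ 2 + 3 * u * ((p ^ n)%N%:Z * w%:Z) +
    ((p ^ n)%N%:Z * w%:Z) ^+ 2))).
  by rewrite /u0; set y := (p ^ n)%N; ring.
have D0 i : (i <= n)%N -> ((p ^ i)%N%:Z %| 2 * k ^+ 2 - u0 ^+ 3)%Z =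
    ((p ^ i)%N%:Z %| 2 * k ^+ 2 - u ^+ 3)%Z.
  have [w0 ->] := DE; move=> le_i; rewrite rpredDr //.
  by rewrite dvdz_mulr // dvdzE !absz_nat dvdn_exp2l.
have pD0 : ((p ^ s)%N%:Z %| 2 * k ^+ 2 - u0 ^+ 3)%Z by rewrite D0.
have sD0 : (s < n)%N -> ~~ ((p ^ s.+1)%N%:Z %| 2 * k ^+ 2 - u0 ^+ 3)%Z.
  by move=> lt; rewrite D0 // sD.
set a0 := (A.`_p)%g; set b0 := (B.`_p)%g; set c0 := ([~ A, B].`_p)%g.
have CG : [~ A, B]%g \in G by rewrite groupR.
have relsP : mrels a b a0 b0 c0 := constt_mrels p nilG AG BG CG rels.
have defP : P :=: <<[set a0; b0]>>%g := constt_gen2 nilG defG sylP.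
have sPG : P \subset G by move: sylP; rewrite inE => /pHall_sub.
have [aP bP] : a0 \in P /\ b0 \in P by rewrite defP; split; [apply: relA_in | apply: relB_in].
have cP : c0 \in P by rewrite (mrels_comm relsP) groupR.
have cardP : #|P| = (p ^ logn p #|G|)%N.
  by move: sylP; rewrite inE => /card_Hall ->; rewrite p_part.
pose M := (logn p #|G| + 6 * n)%N.
have PM x : x \in P -> (x ^+ (p ^ M) = 1)%g.
  by move=> xP; rewrite expnD -cardP expgM expg_cardG // expg1n.
have card_ge : (p ^ (13 * n + s) <= #|P|)%N.
  (* The generators of the model are p-elements, so the map given by the universal property already
     sends the p-parts of A and B to them, and distinct normal forms pull back to P. *)
  have [hT [X [Z [W [relsX X1 Z1 inj]]]]] := p_model p_pr p_gt2 n_gt0 le_sn pu0 aE0 bE0 pD0.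
  have XT (x : hT) : (x ^+ (p ^ (6 * n).+1) = 1 -> x ^+ T = 1)%g.
    have le7 : ((6 * n).+1 <= 7 * n)%N by rewrite mulSn -add1n leq_add2r.
    move=> x1; have /dvdnP[q ->] := pT _ le7.
    by rewrite mulnC expgM x1 expg1n.
  have relX : Grels alpha beta X Z.
    apply/(Grels_mrels (zT _ _ (XT _ X1)).1 (zT _ _ (XT _ Z1)).2).
    by rewrite -(mrels_comm relsX).
  have [f [fA fB]] := univ hT X Z relX.
  have fa : f a0 = X := constt_morph_id p_pr AG fA X1.
  have fb : f b0 = Z := constt_morph_id p_pr BG fB Z1.
  have fc : f c0 = W.
    rewrite (mrels_comm relsP) morphR ?(subsetP sPG) // fa fb.
    by rewrite -(mrels_comm relsX).
  have -> : (p ^ (13 * n + s) = p ^ (5 * n + s) * p ^ (4 * n) * p ^ (4 * n))%N.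
    by rewrite -!expnD; congr (p ^ _)%N; clear; lia.
  apply: (card_ge_model (f := f) sPG aP bP cP).
  by move=> i j l i' j' l'; rewrite fa fb fc => *; apply: inj.
rewrite P2 in aE0 bE0.
have leM : (6 * n <= M)%N by rewrite leq_addl.
have [aM bM cM] := And3 (PM _ aP) (PM _ bP) (PM _ cP).
split.
- exact: (sylow_class p_pr p_gt2 n_gt0 relsP defP aE0 bE0 abE0 pu0 pv0 pk leM aM bM cM).
- exact: (sylow_card p_pr p_gt2 n_gt0 relsP defP aE0 bE0 abE0 pu0 pv0 pk leM aM bM cM).
- exact: (sylow_orderA p_pr p_gt2 n_gt0 relsP defP aE0 bE0 abE0 pu0 pv0 pk leM aM bM cM).
- exact: (sylow_orderB p_pr p_gt2 n_gt0 relsP defP aE0 bE0 abE0 pu0 pv0 pk leM aM bM cM).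
- exact: (sylow_orderC p_pr p_gt2 n_gt0 relsP defP aE0 bE0 abE0 pu0 pv0 pk leM aM bM cM).
Qed.

End PresentedSylow.

Lemma dvdz_vp p i (z : int) : prime p -> z != 0%R ->
  ((p ^ i)%N%:Z %| z)%Z = (i <= vp p z).
Proof. by move=> p_pr z0; rewrite dvdzE !absz_nat pfactor_dvdn // absz_gt0. Qed.

Theorem theorem7p1 (p : nat) (alpha beta : int) (gT : finGroupType)
    (G : {group gT}) (A B : gT) (m l : nat) (u k : int) :
  prime p ->
  alpha != 1%R -> beta != 1%R ->
  (3 < p \/ (p = 3 /\ (alpha %% 9)%Z != 7%Z /\ (beta %% 9)%Z != 7%Z)) ->
  presents alpha beta G A B ->
  vp p (alpha - 1)%R = m -> vp p (beta - 1)%R = m -> 0 < m ->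
  vp p (alpha - beta)%R = l -> 2 * l = 3 * m ->
  alpha = (1 + (p ^ m)%:Z * u)%R -> ~~ (p%:Z %| u)%Z ->
  (alpha - beta)%R = ((p ^ l)%:Z * k)%R -> ~~ (p%:Z %| k)%Z ->
  let D : int := (2 * k ^+ 2 - u ^+ 3)%R in
  let a := (A.`_p)%g in
  let b := (B.`_p)%g in
  let c := ([~ A, B].`_p)%g in
  forall P : {group gT}, (P \in 'Syl_p(G))%g ->
  [/\ nil_class P = (if (p%:Z %| D)%Z then 6 else 5),
      (* case 0 <= s <= m/2, where s = v_p(D) (finite) *)
      (D != 0%R -> vp p D <= m %/ 2 ->
         [/\ #|P| = p ^ (vp p D + 13 * (m %/ 2)),
             #[a]%g = p ^ (vp p D + 5 * (m %/ 2)),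
             #[b]%g = p ^ (vp p D + 5 * (m %/ 2)) &
             #[c]%g = p ^ (2 * m + vp p D)]) &
      (* case s >= m/2 (including s = infinity, i.e. D = 0) *)
      ((p ^ (m %/ 2))%:Z %| D)%Z ->
         [/\ #|P| = p ^ (7 * m),
             #[a]%g = p ^ (3 * m),
             #[b]%g = p ^ (3 * m) &
             #[c]%g = p ^ (5 * (m %/ 2))]].
Proof.
move=> p_pr _ _ p3 pres _ _ m_gt0 _ lm alE pu abE pk D a b c P sylP.
have p_gt2 : 2 < p by case: p3 => [/ltnW|[->]].
set n := m %/ 2; have mE : m = 2 * n by move: lm; rewrite /n; clear; lia.
have lE : l = 3 * n by move: lm; rewrite mE; clear; lia.
have n_gt0 : 0 < n by move: m_gt0; rewrite mE; clear; lia.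
rewrite mE lE in alE abE *.
(* Divisibility is tested first because [vp p 0] is 0 by convention, while D = 0 has to count as
   infinite valuation. *)
pose s := if ((p ^ n)%N%:Z %| D)%Z then n else vp p D.
have nD : ~~ ((p ^ n)%N%:Z %| D)%Z -> D != 0%R by apply: contraNneq => ->; rewrite dvdz0.
have [le_sn pD sD] : [/\ s <= n, ((p ^ s)%N%:Z %| D)%Z &
    s < n -> ~~ ((p ^ s.+1)%N%:Z %| D)%Z].
  rewrite /s; case: ifPn => [dn|ndn]; first by rewrite ltnn.
  have D0 := nD ndn; rewrite !dvdz_vp // ltnn leqnn; split=> //.
  by move: ndn; rewrite dvdz_vp // -ltnNge => /ltnW.
have [cl cP oa ob oc] :=
  presents_sylow p_pr p_gt2 n_gt0 le_sn pres alE abE pu pk sD pD sylP.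
have pDs : (p%:Z %| D)%Z = (0 < s).
  rewrite /s; case: ifPn => [dn|ndn]; last by rewrite -dvdz_vp ?nD // expn1.
  by rewrite n_gt0; apply: dvdz_trans dn; rewrite dvdzE !absz_nat dvdn_exp.
split; first by rewrite cl pDs.
- move=> D0 le_n; have sE : vp p D = s.
    rewrite /s; case: ifPn => //; rewrite dvdz_vp // => ge_n.
    by apply/eqP; rewrite eqn_leq le_n ge_n.
  rewrite sE cP oa ob oc; split; congr (p ^ _); clear; lia.
- move=> dn; have sE : s = n by rewrite /s dn.
  rewrite cP oa ob oc sE; split; congr (p ^ _); clear; lia.
Qed.
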